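(* 1. Let $G\in\mathcal{G}$. Then $\sharp(\hat{\mathcal{J}}_G)\leq\sharp(\mathcal{M}_{\Psi(G)})$. More precisely, there exists an injective map $\tilde{\Psi}:\hat{\mathcal{J}}_G\to\mathcal{M}_{\Psi(G)}$ such that if $J_1,J_2\in\mathcal{J}_G$ and $J_1<J_2$, then $\tilde{\Psi}(J_1)<_r\tilde{\Psi}(J_2)$. 2. If $G\in\mathcal{G}_{dis}$, then $M(\Psi(G))\subset\mathbb{R}$ and $M(\Psi(G))=J(\eta(\Psi(G)))$. 3. Let $G\in\mathcal{G}$. Then $\sharp(\hat{\mathcal{J}}_G)\leq\sharp(\hat{\mathcal{J}}_{\eta(\Psi(G))})$.
   Context: $\hat{\mathbb{C}}$ is the Riemann sphere. A polynomial semigroup is a semigroup, under composition, generated by a non-empty family of non-constant polynomial maps $\hat{\mathbb{C}}\to\hat{\mathbb{C}}$. The Fatou set $F(G)$ is the set of $z\in\hat{\mathbb{C}}$ having a neighborhood on which $G$ is a normal family; the Julia set is $J(G)=\hat{\mathbb{C}}\setminus F(G)$. $CV(g)$ is the set of critical values of $g:\hat{\mathbb{C}}\to\hat{\mathbb{C}}$, $P(G)=\overline{\bigcup_{g\in G}CV(g)}$ (closure in $\hat{\mathbb{C}}$), and $P^{\ast}(G)=P(G)\setminus\{\infty\}$. $\mathcal{G}$ is the set of all polynomial semigroups $G$ such that each element of $G$ has degree at least two and $P^{\ast}(G)$ is bounded in $\mathbb{C}$; $\mathcal{G}_{dis}$ is the set of $G\in\mathcal{G}$ with $J(G)$ disconnected.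 For any polynomial semigroup $G$, $\hat{\mathcal{J}}_G$ is the set of all connected components of $J(G)$, and $\mathcal{J}_G$ is the set of those contained in $\mathbb{C}$. For connected sets $K_1,K_2\subset\mathbb{C}$, $K_1\leq K_2$ means that $K_1=K_2$ or $K_1$ is included in a bounded component of $\mathbb{C}\setminus K_2$; $K_1<K_2$ means $K_1\leq K_2$ and $K_1\neq K_2$. For a polynomial $g$, $a(g)$ denotes the coefficient of its highest degree term. RA is the semigroup (under composition) of maps $x\mapsto ax+b$ on $\mathbb{R}$ with $a,b\in\mathbb{R}$, $a\neq0$; any subsemigroup of RA is called a real affine semigroup. For a non-constant polynomial $g$, $\Psi(g)\in$ RA is $\Psi(g)(x)=\deg(g)\,x+\log|a(g)|$; $\Psi(G)=\{\Psi(g)\mid g\in G\}$, which is a real affine semigroup. $\hat{\mathbb{R}}=\mathbb{R}\cup\{\pm\infty\}$ is the two-point compactification, with $\{(r,+\infty]\}_{r\in\mathbb{R}}$ a neighborhood base at $+\infty$ and $\{[-\infty,r)\}_{r\in\mathbb{R}}$ one at $-\infty$. For a real affine semigroup $H$, $M(H)=\overline{\{x\in\mathbb{R}\mid \exists h\in H,\ h(x)=x,\ |h'(x)|>1\}}\subset\hat{\mathbb{R}}$ (closure in $\hat{\mathbb{R}}$), and $\mathcal{M}_H$ is the set of all connected components of $M(H)$. For connected sets $M_1,M_2\subset\hat{\mathbb{R}}$, $M_1\leq_r M_2$ means $M_1=M_2$ or every $(x,y)\in M_1\times M_2$ satisfies $x<y$; $M_1<_rM_2$ means $M_1\leq_rM_2$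 and $M_1\neq M_2$. $\eta$ sends the real affine map $x\mapsto ax+b$ to the polynomial $z\mapsto az+b$ on $\hat{\mathbb{C}}$, and $\eta(H)=\{\eta(h)\mid h\in H\}$, a polynomial semigroup. *)

(* Defs.v *)
From mathcomp Require Import all_boot all_order all_algebra.
From mathcomp Require Import all_classical all_reals all_analysis.
From mathcomp Require Import complex.

Set Implicit Arguments.
Unset Strict Implicit.
Unset Printing Implicit Defensive.

Import Order.TTheory GRing.Theory Num.Theory.
Import numFieldNormedType.Exports.

Local Open Scope classical_set_scope.
Local Open Scope ring_scope.

(* The topology on the complex numbers is the norm topology carried by the
   regular algebra [R[i]^o], a type convertible to [R[i]]. *)
Notation cplane R := ((complex R)^o).
Notation rsphere R := (one_point_compactification (cplane R)).

Definition components (T : topologicalType) (A : set T) : set (set T) :=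
  [set connected_component A x | x in A].

Section PolynomialSemigroups.
Variable R : realType.
Local Notation C := (complex R).
Implicit Types (g : {poly C}) (G S : set {poly C}).

(* A non-constant polynomial map of the sphere is represented by its polynomial;
   [sphere_map] is only used on polynomials of degree at least one, which fix
   infinity. *)
Definition sphere_map g (p : rsphere R) : rsphere R :=
  if p is Some z then Some (g.[z] : cplane R) else None.

Inductive semigroup_generated S : set {poly C} :=
| generated_by g of S g : semigroup_generated S g
| generated_comp g h of semigroup_generated S g & semigroup_generated S h :
    semigroup_generated S (g \Po h).

Definition polynomial_semigroup G : Prop :=
  exists S, [/\ S !=set0, (forall g, S g -> (1 < size g)%N)
              & G = semigroup_generated S].

Definition chordal (p q : rsphere R) : R :=
  match p, q with
  | Some z, Some w => 2 * Normc.normc (z - w) /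
      (Num.sqrt (1 + Normc.normc z ^+ 2) * Num.sqrt (1 + Normc.normc w ^+ 2))
  | Some z, None | None, Some z => 2 / Num.sqrt (1 + Normc.normc z ^+ 2)
  | None, None => 0
  end.

(* Every sequence in [G] has a subsequence converging uniformly, for the
   spherical distance, on every compact subset of [U]; infinity is an allowed
   value of the limit. *)
Definition normal_on (U : set (rsphere R)) G : Prop :=
  forall u : nat -> {poly C}, (forall n, G (u n)) ->
  exists (phi : nat -> nat) (f : rsphere R -> rsphere R),
    {homo phi : m n / (m < n)%N} /\
    forall K : set (rsphere R), compact K -> K `<=` U ->
    forall e : R, 0 < e ->
    \forall n \near \oo, forall p, K p ->
      chordal (sphere_map (u (phi n)) p) (f p) < e.

Definition Fatou G : set (rsphere R) :=
  [set p | exists U, open_nbhs p U /\ normal_on U G].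

Definition Julia G : set (rsphere R) := ~` Fatou G.

(* At infinity, in the coordinate w = 1/z, a polynomial of degree d >= 1 reads
   w |-> w ^ d / q w with q 0 != 0; its derivative at w = 0 vanishes exactly
   when d >= 2. *)
Definition critical_points g : set (rsphere R) :=
  [set p | if p is Some c then root g^`() c else (2 < size g)%N].

Definition critical_values g : set (rsphere R) :=
  sphere_map g @` critical_points g.

Definition postcritical G : set (rsphere R) :=
  closure (\bigcup_(g in G) critical_values g).

Definition finite_part (A : set (rsphere R)) : set (cplane R) :=
  [set z | A (Some z)].

Definition calG G : Prop :=
  [/\ polynomial_semigroup G, (forall g, G g -> (2 < size g)%N)
    & bounded_set (finite_part (postcritical G))].

Definition calG_dis G : Prop := calG G /\ ~ connected (Julia G).

Definition Julia_components_hat G : set (set (rsphere R)) :=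
  components (Julia G).

Definition Julia_components G : set (set (rsphere R)) :=
  [set J | Julia_components_hat G J /\ ~ J None].

Definition surround_le (K1 K2 : set (cplane R)) : Prop :=
  K1 = K2 \/
  exists B, [/\ components (~` K2) B, bounded_set B & K1 `<=` B].

Definition surround_lt (K1 K2 : set (cplane R)) : Prop :=
  surround_le K1 K2 /\ K1 <> K2.

End PolynomialSemigroups.

(* A real affine map x |-> a x + b with a != 0 is represented by the polynomial
   of degree one with coefficients a and b; composition is [\Po]. *)
Section RealAffineSemigroups.
Variable R : realType.
Implicit Types (h : {poly R}) (H : set {poly R}).

Definition Psi (g : {poly complex R}) : {poly R} :=
  ((size g).-1)%:R *: 'X + (ln (Normc.normc (lead_coef g)))%:P.

Definition PsiS (G : set {poly complex R}) : set {poly R} := Psi @` G.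

Definition repelling_fixed_points H : set R :=
  [set x | exists h, [/\ H h, h.[x] = x & 1 < `|h^`().[x]|]].

Definition Mset H : set (\bar R) :=
  closure (EFin @` repelling_fixed_points H).

Definition M_components H : set (set (\bar R)) := components (Mset H).

Definition ler_sets (M1 M2 : set (\bar R)) : Prop :=
  M1 = M2 \/ forall x y, M1 x -> M2 y -> (x < y)%E.

Definition ltr_sets (M1 M2 : set (\bar R)) : Prop :=
  ler_sets M1 M2 /\ M1 <> M2.

Definition eta h : {poly complex R} := map_poly (real_complex R) h.

Definition etaS H : set {poly complex R} := eta @` H.

End RealAffineSemigroups.

(* Main.v *)
(** Fix [h] in [G] and write K(u) = u^-1(K(h)) for the preimage under [u] in [G]
    of the filled Julia set of [h]. Since the finite critical values of [G] are
    bounded, every K(u) is a connected compact set with connected complement, so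
    its boundary E(u) is connected; all K(u) share a point, and J(G) is the
    closure of the union of the E(u) (off that union the iterates h^k o u are
    bounded on a disc by Cauchy's estimates, or escape with a Harnack
    inequality). Let x(u) be the logarithmic capacity of K(u), which is the
    preimage under Psi(u) of the fixed point of Psi(h); then M(Psi(G)) is the
    closure of the set D of all x(u).

    If J(G) splits into two disjoint closed sets A and B, each E(u) lies on one
    side; sets K(v), K(w) on opposite sides are nested and at a definite
    distance, so scaling K(v) slightly keeps it inside K(w) and the numbers
    x(v), x(w) differ by at least a fixed amount. If D were unbounded, its
    invariance under the maps Psi(g)^-1, with fixed points arbitrarily far away,
    would make it dense in a half-line, which contradicts this gap; hence
    M(Psi(G)) is a bounded subset of the line. Sending a component of J(G) to
    the component of M(Psi(G)) that contains a limit of x(u), for E(u)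
    accumulating at a point of it, is injective by the gap and monotone by
    nestedness. When M(Psi(G)) is bounded, the affine maps eta(Psi(g)) are
    equicontinuous off it and their repelling fixed points are dense in it. *)

Require Import Defs.
From mathcomp Require Import all_boot all_order all_algebra.
From mathcomp Require Import all_classical all_reals all_analysis.
From mathcomp Require Import complex.
From mathcomp Require Import cyclic separable cyclotomic.
From mathcomp Require Import ring lra.

Set Implicit Arguments.
Unset Strict Implicit.
Unset Printing Implicit Defensive.

Import Order.TTheory GRing.Theory Num.Theory.
Import numFieldNormedType.Exports.

Local Open Scope classical_set_scope.
Local Open Scope ring_scope.

Local Notation nc := Normc.normc.
#[local] Arguments Normc.normc : simpl never.

(** * The complex modulus and the plane topology *)

Section Norm.
Variable R : realType.
Local Notation C := (complex R).
Implicit Types z w : C.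

(** All estimates are made on polynomials. K(u) is the decreasing intersection of the lemniscates
    |h^k o u| <= r, with r beyond every finite critical value; connectedness and capacity are
    settled for lemniscates, where capacity is an explicit expression in the degree and the leading
    coefficient, and pass to K(u) by compactness. This expression is what ties the plane to the
    affine maps Psi(u). One map h is kept fixed so that all K(u) share a point, a critical value of
    h: two of them with disjoint boundaries are then nested and cannot lie side by side. Infinity
    may belong to J(G), so one side of a splitting may be unbounded. The scaling estimate only
    involves the size of the inner set of a nested pair, and this set always lies in a disc
    containing the bounded side. The numbers x(u) may have many limits at one point of J(G). The
    limit attached to a component is an arbitrary choice: the gap separates all limits taken on
    different sides of a splitting, and injectivity asks for no more. *)

Lemma normcE' z : (`|z| : C) = (nc z)%:C%C.
Proof. by []. Qed.

Lemma nc_ge0 z : 0 <= nc z.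
Proof. by case: z => a b; exact: sqrtr_ge0. Qed.

Lemma nc_eq0 z : (nc z == 0) = (z == 0).
Proof.
by apply/eqP/eqP => [/Normc.eq0_normc//|->]; exact: Normc.normc0.
Qed.

Lemma nc_gt0 z : (0 < nc z) = (z != 0).
Proof. by rewrite lt_def nc_ge0 nc_eq0 andbT. Qed.

Lemma ncM z w : nc (z * w) = nc z * nc w.
Proof. exact: Normc.normcM. Qed.

Lemma ncN z : nc (- z) = nc z.
Proof. exact: normcN. Qed.

Lemma nc_le z w r s : nc z <= r -> nc w <= s -> nc (z + w) <= r + s.
Proof. by move=> zr ws; apply: le_trans (le_normcD _ _) _; exact: lerD. Qed.

Lemma ncD z w : nc (z + w) <= nc z + nc w.
Proof. exact: le_normcD. Qed.

Lemma ncB z w : nc (z - w) <= nc z + nc w.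
Proof. by rewrite -(ncN w); exact: le_normcD. Qed.

Lemma ncBC z w : nc (z - w) = nc (w - z).
Proof. by rewrite -ncN opprB. Qed.

Lemma nc_sub z w : nc z - nc w <= nc (z - w).
Proof. by rewrite lerBlDr -[X in nc X <= _](subrK w); exact: ncD. Qed.

Lemma nc_dist z w : `|nc z - nc w| <= nc (z - w).
Proof.
rewrite ler_norml nc_sub andbT lerNl opprB ncBC; exact: nc_sub.
Qed.

Lemma ncX z n : nc (z ^+ n) = nc z ^+ n.
Proof.
elim: n => [|n IH]; first by rewrite !expr0; exact: Normc.normc1.
by rewrite !exprS ncM IH.
Qed.

Lemma ncV z : nc z^-1 = (nc z)^-1.
Proof. exact: Normc.normcV. Qed.

Lemma nc_sum (I : Type) (s : seq I) (P : pred I) (F : I -> C) :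
  nc (\sum_(i <- s | P i) F i) <= \sum_(i <- s | P i) nc (F i).
Proof.
elim/big_rec2: _ => [|i x y _ le]; first by rewrite Normc.normc0.
by apply: le_trans (ncD _ _) _; rewrite lerD2l.
Qed.

Lemma nc_real (x : R) : nc x%:C%C = `|x|.
Proof. by rewrite /Normc.normc /= expr0n /= addr0 sqrtr_sqr. Qed.

Lemma nc0 : nc (0 : C) = 0. Proof. exact: Normc.normc0. Qed.
Lemma nc1 : nc (1 : C) = 1. Proof. exact: Normc.normc1. Qed.

Lemma nc_nat n : nc (n%:R : C) = n%:R.
Proof.
have -> : (n%:R : C) = (n%:R : R)%:C%C by rewrite rmorph_nat.
by rewrite nc_real ger0_norm.
Qed.

Lemma Re_le_nc z : `|complex.Re z| <= nc z.
Proof.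
case: z => a b; rewrite /Normc.normc /= -sqrtr_sqr ler_wsqrtr //.
by rewrite lerDl sqr_ge0.
Qed.

Lemma Im_le_nc z : `|complex.Im z| <= nc z.
Proof.
case: z => a b; rewrite /Normc.normc /= -sqrtr_sqr ler_wsqrtr //.
by rewrite lerDr sqr_ge0.
Qed.

Lemma nc_le_ReIm z : nc z <= `|complex.Re z| + `|complex.Im z|.
Proof.
rewrite [X in nc X]complexE; apply: le_trans (ncD _ _) _.
rewrite ncM !nc_real.
suff -> : nc ('i%C : C) = 1 by rewrite mul1r.
by rewrite /Normc.normc /= expr0n /= expr1n add0r sqrtr1.
Qed.

End Norm.

Section PlaneTopology.
Variable R : realType.
Local Notation C := (complex R).
Local Notation T := (cplane R).

Definition disc (z : C) (r : R) : set T := [set w | nc (w - z) < r].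

Lemma nbhs_disc (z : T) (A : set T) :
  nbhs z A <-> exists2 r : R, 0 < r & disc z r `<=` A.
Proof.
split.
  move=> /nbhs_ballP[e /= e0 eA].
  have ereal : e \is Num.real by rewrite gtr0_real.
  have eE := RRe_real ereal.
  exists (complex.Re e); first by move: e0; rewrite -eE ltcR.
  move=> w wz; apply: eA; rewrite -ball_normE /= -eE normcE' ltcR.
  by rewrite ncBC.
move=> [r r0 rA]; apply/nbhs_ballP; exists (r%:C%C : C) => /=.
  by rewrite ltcR.
move=> w; rewrite -ball_normE /= normcE' ltcR ncBC => wz; exact: rA.
Qed.

Lemma open_disc (z : C) (r : R) : open (disc z r).
Proof.
rewrite openE => w wz; apply/nbhs_disc; exists (r - nc (w - z)).
  by rewrite subr_gt0.
move=> v vw; rewrite /disc /=.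
have -> : v - z = (v - w) + (w - z) by rewrite addrA subrK.
by apply: le_lt_trans (ncD _ _) _; rewrite -ltrBrDr.
Qed.

Lemma disc_center (z : C) (r : R) : 0 < r -> disc z r z.
Proof. by move=> r0; rewrite /disc /= subrr nc0. Qed.

Lemma nbhs_disc_center (z : T) (r : R) : 0 < r -> nbhs z (disc z r).
Proof. by move=> r0; apply/nbhs_disc; exists r. Qed.

Lemma cont_disc (f : T -> T) (z : T) :
  (forall e : R, 0 < e -> exists2 r : R, 0 < r &
     forall w, nc (w - z) < r -> nc (f w - f z) < e) -> {for z, continuous f}.
Proof.
move=> H A /nbhs_disc[e e0 eA]; apply/nbhs_disc.
have [r r0 rH] := H e e0; exists r => // w /rH; exact: eA.
Qed.

Lemma poly_bounded_on (p : {poly C}) (r : R) :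
  exists2 M : R, 0 <= M & forall z, nc z <= r -> nc p.[z] <= M.
Proof.
elim/poly_ind: p => [|p c [M M0 IH]].
  by exists 0 => // z _; rewrite horner0 nc0.
exists (M * `|r| + nc c); first by rewrite addr_ge0 ?mulr_ge0 ?nc_ge0.
move=> z zr; rewrite !hornerE; apply: nc_le => //.
rewrite ncM ler_pM ?nc_ge0 ?IH //; exact: le_trans (ler_norm _).
Qed.

Lemma poly_lipschitz_on (p : {poly C}) (r : R) :
  exists2 L : R, 0 <= L & forall z w, nc z <= r -> nc w <= r ->
    nc (p.[z] - p.[w]) <= L * nc (z - w).
Proof.
elim/poly_ind: p => [|p c [L L0 IH]].
  by exists 0 => // z w _ _; rewrite !horner0 subrr nc0 mul0r.
have [M M0 MP] := poly_bounded_on p r.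
exists (L * `|r| + M); first by rewrite addr_ge0 ?mulr_ge0.
move=> z w zr wr; rewrite !hornerE.
have -> : p.[z] * z + c - (p.[w] * w + c) =
  (p.[z] - p.[w]) * z + p.[w] * (z - w) by ring.
rewrite [leRHS]mulrDl; apply: nc_le; rewrite ncM; last first.
  by rewrite ler_wpM2r ?nc_ge0 ?MP.
rewrite mulrAC ler_pM ?nc_ge0 ?IH //; exact: le_trans (ler_norm _).
Qed.

Lemma poly_cont_at (p : {poly C}) (z : C) (e : R) : 0 < e ->
  exists2 r : R, 0 < r & forall w, nc (w - z) < r -> nc (p.[w] - p.[z]) < e.
Proof.
move=> e0; have [L L0 LP] := poly_lipschitz_on p (nc z + 1).
exists (Num.min 1 (e / (L + 1))).
  by rewrite lt_min ltr01 divr_gt0 // ltr_wpDl.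
move=> w; rewrite lt_min => /andP[w1 wL].
have wz : nc w <= nc z + 1.
  rewrite -[w](subrK z) addrC; apply: nc_le => //; exact: ltW.
apply: le_lt_trans (LP _ _ wz _) _; first by rewrite lerDl.
move: wL; rewrite ltr_pdivlMr ?ltr_wpDl //; apply: le_lt_trans.
by rewrite mulrC ler_wpM2l ?nc_ge0 // lerDl.
Qed.

Lemma horner_cont (p : {poly C}) : continuous (fun z : T => p.[z] : T).
Proof. by move=> z; apply: cont_disc => e e0; exact: poly_cont_at. Qed.

Lemma cont_discR (f : T -> R) (z : T) :
  (forall e : R, 0 < e -> exists2 r : R, 0 < r &
     forall w, nc (w - z) < r -> `|f w - f z| < e) -> {for z, continuous f}.
Proof.
move=> H A /nbhs_ballP[e /= e0 eA]; apply/nbhs_disc.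
have [r r0 rH] := H e e0; exists r => // w /rH wz; apply: eA.
by rewrite -ball_normE /= distrC.
Qed.

Lemma nc_cont : continuous (fun z : T => nc z : R).
Proof.
move=> z; apply: cont_discR => e e0; exists e => // w; apply: le_lt_trans.
exact: nc_dist.
Qed.

Lemma nc_horner_cont (p : {poly C}) : continuous (fun z : T => nc p.[z] : R).
Proof.
move=> z; apply: (@continuous_comp _ _ _ (fun z : T => p.[z] : T) (fun z => nc z)).
  exact: horner_cont.
exact: nc_cont.
Qed.

Lemma open_lt_cont (f : T -> R) (s : R) : continuous f -> open [set z | f z < s].
Proof. by move=> cf; apply: (@open_comp _ _ f [set x | x < s]) ; [move=> ? _; exact: cf | exact: open_lt]. Qed.

Lemma open_gt_cont (f : T -> R) (s : R) : continuous f -> open [set z | s < f z].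
Proof. by move=> cf; apply: (@open_comp _ _ f [set x | x > s]) ; [move=> ? _; exact: cf | exact: open_gt]. Qed.

Lemma closed_le_cont (f : T -> R) (s : R) : continuous f -> closed [set z | f z <= s].
Proof. by move=> cf; apply: (@closed_comp _ _ f [set x | x <= s]) ; [move=> ? _; exact: cf | exact: closed_le]. Qed.

Lemma closed_ge_cont (f : T -> R) (s : R) : continuous f -> closed [set z | s <= f z].
Proof. by move=> cf; apply: (@closed_comp _ _ f [set x | x >= s]) ; [move=> ? _; exact: cf | exact: closed_ge]. Qed.

Definition cdisc (z : C) (r : R) : set T := [set w | nc (w - z) <= r].

Lemma dist_cont (z : C) : continuous (fun w : T => nc (w - z) : R).
Proof.
move=> w; apply: cont_discR => e e0; exists e => // v; apply: le_lt_trans.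
have -> : v - w = (v - z) - (w - z) by rewrite opprB addrA subrK.
exact: nc_dist.
Qed.

Lemma closed_cdisc (z : C) (r : R) : closed (cdisc z r).
Proof. exact/closed_le_cont/dist_cont. Qed.

Lemma compact_square (b : R) :
  compact [set z : T | `|complex.Re z| <= b /\ `|complex.Im z| <= b].
Proof.
pose f (x : R * R) : T := Complex x.1 x.2.
have cf : continuous f.
  move=> x A /nbhs_disc[e e0 eA].
  have e20 : 0 < e / 2 by rewrite divr_gt0.
  exists ([set y | `|y - x.1| < e / 2], [set y | `|y - x.2| < e / 2]) => /=.
    split; apply/nbhs_ballP; exists (e / 2) => // y;
      by rewrite -ball_normE /= distrC.
  move=> -[y1 y2] [/= h1 h2]; apply: eA; rewrite /disc /=.
  apply: le_lt_trans (nc_le_ReIm _) _ => /=.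
  by rewrite [e]splitr ltrD.
have := continuous_compact _ (compact_setX (@segment_compact R (- b) b) (@segment_compact R (- b) b)).
move=> /(_ _ f); rewrite (_ : f @` _ = [set z : T | `|complex.Re z| <= b /\ `|complex.Im z| <= b]).
  by apply; exact: continuous_subspaceT.
apply/seteqP; split => [_ [[x y] [/= + +] <-]|[x y] /= [xb yb]].
  by rewrite !in_itv /= -!ler_norml.
by exists (x, y) => //; split; rewrite /= in_itv /= -ler_norml.
Qed.

Lemma closed_bounded_compact (A : set T) (b : R) :
  closed A -> (forall z, A z -> nc z <= b) -> compact A.
Proof.
move=> cA Ab; apply: (subclosed_compact cA (@compact_square b)) => z /Ab zb.
by split; apply: le_trans zb; [exact: Re_le_nc|exact: Im_le_nc].
Qed.

Lemma compact_cdisc (z : C) (r : R) : compact (cdisc z r).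
Proof.
apply: (closed_bounded_compact (b := r + nc z)); first exact: closed_cdisc.
move=> w wz; rewrite -[w](subrK z); exact: nc_le.
Qed.

End PlaneTopology.

(** * Local behaviour and growth of polynomials *)

Section PolyAnalysis.
Variable R : realType.
Local Notation C := (complex R).
Local Notation T := (cplane R).
Implicit Types (p q N D : {poly C}).

Lemma poly_rootsP p : exists2 rs : seq C, size rs = (size p).-1 &
  forall z, p.[z] = lead_coef p * \prod_(t <- rs) (z - t).
Proof.
have [rs E] := closed_field_poly_normal p.
have H z : p.[z] = lead_coef p * \prod_(t <- rs) (z - t).
  rewrite {1}E hornerZ horner_prod; congr (_ * _).
  by apply: eq_bigr => t _; rewrite hornerXsubC.
have [p0|p0] := eqVneq p 0.
  by exists [::] => [|z]; rewrite p0 ?size_poly0 // lead_coef0 mul0r horner0.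
exists rs => //; rewrite E size_scale ?lead_coef_eq0 //.
by rewrite size_prod_XsubC.
Qed.

Lemma nc_prod_ge (rs : seq C) (F : C -> C) (b : R) : 0 <= b ->
  (forall t, t \in rs -> b <= nc (F t)) ->
  b ^+ size rs <= nc (\prod_(t <- rs) F t).
Proof.
move=> b0; elim: rs => [|t rs IH] H; first by rewrite big_nil nc1 expr0.
rewrite big_cons ncM exprS ler_pM ?exprn_ge0 //.
  by apply: H; rewrite mem_head.
by apply: IH => u us; apply: H; rewrite in_cons us orbT.
Qed.

Lemma nc_prod_le (rs : seq C) (F : C -> C) (b : R) :
  (forall t, t \in rs -> nc (F t) <= b) ->
  nc (\prod_(t <- rs) F t) <= b ^+ size rs.
Proof.
elim: rs => [|t rs IH] H; first by rewrite big_nil nc1 expr0.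
rewrite big_cons ncM exprS ler_pM ?nc_ge0 //.
  by apply: H; rewrite mem_head.
by apply: IH => u us; apply: H; rewrite in_cons us orbT.
Qed.

Lemma lead_neq0 p : (1 < size p)%N -> lead_coef p != 0.
Proof. by move=> p1; rewrite lead_coef_eq0 -size_poly_gt0 (leq_trans _ p1). Qed.

Lemma seq_argmin (f : C -> R) (rs : seq C) : (0 < size rs)%N ->
  exists2 t, t \in rs & forall u, u \in rs -> f t <= f u.
Proof.
elim: rs => // t [_ _|u rs /(_ isT)[v vrs vmin] _].
  by exists t => [|u]; rewrite inE // => /eqP ->.
have [tv|vt] := leP (f t) (f v).
  exists t; first exact: mem_head.
  by move=> w; rewrite inE => /predU1P[->//|/vmin]; exact: le_trans.
exists v; first by rewrite inE vrs orbT.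
by move=> w; rewrite inE => /predU1P[->|/vmin//]; exact: ltW.
Qed.

(** In the factorisation of p - w over its roots, every factor |z - t| is at least the distance from
    z to the nearest root. *)
Lemma root_near p z w : (1 < size p)%N ->
  exists2 t, p.[t] = w &
    nc (lead_coef p) * nc (z - t) ^+ (size p).-1 <= nc (p.[z] - w).
Proof.
move=> p1; have lp := lead_neq0 p1.
pose q := p - w%:P.
have sq : size q = size p.
  by rewrite size_polyDl // size_polyN (leq_ltn_trans (size_polyC_leq1 _)).
have lq : lead_coef q = lead_coef p.
  by rewrite lead_coefDl // size_polyN (leq_ltn_trans (size_polyC_leq1 _)).
have qz u : q.[u] = p.[u] - w by rewrite !hornerE.
have [rs srs rsP] := poly_rootsP q.
have n0 : (0 < size rs)%N by rewrite srs sq -ltnS prednK // (leq_trans _ p1).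
have [t trs tmin] := seq_argmin (fun t => nc (z - t)) n0.
exists t.
  apply/eqP; rewrite -subr_eq0 -qz rsP (perm_big _ (perm_to_rem trs)) big_cons.
  by rewrite /= subrr mul0r mulr0.
rewrite -qz rsP lq ncM ler_wpM2l ?nc_ge0 //.
by rewrite -sq -srs; apply: nc_prod_ge => //; exact: nc_ge0.
Qed.

(** The open mapping property at z; the extremum principles for |p| and the local inverses of [p]
    come from it. *)
Lemma poly_small_root p z (e : R) : (1 < size p)%N -> 0 < e ->
  exists2 d : R, 0 < d & forall w, nc (p.[z] - w) < d ->
    exists2 t, p.[t] = w & nc (t - z) < e.
Proof.
move=> p1 e0; have lp : 0 < nc (lead_coef p) by rewrite nc_gt0 lead_neq0.
exists (nc (lead_coef p) * e ^+ (size p).-1).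
  by rewrite mulr_gt0 ?exprn_gt0.
move=> w wd; have [t tw H] := root_near z w p1; exists t => //.
have := le_lt_trans H wd; rewrite ltr_pM2l // ncBC.
by rewrite ltr_pXn2r ?nnegrE ?nc_ge0 ?(ltW e0) // -ltnS prednK // (leq_trans _ p1).
Qed.

Lemma nc_scale_real (x : R) (z : C) : 0 <= x -> nc (x%:C%C * z) = x * nc z.
Proof. by move=> x0; rewrite ncM nc_real ger0_norm. Qed.

(** By openness, [p] takes near z a value slightly further out on the ray through [p.[z]]. *)
Lemma poly_no_local_max p z (e : R) : (1 < size p)%N -> 0 < e ->
  exists2 t, nc (t - z) < e & nc p.[z] < nc p.[t].
Proof.
move=> p1 e0; have [d d0 dP] := poly_small_root z p1 e0.
have [pz|pz] := eqVneq p.[z] 0.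
  have [|t tw te] := dP (d / 2)%:C%C.
    by rewrite pz sub0r ncN nc_real ger0_norm ?divr_ge0 1?ltW ?ltr_pdivrMr //
       ?mulr_gt0 // ltr_pMr // ltr1n.
  exists t => //; rewrite pz tw nc0 nc_real gtr0_norm ?divr_gt0 //.
pose x := d / (2 * nc p.[z]).
have pz0 : 0 < nc p.[z] by rewrite nc_gt0.
have x0 : 0 < x by rewrite divr_gt0 // mulr_gt0.
have [|t tw te] := dP ((1 + x)%:C%C * p.[z]).
  rewrite rmorphD rmorph1 mulrDl mul1r opprD addrA subrr sub0r ncN.
  rewrite nc_scale_real ?ltW // /x invfM mulrA mulfVK ?gt_eqF //.
  by rewrite ltr_pdivrMr // ltr_pMr // ltr1n.
exists t => //; rewrite tw nc_scale_real ?addr_ge0 ?ltW //.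
by rewrite ltr_pMl // ltrDl.
Qed.

Lemma poly_no_local_min p z (e : R) : (1 < size p)%N -> 0 < e -> p.[z] != 0 ->
  exists2 t, nc (t - z) < e & nc p.[t] < nc p.[z].
Proof.
move=> p1 e0 pz; have [d d0 dP] := poly_small_root z p1 e0.
have pz0 : 0 < nc p.[z] by rewrite nc_gt0.
pose x := Num.min (1 / 2) (d / (2 * nc p.[z])).
have x0 : 0 < x by rewrite lt_min !divr_gt0 // mulr_gt0.
have x1 : x <= 1 / 2 by rewrite ge_min lexx.
have x2 : x <= d / (2 * nc p.[z]) by rewrite ge_min lexx orbT.
have [|t tw te] := dP ((1 - x)%:C%C * p.[z]).
  rewrite rmorphB rmorph1 mulrBl mul1r opprB addrC subrK.
  rewrite nc_scale_real ?ltW //.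
  rewrite (@le_lt_trans _ _ (d / 2)) //; last by rewrite ltr_pdivrMr // ltr_pMr // ltr1n.
  by move: x2; rewrite invfM mulrA ler_pdivlMr.
exists t => //; rewrite tw nc_scale_real; last by lra.
by rewrite gtr_pMl //; lra.
Qed.

(** With c = N(z)/D(z), write N - cD = (X - z)^k q where q(z) <> 0. A step of size rho in a
    direction xi with xi^k = N(z)/q(z) multiplies N/D by 1 + rho^k to leading order. *)
Lemma rational_no_local_max N D z (e : R) : 0 < e ->
  N.[z] != 0 -> D.[z] != 0 -> (forall c, N <> c *: D) ->
  exists2 t, nc (t - z) < e & nc N.[z] * nc D.[t] < nc N.[t] * nc D.[z].
Proof.
move=> e0 Nz Dz ND; pose c := N.[z] / D.[z].
have Q0 : N - c *: D != 0 by apply/eqP => /subr0_eq; exact: ND.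
have [k [q /implyP/(_ Q0) qz Q]] := multiplicity_XsubC (N - c *: D) z.
have k0 : (0 < k)%N.
  rewrite lt0n; apply/eqP => k0; move: qz.
  rewrite rootE (_ : q = N - c *: D); last by rewrite Q k0 expr0 mulr1.
  by rewrite !hornerE /c mulfVK // subrr eqxx.
rewrite rootE in qz.
have [xi xiP] : exists xi : C, xi ^+ k = N.[z] / q.[z].
  have /closed_rootP[x xP] : size ('X^k - (N.[z] / q.[z])%:P : {poly C}) != 1%N.
    by rewrite size_XnsubC // eqSS -lt0n.
  by exists x; move: xP; rewrite rootE !hornerE subr_eq0 => /eqP.
(* These give N(t) D(z) = A(t) + rho^k (A(t) + W(t)), where the error [W] vanishes at z. *)
pose A := N.[z] *: D; pose W := (N.[z] * D.[z] / q.[z]) *: q - A.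
have Az : A.[z] != 0 by rewrite !hornerE mulf_neq0.
have Wz : W.[z] = 0 by rewrite !hornerE mulfVK // subrr.
have h0 : 0 < nc A.[z] / 2 by rewrite divr_gt0 // nc_gt0.
have [r1 r10 r1P] := poly_cont_at A z h0.
have [r2 r20 r2P] := poly_cont_at W z h0.
pose m := Num.min (Num.min r1 r2) e.
have m0 : 0 < m by rewrite !lt_min r10 r20.
pose rho := m / (2 * (nc xi + 1)).
have rho0 : 0 < rho by rewrite divr_gt0 // mulr_gt0 // ltr_wpDl ?nc_ge0.
pose t := z + rho%:C%C * xi.
have tzE : t - z = rho%:C%C * xi by rewrite /t addrAC subrr add0r.
have tz : nc (t - z) < m.
  rewrite tzE nc_scale_real ?ltW // /rho mulrAC ltr_pdivrMr; last first.
    by rewrite mulr_gt0 // ltr_wpDl ?nc_ge0.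
  rewrite ltr_pM2l //; have := nc_ge0 xi; lra.
have tP i : m <= i -> nc (t - z) < i by exact: lt_le_trans.
have t1 := r1P t (tP _ _); have t2 := r2P t (tP _ _).
exists t; first by apply: tP; rewrite ge_min lexx orbT.
have {}t1 : nc (A.[t] - A.[z]) < nc A.[z] / 2 by apply: t1; rewrite !ge_min lexx.
have {}t2 : nc W.[t] < nc A.[z] / 2.
  by move: t2; rewrite Wz subr0; apply; rewrite !ge_min lexx orbT.
have At : nc A.[z] / 2 < nc A.[t].
  rewrite ncBC in t1; have := nc_sub A.[z] A.[t]; lra.
have -> : nc N.[z] * nc D.[t] = nc A.[t] by rewrite !hornerE ncM.
rewrite -ncM.
have -> : N.[t] * D.[z] = A.[t] + (rho ^+ k)%:C%C * (A.[t] + W.[t]).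
  have E : N.[t] = q.[t] * (rho%:C%C * xi) ^+ k + c * D.[t].
    have /eqP := congr1 (horner^~ t) Q.
    rewrite hornerD hornerN hornerZ hornerM horner_exp hornerXsubC tzE.
    by rewrite subr_eq => /eqP.
  rewrite E exprMn xiP /A /W hornerD hornerN !hornerZ rmorphXn /c /=.
  by field; rewrite qz Dz.
have rk : 0 < rho ^+ k by rewrite exprn_gt0.
have -> : A.[t] + (rho ^+ k)%:C%C * (A.[t] + W.[t]) =
   (1 + rho ^+ k)%:C%C * A.[t] - (- ((rho ^+ k)%:C%C * W.[t])).
  by rewrite rmorphD rmorph1; ring.
apply: lt_le_trans (nc_sub _ _).
rewrite ncN !nc_scale_real ?addr_ge0 ?ltW // mulrDl mul1r.
by rewrite -addrA ltrDl -mulrBr mulr_gt0 // subr_gt0 (lt_trans t2).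
Qed.

End PolyAnalysis.

Section Growth.
Variable R : realType.
Local Notation C := (complex R).
Local Notation T := (cplane R).
Implicit Types (p q N D : {poly C}).

Lemma seq_bound (rs : seq C) : exists2 r : R, 0 <= r & forall t, t \in rs -> nc t <= r.
Proof.
elim: rs => [|t rs [r r0 H]]; first by exists 0.
exists (nc t + r); first by rewrite addr_ge0 ?nc_ge0.
move=> u; rewrite inE => /predU1P[->|/H ur]; first by rewrite lerDl.
by rewrite (le_trans ur) // lerDr nc_ge0.
Qed.

Lemma poly_upper p : exists2 c : R, 0 < c & forall z, 1 <= nc z ->
  nc p.[z] <= c * nc z ^+ (size p).-1.
Proof.
have [rs srs rsP] := poly_rootsP p; have [r r0 rP] := seq_bound rs.
exists (nc (lead_coef p) * (1 + r) ^+ (size p).-1 + 1).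
  by rewrite ltr_wpDl // mulr_ge0 ?nc_ge0 ?exprn_ge0 ?addr_ge0.
move=> z z1; rewrite mulrDl ler_wpDr ?mul1r ?exprn_ge0 ?nc_ge0 //.
rewrite rsP ncM -mulrA ler_wpM2l ?nc_ge0 // -exprMn -srs.
apply: nc_prod_le => t /rP tr; apply: le_trans (ncB _ _) _.
rewrite mulrDl mul1r lerD2l (le_trans tr) // ler_peMr //.
Qed.

Lemma poly_lower p : p != 0 -> exists2 c : R, 0 < c &
  exists2 r : R, 1 <= r & forall z, r <= nc z -> c * nc z ^+ (size p).-1 <= nc p.[z].
Proof.
move=> p0; have [rs srs rsP] := poly_rootsP p; have [r r0 rP] := seq_bound rs.
exists (nc (lead_coef p) * 2^-1 ^+ (size p).-1).
  by rewrite mulr_gt0 ?exprn_gt0 ?invr_gt0 // nc_gt0 lead_coef_eq0.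
exists (2 * r + 1); first by lra.
move=> z rz; rewrite rsP ncM -mulrA ler_wpM2l ?nc_ge0 // -exprMn -srs.
apply: nc_prod_ge => [|t /rP tr]; first by rewrite mulr_ge0 ?invr_ge0 ?nc_ge0.
apply: le_trans (nc_sub _ _); lra.
Qed.

Lemma exprn_unbounded (x M : R) : 1 < x -> exists k, M < x ^+ k.
Proof.
move=> x1.
have y0 : 0 < x - 1 by rewrite subr_gt0.
have H k : 1 + k%:R * (x - 1) <= x ^+ k.
  elim: k => [|k IH]; first by rewrite mul0r addr0.
  rewrite exprS.
  apply: le_trans (ler_wpM2l (ltW (lt_trans ltr01 x1)) IH).
  rewrite -natr1; have : 0 <= k%:R * (x - 1) * (x - 1) by rewrite !mulr_ge0 // ltW.
  by nra.
exists (Num.truncn (`|M| / (x - 1))).+1.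
apply: lt_le_trans (H _).
rewrite (@le_lt_trans _ _ `|M|) ?ler_norm // ltr_pwDl //.
by rewrite -ler_pdivrMr //; apply: ltW; exact: truncnS_gt.
Qed.

Lemma poly_ratio_small N D (e : R) : (size N < size D)%N -> 0 < e ->
  exists r : R, forall z, r <= nc z -> nc N.[z] <= e * nc D.[z].
Proof.
move=> ND e0.
have D0 : D != 0 by rewrite -size_poly_gt0 (leq_trans _ ND).
have [N0|N0] := eqVneq N 0.
  by exists 0 => z _; rewrite N0 horner0 nc0 mulr_ge0 ?nc_ge0 // ltW.
have [c c0 cP] := poly_upper N; have [d d0 [r r1 dP]] := poly_lower D0.
exists (Num.max r (c / (e * d))) => z; rewrite ge_max => /andP[rz cz].
have z1 : 1 <= nc z by exact: le_trans rz.
apply: (le_trans (cP _ z1)).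
apply: (@le_trans _ _ (e * (d * nc z ^+ (size D).-1))); last first.
  by rewrite ler_wpM2l ?(ltW e0) // dP.
have -> : (size D).-1 = ((size N).-1 + ((size D).-1 - (size N).-1))%N.
  by rewrite subnKC // -ltnS !prednK ?size_poly_gt0 // ltnW.
rewrite exprD !mulrA [e * d * _]mulrC -!mulrA [c * _]mulrC ler_wpM2l ?exprn_ge0 ?nc_ge0 //.
have : (0 < (size D).-1 - (size N).-1)%N.
  by rewrite subn_gt0 -ltnS !prednK ?size_poly_gt0 // size_poly_gt0.
case: (_ - _)%N => // k _; rewrite exprS.
have := cz; rewrite ler_pdivrMr ?mulr_gt0 // => H; apply: (le_trans H).
rewrite [_ * (e * d)]mulrC mulrA ler_wpM2l ?(ltW (mulr_gt0 e0 d0)) //.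
by rewrite ler_peMr ?nc_ge0 // exprn_ege1.
Qed.

Lemma poly_tends_infty p (M : R) : (1 < size p)%N ->
  exists2 r : R, 0 < r & forall z, r <= nc z -> M <= nc p.[z].
Proof.
move=> p1; have e0 : 0 < (`|M| + 1)^-1 by rewrite invr_gt0 ltr_wpDl.
have := @poly_ratio_small 1 p _ _ e0; rewrite size_poly1 => /(_ p1)[r rP].
exists (`|r| + 1); first by rewrite ltr_wpDl.
move=> z rz; have := rP z; rewrite hornerC nc1 => H.
have {}rz : r <= nc z by apply: le_trans rz; have := ler_norm r; lra.
have {H} := H rz; rewrite mulrC ler_pdivlMr ?ltr_wpDl // mul1r.
have := ler_norm M; lra.
Qed.

Lemma nc_exists (r : R) : 0 <= r -> exists z : C, nc z = r.
Proof. by move=> r0; exists r%:C%C; rewrite nc_real ger0_norm. Qed.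

(** Far from 0 each polynomial is its leading monomial up to e |z|^n; with e a third of the supposed
    excess, two such errors cannot make up for it. *)
Lemma lead_coef_le N D (r : R) : size N = size D ->
  (forall z, r <= nc z -> nc N.[z] <= nc D.[z]) ->
  nc (lead_coef N) <= nc (lead_coef D).
Proof.
move=> ND H; have [D0|D0] := eqVneq D 0.
  have /eqP -> : N == 0 by rewrite -size_poly_eq0 ND D0 size_poly0.
  by rewrite lead_coef0 nc0 nc_ge0.
have N0 : N != 0 by rewrite -size_poly_gt0 ND size_poly_gt0.
set n := (size D).-1.
have small (P : {poly C}) : P != 0 -> size P = n.+1 -> (size (P - lead_coef P *: 'X^n)%R < size ('X^n : {poly C})%R)%N.
  move=> P0 sP; rewrite size_polyXn ltnS; apply/leq_sizeP => j nj.
  rewrite coefB coefZ coefXn; move: nj; rewrite leq_eqVlt => /predU1P[<-|nj].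
    by rewrite eqxx mulr1 lead_coefE sP subrr.
  by rewrite gtn_eqF // mulr0 subr0 nth_default // sP.
have sD : size D = n.+1 by rewrite prednK // size_poly_gt0.
rewrite leNgt; apply/negP => lt.
pose e := (nc (lead_coef N) - nc (lead_coef D)) / 3.
have e0 : 0 < e by rewrite divr_gt0 // subr_gt0.
have [r1 H1] := poly_ratio_small (small _ N0 (etrans ND sD)) e0.
have [r2 H2] := poly_ratio_small (small _ D0 sD) e0.
pose s := `|r| + `|r1| + `|r2| + 1.
have s0 : 0 < s by rewrite ltr_wpDl // !addr_ge0.
have [z zs] := nc_exists (ltW s0).
have /= := (ler_norm r, ler_norm r1, ler_norm r2) => -[[hr hr1] hr2].
have [nr nr1 nr2] := And3 (normr_ge0 r) (normr_ge0 r1) (normr_ge0 r2).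
have {}H : nc N.[z] <= nc D.[z] by apply: H; rewrite zs /s; lra.
have {}H1 := H1 z; have {}H2 := H2 z.
have {}H1 : nc (N.[z] - lead_coef N * z ^+ n) <= e * nc (z ^+ n).
  have := H1 _; rewrite !hornerE => -> //; rewrite zs /s; lra.
have {}H2 : nc (D.[z] - lead_coef D * z ^+ n) <= e * nc (z ^+ n).
  have := H2 _; rewrite !hornerE => -> //; rewrite zs /s; lra.
have zn : 0 < nc (z ^+ n) by rewrite ncX zs exprn_gt0.
have h1 := nc_sub (lead_coef N * z ^+ n) N.[z]; rewrite ncBC in h1.
have h2 := nc_sub D.[z] (lead_coef D * z ^+ n).
rewrite !ncM in h1 h2.
have : (nc (lead_coef N) - nc (lead_coef D) - 2 * e) * nc (z ^+ n) <= 0 by lra.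
by apply/negP; rewrite -ltNge mulr_gt0 // /e; lra.
Qed.

End Growth.

(** * Maximum principles and capacity *)

Section MaxPrinciple.
Variable R : realType.
Local Notation C := (complex R).
Local Notation T := (cplane R).
Implicit Types (p q N D : {poly C}).

Lemma compact_argmax (A : set T) (f : T -> R) : A !=set0 -> compact A ->
  (forall z, A z -> {for z, continuous f}) ->
  exists2 z, A z & forall w, A w -> f w <= f z.
Proof.
move=> A0 cA cf; have [|z zA zP] := compact_EVT_max A0 cA (f := f).
  by apply: continuous_in_subspaceT => z /set_mem; exact: cf.
exists z; first exact: set_mem.
by move=> w Aw; apply: zP; exact: mem_set.
Qed.

Lemma compact_argmin (A : set T) (f : T -> R) : A !=set0 -> compact A ->
  (forall z, A z -> {for z, continuous f}) ->
  exists2 z, A z & forall w, A w -> f z <= f w.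
Proof.
move=> A0 cA cf; have [|z zA zP] := compact_EVT_min A0 cA (f := f).
  by apply: continuous_in_subspaceT => z /set_mem; exact: cf.
exists z; first exact: set_mem.
by move=> w Aw; apply: zP; exact: mem_set.
Qed.

Lemma open_near (A : set T) z : open A -> A z ->
  exists2 e : R, 0 < e & forall w, nc (w - z) < e -> A w.
Proof. by move=> oA Az; apply/nbhs_disc/open_nbhs_nbhs. Qed.

Lemma closure_disc (A : set T) z : closure A z <->
  forall e : R, 0 < e -> exists2 w, A w & nc (w - z) < e.
Proof.
split=> [cA e e0|H B /nbhs_disc[e e0 eB]].
  by have [w [Aw wz]] := cA _ (nbhs_disc_center z e0); exists w.
by have [w Aw wz] := H e e0; exists w; split => //; exact: eB.
Qed.

Lemma closure_bounded (A : set T) (b : R) :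
  (forall z, A z -> nc z <= b) -> forall z, closure A z -> nc z <= b.
Proof.
move=> H z cz; have : closed [set z : T | nc z <= b] by apply/closed_le_cont/nc_cont.
move=> /closure_id E; have := closureS H cz.
by rewrite -[closure _]E.
Qed.

(** The minimum of |p| on the compact closure of [O] is below s, hence attained inside, where only a
    root can be a minimum. *)
Lemma min_principle_root p (O : set T) (b s : R) z0 : (1 < size p)%N ->
  open O -> (forall z, O z -> nc z <= b) -> O z0 -> nc p.[z0] < s ->
  (forall z, closure O z -> ~ O z -> s <= nc p.[z]) ->
  exists2 t, O t & p.[t] = 0.
Proof.
move=> p1 oO Ob Oz0 z0s bd.
have cO : compact (closure O).
  apply: (closed_bounded_compact (b := b)); first exact: closed_closure.
  exact: closure_bounded.
have O0 : closure O !=set0 by exists z0; apply: subset_closure.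
have [z cz zmin] := compact_argmin O0 cO (fun z _ => @nc_horner_cont R p z).
have Oz : O z.
  apply: contrapT => /(bd _ cz); apply/negP; rewrite -ltNge.
  by apply: le_lt_trans z0s; apply: zmin; exact: subset_closure.
exists z => //; apply/eqP; apply: contraT => pz.
have [e e0 eO] := open_near oO Oz.
have [t te] := poly_no_local_min p1 e0 pz.
move=> lt; have /= := zmin t (subset_closure (eO t te)).
by rewrite leNgt lt.
Qed.

Lemma max_principle_bounded p (O : set T) (b s : R) z0 : (1 < size p)%N ->
  open O -> (forall z, O z -> nc z <= b) -> O z0 -> s < nc p.[z0] ->
  (forall z, closure O z -> ~ O z -> nc p.[z] <= s) -> False.
Proof.
move=> p1 oO Ob Oz0 z0s bd.
have cO : compact (closure O).
  apply: (closed_bounded_compact (b := b)); first exact: closed_closure.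
  exact: closure_bounded.
have O0 : closure O !=set0 by exists z0; apply: subset_closure.
have [z cz zmax] := compact_argmax O0 cO (fun z _ => @nc_horner_cont R p z).
have Oz : O z.
  apply: contrapT => /(bd _ cz); apply/negP; rewrite -ltNge.
  by apply: (lt_le_trans z0s); apply: zmax; exact: subset_closure.
have [e e0 eO] := open_near oO Oz.
have [t te] := poly_no_local_max z p1 e0.
move=> lt; have /= := zmax t (subset_closure (eO t te)).
by rewrite leNgt lt.
Qed.

Lemma ratio_cont N D (z : T) : D.[z] != 0 ->
  {for z, continuous (fun w : T => nc N.[w] / nc D.[w])}.
Proof.
move=> Dz; have cN := @nc_horner_cont R N z.
have cD := @nc_horner_cont R D z.
have cV : {for z, continuous (fun w : T => (nc D.[w])^-1)}.
  by apply: (cvgV _ cD); rewrite nc_eq0.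
exact: (cvgM cN cV).
Qed.

(* The maximum principle applies to [N / D] because it tends to 0 at infinity. *)
Lemma max_principle_exterior p N D (s c : R) : (size N < size D)%N -> 0 <= c ->
  (forall z, s <= nc p.[z] -> D.[z] != 0) ->
  (forall z, nc p.[z] = s -> nc N.[z] <= c * nc D.[z]) ->
  forall z, s <= nc p.[z] -> nc N.[z] <= c * nc D.[z].
Proof.
move=> ND c0 D0 bd z1 z1s; rewrite leNgt; apply/negP => lt1.
have Dz1 : 0 < nc D.[z1] by rewrite nc_gt0 D0.
pose f (z : T) := nc N.[z] / nc D.[z].
have f1 : c < f z1 by rewrite /f ltr_pdivlMr.
have [r rP] := poly_ratio_small ND (le_lt_trans c0 f1).
pose A : set T := [set z | s <= nc p.[z] /\ nc z <= `|r| + nc z1].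
have cA : compact A.
  apply: (closed_bounded_compact (b := `|r| + nc z1)) => [|z []//].
  rewrite (_ : A = [set z : T | s <= nc p.[z]] `&` [set z : T | nc z <= `|r| + nc z1]) //.
  apply: closedI; first exact: (closed_ge_cont (@nc_horner_cont R p)).
  exact: (closed_le_cont (@nc_cont R)).
have Az1 : A z1 by split; rewrite ?lerDr.
have A0 : A !=set0 by exists z1.
have [|z [zs zb] zmax] := @compact_argmax A f A0 cA.
  by move=> z [/D0 Dz _]; exact: ratio_cont.
have Dz : 0 < nc D.[z] by rewrite nc_gt0 D0.
have fz : c < f z by apply: (lt_le_trans f1); exact: zmax.
have zs' : s < nc p.[z].
  rewrite lt_neqAle zs andbT; apply/eqP => /esym/bd.
  by rewrite -ler_pdivrMr // leNgt fz.
have Nz : N.[z] != 0.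
  apply/eqP => Nz; move: fz; rewrite /f Nz nc0 mul0r ltNge => /negP; apply.
  exact: c0.
have [e e0 eP] := open_near (open_gt_cont (@nc_horner_cont R p)) zs'.
have NaD a : N <> a *: D.
  move=> Na; move: ND; have [a0|a0] := eqVneq a 0.
    by move: Nz; rewrite Na a0 scale0r horner0 eqxx.
  by rewrite Na size_scale // ltnn.
have [t te] := rational_no_local_max e0 Nz (D0 _ zs) NaD.
have ts := eP t te; have Dt : 0 < nc D.[t] by rewrite nc_gt0 D0 // ltW.
move=> lt2.
have : f z < f t.
  by rewrite /f ltr_pdivrMr // mulrAC ltr_pdivlMr.
apply/negP; rewrite -leNgt.
(* The point t may lie beyond the truncation radius of [A]; there the decay of N/D keeps the
   quotient below [f z1]. *)
have [tb|tb] := leP (nc t) (`|r| + nc z1); first by apply: zmax; split => //; exact: ltW.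
apply: (@le_trans _ _ (f z1)); last exact: zmax.
rewrite {1}/f ler_pdivrMr // rP // ltW // (le_lt_trans _ tb) //.
by rewrite ler_wpDr ?nc_ge0 // ler_norm.
Qed.

(** log(|p|/s) / deg p is the Green function of the set |p| <= s, and Green functions decrease when
    the set grows. Powers of equal degree have a quotient that need not tend to 0 at infinity, so
    the exterior principle is applied to Q^(mk) against P^(nk+1); the surplus factor P disappears as
    k grows. *)
Lemma green_le p q (s : R) : 0 < s -> (1 < size p)%N -> (1 < size q)%N ->
  (forall z, nc p.[z] <= s -> nc q.[z] <= s) ->
  forall z, s <= nc p.[z] ->
    (nc q.[z] / s) ^+ (size p).-1 <= (nc p.[z] / s) ^+ (size q).-1.
Proof.
move=> s0 p1 q1 pq z zs.
set m := (size p).-1; set n := (size q).-1.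
have p0 : p != 0 by rewrite -size_poly_gt0 (leq_trans _ p1).
have q0 : q != 0 by rewrite -size_poly_gt0 (leq_trans _ q1).
have m0 : (0 < m)%N by rewrite /m -ltnS prednK // (leq_trans _ p1).
have n0 : (0 < n)%N by rewrite /n -ltnS prednK // (leq_trans _ q1).
set Q := nc q.[z] / s; set P := nc p.[z] / s.
have P1 : 1 <= P by rewrite ler_pdivlMr // mul1r.
have P0 : 0 < P by exact: lt_le_trans P1.
have key k : Q ^+ (m * k) <= P ^+ (n * k).+1.
  have sN : (size (q ^+ (m * k)) < size (p ^+ (n * k).+1))%N.
    rewrite -(prednK (n := size (q ^+ _))) ?size_poly_gt0 ?expf_neq0 //.
    rewrite -(prednK (n := size (p ^+ _))) ?size_poly_gt0 ?expf_neq0 //.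
    rewrite !size_exp ltnS -/m -/n mulnS mulnCA.
    by rewrite -[X in (X < _)%N]add0n ltn_add2r.
  pose c := s ^+ (m * k) / s ^+ (n * k).+1.
  have c0 : 0 <= c by rewrite divr_ge0 ?exprn_ge0 ?(ltW s0).
  have nz w : s <= nc p.[w] -> (p ^+ (n * k).+1).[w] != 0.
    by move=> ws; rewrite horner_exp expf_neq0 // -nc_gt0 (lt_le_trans s0).
  have := @max_principle_exterior p _ _ s c sN c0 nz _ z zs.
  rewrite !horner_exp !ncX /Q /P !expr_div_n => H.
  rewrite ler_pdivrMr ?exprn_gt0 // mulrC mulrA mulrAC; apply: H => w ws.
  rewrite !horner_exp !ncX ws /c mulfVK ?expf_neq0 ?gt_eqF //.
  by rewrite lerXn2r ?nnegrE ?nc_ge0 ?(ltW s0) // pq // ws.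
rewrite leNgt; apply/negP => lt.
pose x := Q ^+ m / P ^+ n.
have x1 : 1 < x by rewrite /x ltr_pdivlMr ?exprn_gt0 // mul1r.
have [k] := exprn_unbounded P x1; rewrite ltNge => /negP; apply.
by rewrite /x expr_div_n -!exprM ler_pdivrMr ?exprn_gt0 // -exprS key.
Qed.

(* The logarithmic capacity of [|p| <= s]. *)
Definition logcap p (s : R) := (ln s - ln (nc (lead_coef p))) / (size p).-1%:R.

(** Capacity is the behaviour of the Green function at infinity: [green_le] compares scaled powers
    of [q] and [p] of the same degree, hence their leading coefficients, and logarithms give the
    claim. *)
Lemma logcap_le p q (s : R) : 0 < s -> (1 < size p)%N -> (1 < size q)%N ->
  (forall z, nc p.[z] <= s -> nc q.[z] <= s) -> logcap p s <= logcap q s.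
Proof.
move=> s0 p1 q1 pq; have H := green_le s0 p1 q1 pq.
have m0 : (0 < (size p).-1)%N by rewrite -ltnS prednK // (leq_trans _ p1).
have n0 : (0 < (size q).-1)%N by rewrite -ltnS prednK // (leq_trans _ q1).
have p0 : p != 0 by rewrite -size_poly_gt0 (leq_trans _ p1).
have q0 : q != 0 by rewrite -size_poly_gt0 (leq_trans _ q1).
rewrite /logcap; set m := (size p).-1 in H m0 *; set n := (size q).-1 in H n0 *.
have lp : 0 < nc (lead_coef p) by rewrite nc_gt0 lead_coef_eq0.
have lq : 0 < nc (lead_coef q) by rewrite nc_gt0 lead_coef_eq0.
have [r r0 rP] := poly_tends_infty s p1.
have sc (x : R) : 0 < x -> x%:C%C != 0 :> C by move=> x0; rewrite -nc_gt0 nc_real normr_gt0 gt_eqF.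
have := @lead_coef_le R ((s ^- m)%:C%C *: q ^+ m) ((s ^- n)%:C%C *: p ^+ n) r.
rewrite !size_scale ?sc ?invr_gt0 ?exprn_gt0 //.
rewrite -(prednK (n := size (q ^+ _))) ?size_poly_gt0 ?expf_neq0 //.
rewrite -(prednK (n := size (p ^+ _))) ?size_poly_gt0 ?expf_neq0 //.
rewrite !size_exp mulnC => /(_ erefl).
have nsc (x : R) z : 0 < x -> nc (x%:C%C * z) = x * nc z by move=> /ltW; exact: nc_scale_real.
rewrite !lead_coefZ !nsc ?invr_gt0 ?exprn_gt0 // !lead_coef_exp !ncX => H1.
have {}H1 : (nc (lead_coef q) / s) ^+ m <= (nc (lead_coef p) / s) ^+ n.
  rewrite !expr_div_n mulrC [leRHS]mulrC; apply: H1 => z /rP /(H z).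
  rewrite !hornerZ !horner_exp !nsc ?invr_gt0 ?exprn_gt0 // !ncX !expr_div_n.
  by rewrite [leLHS]mulrC [leRHS]mulrC -/m -/n [leLHS]mulrC [leRHS]mulrC.
have q_s : 0 < nc (lead_coef q) / s by rewrite divr_gt0.
have p_s : 0 < nc (lead_coef p) / s by rewrite divr_gt0.
have : ln ((nc (lead_coef q) / s) ^+ m) <= ln ((nc (lead_coef p) / s) ^+ n).
  by rewrite ler_ln ?posrE ?exprn_gt0.
rewrite !lnXn // !ln_div ?posrE // => {}H1.
rewrite ler_pdivrMr ?ltr0n // mulrAC ler_pdivlMr ?ltr0n //.
move: H1; rewrite -[X in X <= _]mulr_natl -[X in _ <= X -> _]mulr_natl; lra.
Qed.

End MaxPrinciple.

(** * Connectedness in the plane *)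

Section Topology.
Variable T : ptopologicalType.
Implicit Types A U V : set T.

Lemma connected_sub_open A U V x : connected A -> open U -> open V ->
  A `<=` U `|` V -> A `&` U `&` V = set0 -> A x -> U x -> A `<=` U.
Proof.
move=> cA oU oV AUV AUV0 Ax Ux.
have E : A `&` U = A `&` ~` V.
  apply/seteqP; split => y [Ay h]; split => //; last by case: (AUV y Ay).
  by move=> Vy; suff : set0 y by []; rewrite -AUV0.
suff <- : A `&` U = A by move=> y [].
apply: cA.
- by exists x.
- by exists U.
- by exists (~` V) => //; exact: open_closedC.
Qed.

Lemma connected_sub_closed A U V x : connected A -> closed U -> closed V ->
  A `<=` U `|` V -> A `&` U `&` V = set0 -> A x -> U x -> A `<=` U.
Proof.
move=> cA oU oV AUV AUV0 Ax Ux.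
have E : A `&` U = A `&` ~` V.
  apply/seteqP; split => y [Ay h]; split => //; last by case: (AUV y Ay).
  by move=> Vy; suff : set0 y by []; rewrite -AUV0.
suff <- : A `&` U = A by move=> y [].
apply: cA.
- by exists x.
- by exists (~` V) => //; exact: closed_openC.
- by exists U.
Qed.

Lemma connected_sep_closed A : closed A ->
  (forall U V, closed U -> closed V -> U `&` V = set0 -> U !=set0 -> V !=set0 ->
     A = U `|` V -> False) -> connected A.
Proof.
move=> cA H B [x Bx] [U oU BU] [V cV BV]; apply: contrapT => BA.
apply: (H B (A `&` ~` U)).
- by rewrite BV; exact: closedI.
- by apply: closedI => //; exact: open_closedC.
- by rewrite BU; apply/seteqP; split => // y [[_ ?] []].
- by exists x.
- apply: contrapT => /forallNP n; apply: BA; apply/seteqP; split => y.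
    by rewrite BU => -[].
  by move=> Ay; rewrite BU; split => //; apply: contrapT => nU; apply: (n y).
- apply/seteqP; split => y => [Ay|[|[]//]]; last by rewrite BU => -[].
  by have [Uy|nUy] := pselect (U y); [left; rewrite BU|right].
Qed.

Lemma connected_sep_open A : open A ->
  (forall U V, open U -> open V -> U `&` V = set0 -> U !=set0 -> V !=set0 ->
     A = U `|` V -> False) -> connected A.
Proof.
move=> cA H B [x Bx] [U oU BU] [V cV BV]; apply: contrapT => BA.
apply: (H B (A `&` ~` V)).
- by rewrite BU; exact: openI.
- by apply: openI => //; exact: closed_openC.
- by rewrite BV; apply/seteqP; split => // y [[_ ?] []].
- by exists x.
- apply: contrapT => /forallNP n; apply: BA; apply/seteqP; split => y.
    by rewrite BU => -[].
  by move=> Ay; rewrite BV; split => //; apply: contrapT => nU; apply: (n y).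
- apply/seteqP; split => y => [Ay|[|[]//]]; last by rewrite BU => -[].
  by have [Uy|nUy] := pselect (V y); [left; rewrite BV|right].
Qed.

Lemma connected_from A x :
  (forall y, A y -> exists B, [/\ B `<=` A, connected B, B x & B y]) -> connected A.
Proof.
move=> H; have [[y Ay]|] := pselect (A !=set0); last first.
  move=> n; have -> : A = set0; last exact: connected0.
  by apply/seteqP; split => // y Ay; apply: n; exists y.
have Ax : A x by have [B [BA _ Bx _]] := H y Ay; exact: BA.
rewrite (_ : A = connected_component A x); first exact: component_connected.
apply/seteqP; split; last exact: connected_component_sub.
by move=> z /H[B [BA cB Bx Bz]]; exists B.
Qed.

Lemma compact_increasing_cover A (f : nat -> set T) : compact A ->
  (forall k, open (f k)) -> (forall k, f k `<=` f k.+1) ->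
  (forall x, A x -> exists k, f k x) -> exists k, A `<=` f k.
Proof.
rewrite compact_cover => cA fo fS Af.
have [|D _ DA] := cA nat setT f (fun k _ => fo k).
  by move=> x /Af[k fk]; exists k.
have mono i j : (i <= j)%N -> f i `<=` f j.
  move=> ij; rewrite -(subnKC ij); elim: (_ - _)%N => [|k IH]; first by rewrite addn0.
  by rewrite addnS; exact: subset_trans IH _.
exists (\max_(i <- finmap.enum_fset D) i)%N => x /DA[i /= iD]; apply: mono.
exact: leq_bigmax_seq.
Qed.

Lemma closure_closed_sub A U : closed U -> A `<=` U -> closure A `<=` U.
Proof. by move=> /closure_id {2}-> AU; exact: closureS. Qed.

(** This brings an inclusion about a filled Julia preimage down to one of the lemniscates that
    decrease to it. *)
Lemma compact_decreasing_sub (F : nat -> set T) U : compact (F 0%N) ->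
  (forall k, closed (F k)) -> (forall k, F k.+1 `<=` F k) -> open U ->
  \bigcap_k F k `<=` U -> exists k, F k `<=` U.
Proof.
move=> c0 Fc FS oU FU.
have [||x F0x|k kP] := @compact_increasing_cover _ (fun k => U `|` ~` F k) c0.
- by move=> k; apply: openU => //; exact: closed_openC.
- by move=> k x [|nF]; [left|right => /FS].
- apply: contrapT => /forallNP n; apply: (n 0%N); left; apply: FU => k _.
  by apply: contrapT => nF; apply: (n k); right.
exists k => x Fx; have F0x : F 0%N x.
  by elim: k {kP} Fx => // k IH /FS.
by case: (kP x F0x).
Qed.

End Topology.

Section PlaneConnected.
Variable R : realType.
Local Notation C := (complex R).
Local Notation T := (cplane R).
Implicit Types (A E : set T).

Definition sdist E (z : C) : R := inf [set nc (z - w) | w in E].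

Lemma sdist_le E z w : E w -> sdist E z <= nc (z - w).
Proof.
move=> Ew; apply: ge_inf; last by exists w.
by exists 0 => _ [v _ <-]; exact: nc_ge0.
Qed.

Lemma sdist_ge E z (r : R) : E !=set0 -> (forall w, E w -> r <= nc (z - w)) ->
  r <= sdist E z.
Proof.
by move=> [w Ew] H; apply: lb_le_inf; [exists (nc (z - w)); exists w|move=> _ [v Ev <-]; exact: H].
Qed.

Lemma sdist_ge0 E z : E !=set0 -> 0 <= sdist E z.
Proof. by move=> E0; apply: sdist_ge => // w _; exact: nc_ge0. Qed.

Lemma sdist_lip E z w : E !=set0 -> sdist E z <= sdist E w + nc (z - w).
Proof.
move=> E0; rewrite -lerBlDr; apply: sdist_ge => // v Ev; rewrite lerBlDr.
apply: (le_trans (sdist_le z Ev)).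
have -> : z - v = (w - v) + (z - w) by ring.
exact: ncD.
Qed.

Lemma sdist_cont E : E !=set0 -> continuous (sdist E : T -> R).
Proof.
move=> E0 z; apply: cont_discR => e e0; exists e => // w wz.
have h1 := sdist_lip w z E0; have h2 := sdist_lip z w E0.
rewrite ncBC in h2; rewrite ltr_norml; apply/andP; split; lra.
Qed.

Lemma sdist_gt0 E z : E !=set0 -> closed E -> ~ E z -> 0 < sdist E z.
Proof.
move=> E0 /closed_openC oE nEz; have [e e0 eE] := open_near oE nEz.
apply: (lt_le_trans e0); apply: sdist_ge => // w Ew.
by rewrite leNgt; apply/negP; rewrite ncBC => /eE.
Qed.

Lemma sdist_eq0 E z : E z -> sdist E z = 0.
Proof.
move=> Ez; apply/eqP; rewrite eq_le sdist_ge0 ?andbT; last by exists z.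
by apply: le_trans (sdist_le _ Ez) _; rewrite subrr nc0.
Qed.

Lemma compact_closed_gap A E : compact A -> closed E -> A `&` E = set0 ->
  exists2 d : R, 0 < d & forall z w, A z -> E w -> d <= nc (z - w).
Proof.
move=> cA cE AE.
have [[a Aa]|nA] := pselect (A !=set0); last first.
  by exists 1 => // z w Az; exfalso; apply: nA; exists z.
have [E0|nE] := pselect (E !=set0); last first.
  by exists 1 => // z w _ Ew; exfalso; apply: nE; exists w.
have A0 : A !=set0 by exists a.
have [z Az zmin] := compact_argmin A0 cA (fun z _ => sdist_cont E0 (x := z)).
exists (sdist E z).
  apply: sdist_gt0 => // Ez; suff : set0 z by [].
  by rewrite -AE.
move=> v w Av Ew; exact: le_trans (zmin _ Av) (sdist_le _ Ew).
Qed.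

Lemma line_cont (z w : C) : continuous (fun t : R => z + t%:C%C * (w - z) : T).
Proof.
move=> t A /nbhs_disc[e e0 eA].
apply/nbhs_ballP; exists (e / (nc (w - z) + 1)) => /=.
  by rewrite divr_gt0 // ltr_wpDl ?nc_ge0.
move=> s; rewrite -ball_normE /= => st; apply: eA; rewrite /disc /=.
have -> : z + s%:C%C * (w - z) - (z + t%:C%C * (w - z)) = (s - t)%:C%C * (w - z).
  by rewrite rmorphB; ring.
rewrite ncM nc_real distrC; move: st; rewrite ltr_pdivlMr ?ltr_wpDl ?nc_ge0 //.
by apply: le_lt_trans; rewrite ler_wpM2l // lerDl.
Qed.

Definition seg (z w : C) : set T := [set z + t%:C%C * (w - z) | t in `[0, 1 : R]].

Lemma seg_connected z w : connected (seg z w).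
Proof.
apply: connected_continuous_connected; first exact: segment_connected.
exact/continuous_subspaceT/line_cont.
Qed.

Lemma seg_l z w : seg z w z.
Proof. by exists 0; rewrite /= ?in_itv /= ?lexx ?ler01 // mul0r addr0. Qed.

Lemma seg_r z w : seg z w w.
Proof. by exists 1; rewrite /= ?in_itv /= ?lexx ?ler01 // mul1r addrC subrK. Qed.

Lemma nc_conv z w (t : R) v : 0 <= t -> t <= 1 ->
  nc (z + t%:C%C * (w - z) - v) <= (1 - t) * nc (z - v) + t * nc (w - v).
Proof.
move=> t0 t1.
have -> : z + t%:C%C * (w - z) - v = (1 - t)%:C%C * (z - v) + t%:C%C * (w - v).
  by rewrite rmorphB rmorph1; ring.
apply: le_trans (ncD _ _) _; rewrite !nc_scale_real ?subr_ge0 //.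
Qed.

Lemma seg_disc z w v (r : R) : nc (z - v) < r -> nc (w - v) < r ->
  seg z w `<=` disc v r.
Proof.
move=> zr wr _ [t /= + <-]; rewrite in_itv /= => /andP[t0 t1].
rewrite /disc /=; apply: le_lt_trans (nc_conv _ _ _ t0 t1) _.
have [t00|tn0] := eqVneq t 0; first by rewrite t00 subr0 mul1r mul0r addr0.
have : 0 < t by rewrite lt_def tn0.
nra.
Qed.

Lemma disc_connected v (r : R) : connected (disc v r).
Proof.
apply: (@connected_from T _ v) => w wr; exists (seg v w); split.
- apply: seg_disc => //; rewrite subrr nc0; apply: le_lt_trans wr; exact: nc_ge0.
- exact: seg_connected.
- exact: seg_l.
- exact: seg_r.
Qed.

Definition halfplane (L : C -> R) (b : R) : set T := [set z | b < L z].

Lemma halfplane_connected (L : C -> R) (b : R) :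
  (forall (z w : C) (t : R), L (z + t%:C%C * (w - z)) = (1 - t) * L z + t * L w) ->
  connected (halfplane L b).
Proof.
move=> Llin; have [[z zb]|n] := pselect (halfplane L b !=set0); last first.
  have -> : halfplane L b = set0; last exact: connected0.
  by apply/seteqP; split => // y Ay; apply: n; exists y.
apply: (@connected_from T _ z) => w wb; exists (seg z w); split.
- move=> _ [t /= + <-]; rewrite in_itv /= => /andP[t0 t1].
  rewrite /halfplane /= Llin; rewrite /halfplane /= in zb wb.
  have [t00|tn0] := eqVneq t 0; first by rewrite t00 subr0 mul1r mul0r addr0.
  have : 0 < t by rewrite lt_def tn0.
  nra.
- exact: seg_connected.
- exact: seg_l.
- exact: seg_r.
Qed.

(** A neighborhood of infinity that is visibly connected: four half-planes, consecutive ones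
    overlapping. *)
Definition outer_square (b : R) : set T :=
  [set z : T | b < `|complex.Re z| \/ b < `|complex.Im z|].

Lemma outer_square_connected (b : R) : 0 < b -> connected (outer_square b).
Proof.
move=> b0.
pose H1 := halfplane (fun z => complex.Re z) b.
pose H2 := halfplane (fun z => complex.Im z) b.
pose H3 := halfplane (fun z => - complex.Re z) b.
pose H4 := halfplane (fun z => - complex.Im z) b.
have c1 : connected H1 by apply: halfplane_connected => -[a c] [a' c'] t /=; ring.
have c2 : connected H2 by apply: halfplane_connected => -[a c] [a' c'] t /=; ring.
have c3 : connected H3 by apply: halfplane_connected => -[a c] [a' c'] t /=; ring.
have c4 : connected H4 by apply: halfplane_connected => -[a c] [a' c'] t /=; ring.
have -> : outer_square b = H1 `|` H2 `|` H3 `|` H4.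
  apply/seteqP; rewrite /outer_square /H1 /H2 /H3 /H4 /halfplane /setU /=.
  split => -[x y] /=; rewrite !ltr_normr.
    move=> [/orP[h|h]|/orP[h|h]].
    - by left; left; left.
    - by left; right.
    - by left; left; right.
    - by right.
  by move=> [[[h|h]|h]|h]; [left|right|left|right]; rewrite h ?orbT.
have bb : b < b + 1 by rewrite ltrDl.
apply: connectedU => //; last first.
- apply: connectedU => //; last by apply: connectedU => //; exists (Complex (b+1) (b+1)).
  by exists (Complex (- (b + 1)) (b + 1)); split; [right|]; rewrite /H2 /H3 /halfplane /= ?opprK.
- by exists (Complex (b + 1) (- (b + 1))); split; [left; left|]; rewrite /H1 /H4 /halfplane /= ?opprK.
Qed.

Lemma connected_meets_boundary A E z w : connected A -> A z -> E z -> A w -> ~ E w ->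
  exists v, [/\ A v, closure E v & closure (~` E) v].
Proof.
move=> cA Az Ez Aw nEw; apply: contrapT => n.
have := @connected_sub_open _ A (~` closure (~` E)) (~` closure E) z cA.
have H : A `<=` ~` closure (~` E) `|` ~` closure E.
  move=> v Av; have [cv|] := pselect (closure E v); last by right.
  by left => cv'; apply: n; exists v.
move=> /(_ (closed_openC (@closed_closure _ _)) (closed_openC (@closed_closure _ _)) H).
have H2 : A `&` ~` closure (~` E) `&` ~` closure E = set0.
  apply/seteqP; split => // v [[Av h1] h2].
  have [Ev|nEv] := pselect (E v); first by apply: h2; exact: subset_closure.
  by apply: h1; exact: subset_closure.
move=> /(_ H2 Az) H3.
have : (~` closure (~` E)) w.
  apply: H3 => // cz; apply: n; exists z; split => //; exact: subset_closure.
by apply; exact: subset_closure.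
Qed.

Lemma closed_sep_plane U V : closed U -> compact V -> U `&` V = set0 ->
  exists U' V' : set T, [/\ open U', open V', U `<=` U', V `<=` V' & U' `&` V' = set0].
Proof.
move=> cU cV UV; have [d d0 dP] := compact_closed_gap cV cU (etrans (setIC _ _) UV).
exists (\bigcup_(z in U) disc z (d / 2)), (\bigcup_(z in V) disc z (d / 2)).
have d20 : 0 < d / 2 by rewrite divr_gt0.
split.
- by apply: bigcup_open => z _; exact: open_disc.
- by apply: bigcup_open => z _; exact: open_disc.
- by move=> z Uz; exists z => //; exact: disc_center.
- by move=> z Uz; exists z => //; exact: disc_center.
- apply/seteqP; split => // z [[u Uu zu] [v Vv zv]].
  have := dP v u Vv Uu; have -> : v - u = (z - u) - (z - v) by ring.
  move=> h; have := le_trans h (ncB _ _); rewrite /disc /= in zu zv; lra.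
Qed.

Lemma decreasing_connected (F : nat -> set T) : (forall k, compact (F k)) ->
  (forall k, closed (F k)) -> (forall k, connected (F k)) ->
  (forall k, F k.+1 `<=` F k) -> connected (\bigcap_k F k).
Proof.
move=> Fcp Fc Fcon FS.
have cI : closed (\bigcap_k F k) by apply: closed_bigI => k _.
apply: connected_sep_closed => // U V cU cV UV [u Uu] [v Vv] E.
have cpV : compact V.
  by apply: (subclosed_compact cV (Fcp 0%N)) => x Vx; have : (\bigcap_k F k) x; [rewrite E; right|exact].
have [U' [V' [oU oV UU VV UV']]] := closed_sep_plane cU cpV UV.
have [|k kP] := compact_decreasing_sub (Fcp 0%N) Fc FS (openU oU oV).
  by rewrite E => x [/UU|/VV]; [left|right].
have Fu : F k u by have : (\bigcap_k F k) u; [rewrite E; left|exact].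
have Fv : F k v by have : (\bigcap_k F k) v; [rewrite E; right|exact].
have : F k `<=` U'.
  apply: (connected_sub_open (Fcon k) oU oV kP _ Fu); last exact: UU.
  by rewrite -setIA UV' setI0.
move=> /(_ v Fv) U'v; suff : set0 v by [].
by rewrite -UV'; split => //; exact: VV.
Qed.

End PlaneConnected.

(** * Connectedness of lemniscates *)

Section Lemniscates.
Variable R : realType.
Local Notation C := (complex R).
Local Notation T := (cplane R).
Implicit Types (p q : {poly C}).

(** At a critical point p - p(z0) has a double root, so the Lipschitz constant of [p] on small discs
    is arbitrarily small. *)
Lemma flat_lipschitz p z0 (e : R) : root p^`() z0 -> 0 < e ->
  exists2 r : R, 0 < r & forall z w, nc (z - z0) < r -> nc (w - z0) < r ->
    nc (p.[z] - p.[w]) <= e * nc (z - w).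
Proof.
move=> dp e0.
have : root (p - p.[z0]%:P) z0 by rewrite rootE !hornerE subrr.
case/factor_theorem => g Eg.
have : root g z0.
  have := congr1 (fun h => h^`().[z0]) Eg.
  rewrite derivB derivC subr0 derivM derivXsubC mulr1 hornerD hornerM hornerXsubC.
  by rewrite subrr mulr0 add0r rootE => <-.
case/factor_theorem => q Eq.
have pE z : p.[z] = q.[z] * (z - z0) ^+ 2 + p.[z0].
  have := congr1 (horner^~ z) Eg; rewrite Eq hornerD hornerN hornerC => /eqP.
  by rewrite subr_eq => /eqP ->; rewrite !hornerM !hornerXsubC -mulrA expr2.
have [M M0 MP] := poly_bounded_on q (nc z0 + 1).
have [L L0 LP] := poly_lipschitz_on q (nc z0 + 1).
pose r := Num.min 1 (e / (2 * M + L + 1)).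
have k0 : 0 < 2 * M + L + 1 by lra.
have r0 : 0 < r by rewrite lt_min ltr01 divr_gt0.
have r1 : r <= 1 by rewrite ge_min lexx.
have re : r * (2 * M + L + 1) <= e by rewrite -ler_pdivlMr // ge_min lexx orbT.
exists r => // z w zr wr.
have bd v : nc (v - z0) < r -> nc v <= nc z0 + 1.
  move=> vr; rewrite -[v](subrK z0) addrC; apply: nc_le => //; lra.
have -> : p.[z] - p.[w] = (z - w) * ((z - z0) + (w - z0)) * q.[z]
     + (w - z0) ^+ 2 * (q.[z] - q.[w]).
  by rewrite pE [p.[w]]pE; ring.
have h1 : nc ((z - w) * ((z - z0) + (w - z0)) * q.[z]) <= nc (z - w) * (2 * r) * M.
  rewrite !ncM; apply: ler_pM; rewrite ?mulr_ge0 ?nc_ge0 ?MP ?bd //.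
  rewrite ler_wpM2l ?nc_ge0 // mulr_natl mulr2n; apply: nc_le; exact: ltW.
have h2 : nc ((w - z0) ^+ 2 * (q.[z] - q.[w])) <= r * (L * nc (z - w)).
  rewrite ncM ncX; apply: ler_pM; rewrite ?exprn_ge0 ?nc_ge0 ?LP ?bd //.
  have := nc_ge0 (w - z0); rewrite expr2; nra.
apply: le_trans (nc_le h1 h2) _.
have := nc_ge0 (z - w); have d0 := ltW r0; nra.
Qed.

(** [flat_lipschitz] applies to [p] minus its linear part, which is thus a perturbation of
    multiplication by p'(z0): the injective half of the inverse function theorem. *)
Lemma local_expansion p z0 : ~~ root p^`() z0 ->
  exists2 r : R, 0 < r & exists2 L : R, 0 < L &
  forall z w, nc (z - z0) < r -> nc (w - z0) < r ->
    nc (z - w) <= L * nc (p.[z] - p.[w]).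
Proof.
move=> dp; pose a := p^`().[z0]; pose g := p - a *: 'X.
have a0 : 0 < nc a by rewrite nc_gt0.
have dg : root g^`() z0 by rewrite rootE derivB derivZ derivX !hornerE subrr.
have h0 : 0 < nc a / 2 by rewrite divr_gt0.
have [r r0 rP] := flat_lipschitz dg h0.
exists r => //; exists (2 / nc a); first by rewrite divr_gt0.
move=> z w zr wr; have := rP z w zr wr.
have -> : g.[z] - g.[w] = (p.[z] - p.[w]) - a * (z - w).
  by rewrite !hornerE; ring.
move=> h; rewrite mulrAC ler_pdivlMr //.
have := nc_sub (a * (z - w)) (p.[z] - p.[w]); rewrite ncBC ncM; lra.
Qed.

Lemma sublevel_open p (s : R) : open ([set z | nc p.[z] < s] : set T).
Proof. exact: (open_lt_cont (@nc_horner_cont R p)). Qed.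

(* Near a non-critical point on the level [s], the sublevel set is connected,
   because the local inverse of [p] carries segments of a disc into it. *)
Lemma local_sublevel_link p z0 (s : R) : (1 < size p)%N -> ~~ root p^`() z0 ->
  exists2 r : R, 0 < r & forall z1 z2, nc (z1 - z0) < r -> nc (z2 - z0) < r ->
    nc p.[z1] < s -> nc p.[z2] < s ->
    exists B : set T, [/\ B `<=` [set z | nc p.[z] < s], connected B, B z1 & B z2].
Proof.
move=> p1 dp; have [r r0 [L L0 LP]] := local_expansion dp.
have [d d0 dP] := poly_small_root z0 p1 r0.
have [r' r'0 r'P] := poly_cont_at p z0 d0.
exists (Num.min r r') => [|z1 z2]; first by rewrite lt_min r0.
rewrite !lt_min => /andP[z1r z1r'] /andP[z2r z2r'] z1s z2s.
(* The local inverse is chosen on the disc of radius d around [p.[z0]]; elsewhere it takes the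
   default 0. *)
have q w : exists t, nc (p.[z0] - w) < d -> p.[t] = w /\ nc (t - z0) < r.
  have [wd|] := pselect (nc (p.[z0] - w) < d).
    by have [t tw tr] := dP w wd; exists t.
  by exists 0.
have /choice[f fP] := q.
pose D : set T := disc p.[z0] d.
have fD w : D w -> p.[f w] = w /\ nc (f w - z0) < r.
  by rewrite /D /disc /= ncBC => /fP.
have cf w : D w -> {for w, continuous (f : T -> T)}.
  move=> Dw; apply: cont_disc => e e0.
  have [e1 e10 e1D] := open_near (open_disc (z := _) (r := _)) Dw.
  exists (Num.min e1 (e / L)); first by rewrite lt_min e10 divr_gt0.
  move=> v; rewrite lt_min => /andP[/e1D Dv vL].
  have [[pv vr] [pw wr]] := (fD v Dv, fD w Dw).
  apply: le_lt_trans (LP _ _ vr wr) _.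
  by rewrite pv pw mulrC -ltr_pdivlMr.
have D1 : D p.[z1] by exact: r'P.
have D2 : D p.[z2] by exact: r'P.
pose S := seg p.[z1] p.[z2].
have SD : S `<=` D by exact: seg_disc.
have fz z : nc (z - z0) < r -> D p.[z] -> f p.[z] = z.
  move=> zr Dz; have [pf fr] := fD _ Dz.
  apply/eqP; rewrite -subr_eq0 -nc_eq0 eq_le nc_ge0 andbT.
  by apply: le_trans (LP _ _ fr zr) _; rewrite pf subrr nc0 mulr0.
exists (f @` S); split.
- move=> _ [w Sw <-] /=; have [-> _] := fD w (SD w Sw).
  have := @seg_disc R p.[z1] p.[z2] 0 s; rewrite !subr0 => /(_ z1s z2s w Sw).
  by rewrite /disc /= subr0.
- apply: (@connected_continuous_connected T T); first exact: seg_connected.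
  by apply: continuous_in_subspaceT => w /set_mem /SD; exact: cf.
- by exists p.[z1]; [exact: seg_l|exact: fz].
- by exists p.[z2]; [exact: seg_r|exact: fz].
Qed.

Lemma sublevel_bounded p (s : R) : (1 < size p)%N ->
  exists b : R, forall z, nc p.[z] <= s -> nc z <= b.
Proof.
move=> p1; have [r r0 rP] := poly_tends_infty (s + 1) p1; exists r => z zs.
rewrite leNgt; apply/negP => /ltW /rP; lra.
Qed.

(** On the boundary of an open piece of the sublevel set |p| is at least s, so the minimum principle
    puts a root in the piece. *)
Lemma sublevel_piece_root p (s : R) (U V : set T) z : (1 < size p)%N ->
  open U -> open V -> U `&` V = set0 -> [set z : T | nc p.[z] < s] = U `|` V ->
  U z -> exists2 t, U t & p.[t] = 0.
Proof.
move=> p1 oU oV UV E Uz; have [b bP] := sublevel_bounded s p1.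
have US : U `<=` [set z : T | nc p.[z] < s] by rewrite E => w; left.
apply: (@min_principle_root R p U b s z) => //.
- by move=> w /US /ltW; exact: bP.
- exact: US.
- move=> w cw nw; rewrite leNgt; apply/negP => ws.
  have : (U `|` V) w by rewrite -E.
  case=> // Vw; have [v [Uv Vv]] := cw V (open_nbhs_nbhs (conj oV Vw)).
  by suff : set0 v by []; rewrite -UV.
Qed.

(** Both pieces of a separation would contain roots, and a connected set through all roots joins
    them. *)
Lemma sublevel_connected_from p (s : R) (K : set T) : (1 < size p)%N ->
  connected K -> K `<=` [set z | nc p.[z] < s] -> (forall t, root p t -> K t) ->
  connected ([set z | nc p.[z] < s] : set T).
Proof.
move=> p1 cK Ks rK; apply: connected_sep_open; first exact: sublevel_open.
move=> U V oU oV UV [u Uu] [v Vv] E.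
have [a Ua pa] := sublevel_piece_root p1 oU oV UV E Uu.
have [b Vb pb] := sublevel_piece_root p1 oV oU (etrans (setIC _ _) UV) (etrans E (setUC _ _)) Vv.
have Ka : K a by apply: rK; rewrite rootE pa.
have Kb : K b by apply: rK; rewrite rootE pb.
have : K `<=` U.
  apply: (connected_sub_open cK oU oV _ _ Ka Ua); first by rewrite -E.
  by rewrite -setIA UV setI0.
by move=> /(_ b Kb) Ub; suff : set0 b by []; rewrite -UV.
Qed.

Lemma roots_seqP p : p != 0 -> exists rs : seq C, forall t, root p t <-> t \in rs.
Proof.
move=> p0; have [rs srs rsP] := poly_rootsP p; exists rs => t; split.
  rewrite rootE rsP mulf_eq0 lead_coef_eq0 (negbTE p0) /=.
  by rewrite prodf_seq_eq0 => /hasP[u urs /=]; rewrite subr_eq0 => /eqP ->.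
move=> trs; rewrite rootE rsP mulf_eq0; apply/orP; right.
by rewrite prodf_seq_eq0; apply/hasP; exists t => //=; rewrite subrr.
Qed.

Lemma sublevel_connected_large p : (1 < size p)%N ->
  exists M : R, forall s, M < s -> connected ([set z | nc p.[z] < s] : set T).
Proof.
move=> p1; have [b bP] := sublevel_bounded 0 p1.
have [M M0 MP] := poly_bounded_on p (`|b| + 1); exists M => s Ms.
apply: (sublevel_connected_from (K := disc 0 (`|b| + 1))) => //.
- exact: disc_connected.
- by move=> z; rewrite /disc /= subr0 => /ltW /MP zM; exact: le_lt_trans Ms.
- move=> t; rewrite rootE => /eqP pt; rewrite /disc /= subr0.
  have := bP t; rewrite pt nc0 lexx => /(_ isT); have := ler_norm b; lra.
Qed.

(** Let V(t) be the component of a root [a] in |p| < t. The union of the V(t) for t < s is open and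
    closed in the level s, hence all of it; since there are finitely many roots, a single V(t)
    contains them all. *)
Lemma sublevel_connected_below p (s : R) : (1 < size p)%N -> 0 < s ->
  connected ([set z | nc p.[z] < s] : set T) ->
  exists2 t : R, t < s & forall u, t <= u -> u < s ->
     connected ([set z | nc p.[z] < u] : set T).
Proof.
move=> p1 s0 cs; have p0 : p != 0 by rewrite -size_poly_gt0 (leq_trans _ p1).
have [a ra] : exists a, root p a by apply/closed_rootP; rewrite gtn_eqF.
pose O t : set T := [set z | nc p.[z] < t].
pose V t := connected_component (O t) a.
have aO t : 0 < t -> O t a by move=> t0; rewrite /O /= (eqP ra) nc0.
have Vmono t u : t <= u -> V t `<=` V u.
  move=> tu z [B [Ba BO cB Bz]]; exists B => //; split => // w /BO /= wt.
  exact: lt_le_trans tu.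
pose W : set T := \bigcup_(t in [set t | 0 < t < s]) V t.
have WO : W = O s.
  apply: cs.
  - exists a; exists (s / 2); first by rewrite /=; lra.
    by apply/connected_component_refl/aO; lra.
  - exists W; last first.
      apply/seteqP; split => [z Wz|z []//]; split => //.
      case: Wz => t /= /andP[_ ts] /connected_component_sub zt.
      exact: lt_trans ts.
    rewrite openE => z [t /andP[t0 ts] Vz].
    have [e e0 eO] := open_near (sublevel_open (p := p) (s := t)) (connected_component_sub Vz).
    apply/nbhs_disc; exists e => // w wz; exists t; first by rewrite /= t0.
    apply: connected_component_trans Vz _.
    exists (disc z e); last exact: wz.
    by split; [exact: disc_center|exact: eO|exact: disc_connected].
  - exists (closure W); first exact: closed_closure.
    apply/seteqP; split => z.
      move=> Wz; split; last exact: subset_closure.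
      case: Wz => t /= /andP[_ ts] /connected_component_sub zt.
      exact: lt_trans ts.
    move=> [zs cz]; pose t := (nc p.[z] + s) / 2; rewrite /O /= in zs.
    have zt : O t z by rewrite /O /= /t; lra.
    have [e e0 eO] := open_near (sublevel_open (p := p) (s := t)) zt.
    have [w [Ww wz]] := cz _ (nbhs_disc_center z e0).
    case: Ww => u /= /andP[u0 us] Vw.
    exists (Num.max u t); first by rewrite /= lt_max u0 /= gt_max us /t; lra.
    apply: (@connected_component_trans _ _ w).
      by apply: Vmono Vw; rewrite le_max lexx.
    exists (disc z e); last exact: disc_center.
    split; [exact: wz| |exact: disc_connected].
    by move=> v /eO vt; apply: lt_le_trans vt _; rewrite le_max lexx orbT.
have [rs rsP] := roots_seqP p0.
have [t /andP[t0 ts] tP] : exists2 t, 0 < t < s & forall c, c \in rs -> V t c.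
  have {rsP} : forall c, c \in rs -> W c.
    by move=> c /rsP /eqP pc; rewrite WO /O /= pc nc0.
  elim: rs => [_|c rs IH H]; first by exists (s / 2) => //; lra.
  have [|t /andP[t0 ts] tP] := IH; first by move=> d drs; apply: H; rewrite inE drs orbT.
  have [u /= /andP[u0 us] uc] := H c (mem_head _ _).
  exists (Num.max t u); first by rewrite lt_max t0 /= gt_max ts.
  move=> d; rewrite inE => /predU1P[->|/tP].
    by apply: Vmono uc; rewrite le_max lexx orbT.
  by apply: Vmono; rewrite le_max lexx.
exists t => // u tu us.
apply: (sublevel_connected_from (K := V t)) => //.
- exact: component_connected.
- by move=> z /connected_component_sub zt; exact: lt_le_trans tu.
- by move=> c /rsP /tP.
Qed.

Lemma closure_sublevel p (s : R) : (1 < size p)%N -> 0 < s ->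
  closure ([set z | nc p.[z] < s] : set T) = [set z | nc p.[z] <= s].
Proof.
move=> p1 s0; apply/seteqP; split.
  apply: closure_closed_sub; first exact: (closed_le_cont (@nc_horner_cont R p)).
  by move=> z /ltW.
move=> z /= zs; apply/closure_disc => e e0.
have [pz|pz] := eqVneq p.[z] 0.
  by exists z; rewrite /= ?pz ?nc0 // subrr nc0.
have [t tz tp] := poly_no_local_min p1 e0 pz.
by exists t => //=; exact: lt_le_trans zs.
Qed.

Lemma closed_sublevel p (s : R) : closed ([set z | nc p.[z] <= s] : set T).
Proof. exact: (closed_le_cont (@nc_horner_cont R p)). Qed.

Lemma compact_sublevel p (s : R) : (1 < size p)%N ->
  compact ([set z | nc p.[z] <= s] : set T).
Proof.
move=> p1; have [b bP] := sublevel_bounded s p1.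
by apply: (closed_bounded_compact (b := b)) => //; exact: closed_sublevel.
Qed.

(** Descend from the large levels, which are connected. The supremum s of the disconnected levels is
    itself disconnected, by [sublevel_connected_below]. The closed sublevel set at s is connected,
    as a decreasing intersection of higher ones, so the closures of the two pieces meet at a point
    of level s; this point is not critical, and [local_sublevel_link] joins the pieces near it. *)
Lemma sublevel_connected p (s0 : R) : (1 < size p)%N -> 0 < s0 ->
  (forall c, root p^`() c -> nc p.[c] < s0) ->
  forall s, s0 <= s -> connected ([set z | nc p.[z] < s] : set T).
Proof.
move=> p1 s00 crit s1 s01; apply: contrapT => bad1.
pose O t : set T := [set z | nc p.[z] < t].
pose B := [set s | s0 <= s /\ ~ connected (O s)].
have [M MP] := sublevel_connected_large p1.
have Bub : ubound B M by move=> s [_ n]; rewrite leNgt; apply/negP => /MP.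
have Bs : has_sup B by split; [exists s1|exists M].
pose s := sup B.
have Bles t : B t -> t <= s by move=> Bt; apply: ub_le_sup => //; exists M.
have s0s : s0 <= s by apply: (le_trans s01); exact: Bles.
have sp : 0 < s by exact: lt_le_trans s0s.
have bads : ~ connected (O s).
  move=> cs; have [t ts tP] := sublevel_connected_below p1 sp cs.
  have e0 : 0 < s - t by rewrite subr_gt0.
  have [u Bu] := sup_adherent e0 Bs; rewrite -/s opprB addrC subrK => tu.
  have us := Bles u Bu; case: (Bu) => _; apply.
  move: us; rewrite le_eqVlt => /predU1P[->//|us]; apply: tP => //; exact: ltW.
apply: bads; apply: connected_sep_open; first exact: sublevel_open.
move=> U V oU oV UV [u Uu] [v Vv] E.
have above t : s < t -> connected (O t).
  move=> st; apply: contrapT => n; have : B t by split => //; apply: ltW; exact: le_lt_trans st.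
  by move=> /Bles; rewrite leNgt st.
pose F k : set T := [set z | nc p.[z] <= s + k.+1%:R^-1].
have kp k : 0 < (k.+1%:R : R)^-1 by rewrite invr_gt0.
have cF : connected (\bigcap_k F k).
  apply: decreasing_connected => k.
  - exact: compact_sublevel.
  - exact: closed_sublevel.
  - rewrite /F -closure_sublevel // ?addr_gt0 //.
    by apply/connected_closure/above; rewrite ltrDl.
  - move=> z /= h; apply: (le_trans h); rewrite lerD2l lef_pV2 ?posrE //.
    by rewrite ler_nat.
have EF : \bigcap_k F k = closure U `|` closure V.
  rewrite -closureU -E closure_sublevel //; apply/seteqP; split => z.
    move=> h /=; apply/ler_addgt0Pr => e e0.
    have [k ke] : exists k, k.+1%:R^-1 < e.
      exists (Num.truncn e^-1); rewrite invf_plt ?posrE //; exact: truncnS_gt.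
    by apply: le_trans (h k I) _; rewrite lerD2l ltW.
  by move=> /= h k _ /=; apply: (le_trans h); rewrite lerDl ltW.
have [z0 [cU cV]] : (closure U `&` closure V) !=set0.
  apply: contrapT => n.
  have : closure U `|` closure V `<=` closure U.
    apply: (@connected_sub_closed T _ (closure U) (closure V) u) => //.
    - by rewrite -EF.
    - exact: closed_closure.
    - exact: closed_closure.
    - apply/seteqP; split => // z [[_ a] b]; apply: n; exists z => //.
    - by left; exact: subset_closure.
    - exact: subset_closure.
  move=> /(_ v (or_intror (subset_closure Vv))) cv.
  by apply: n; exists v; split => //; exact: subset_closure.
have z0s : nc p.[z0] = s.
  apply/eqP; rewrite eq_le; apply/andP; split.
    have : (\bigcap_k F k) z0 by rewrite EF; left.
    by rewrite EF -closureU -E closure_sublevel.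
  rewrite leNgt; apply/negP => lt.
  have : (U `|` V) z0 by rewrite -E.
  case=> [Uz|Vz].
    have [w [Vw Uw]] := cV U (open_nbhs_nbhs (conj oU Uz)).
    by suff : set0 w by []; rewrite -UV.
  have [w [Uw Vw]] := cU V (open_nbhs_nbhs (conj oV Vz)).
  by suff : set0 w by []; rewrite -UV.
have nc0 : ~~ root p^`() z0.
  by apply/negP => /crit; rewrite z0s ltNge s0s.
have [r r0 rP] := local_sublevel_link s p1 nc0.
have [z1 [Uz1 z1r]] := cU _ (nbhs_disc_center z0 r0).
have [z2 [Vz2 z2r]] := cV _ (nbhs_disc_center z0 r0).
have z1s : O s z1 by rewrite E; left.
have z2s : O s z2 by rewrite E; right.
have [K [KO cK K1 K2]] := rP z1 z2 z1r z2r z1s z2s.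
have : K `<=` U.
  apply: (connected_sub_open cK oU oV _ _ K1 Uz1); first by rewrite -E.
  by rewrite -setIA UV setI0.
by move=> /(_ z2 K2) Uz2; suff : set0 z2 by []; rewrite -UV.
Qed.

Lemma closed_sublevel_connected p (s : R) : (1 < size p)%N -> 0 < s ->
  (forall c, root p^`() c -> nc p.[c] < s) ->
  connected ([set z | nc p.[z] <= s] : set T).
Proof.
move=> p1 s0 crit; rewrite -closure_sublevel //.
by apply/connected_closure/(sublevel_connected p1 s0 crit).
Qed.

(** A piece that misses the neighborhood [Q] of infinity is bounded and has |p| <= s on its
    boundary, against the maximum principle; and the connected [Q] meets only one piece. *)
Lemma superlevel_connected p (s : R) : (1 < size p)%N ->
  connected ([set z | s < nc p.[z]] : set T).
Proof.
move=> p1; have oS : open ([set z | s < nc p.[z]] : set T).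
  exact: (open_gt_cont (@nc_horner_cont R p)).
have [b bP] := sublevel_bounded s p1.
pose Q := outer_square (`|b| + 1).
have b0 : 0 < `|b| + 1 by rewrite ltr_wpDl.
have cQ : connected Q by exact: outer_square_connected.
have QS : Q `<=` [set z | s < nc p.[z]].
  move=> z Qz /=; rewrite ltNge; apply/negP => /bP zb.
  have := ler_norm b; have := Re_le_nc z; have := Im_le_nc z.
  case: Qz => h; lra.
have Qb z : ~ Q z -> nc z <= 2 * (`|b| + 1).
  move=> nQ; apply: le_trans (nc_le_ReIm _) _.
  rewrite mulr_natl mulr2n; apply: lerD; rewrite leNgt; apply/negP => h; apply: nQ; [left|right]; exact: h.
have Q0 : Q (Complex (`|b| + 2) 0).
  by left => /=; apply: lt_le_trans (ler_norm _); rewrite ltrD2l ltr1n.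
have piece U V z : open U -> open V -> U `&` V = set0 ->
    [set z : T | s < nc p.[z]] = U `|` V -> U z -> U `&` Q = set0 -> False.
  move=> oU oV UV E Uz UQ.
  have US : U `<=` [set z : T | s < nc p.[z]] by rewrite E => w; left.
  apply: (@max_principle_bounded R p U (2 * (`|b| + 1)) s z) => //.
  - by move=> w Uw; apply: Qb => Qw; suff : set0 w by []; rewrite -UQ.
  - exact: US.
  - move=> w cw nw; rewrite leNgt; apply/negP => ws.
    have : (U `|` V) w by rewrite -E.
    case=> // Vw; have [v [Uv Vv]] := cw V (open_nbhs_nbhs (conj oV Vw)).
    by suff : set0 v by []; rewrite -UV.
apply: connected_sep_open => // U V oU oV UV [u Uu] [v Vv] E.
have : (U `|` V) (Complex (`|b| + 2) 0) by rewrite -E; exact: QS.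
case=> h.
  have QU : Q `<=` U.
    apply: (connected_sub_open cQ oU oV _ _ Q0 h); first by rewrite -E.
    by rewrite -setIA UV setI0.
  apply: (piece V U v) => //; first by rewrite setIC.
    by rewrite setUC.
  apply/seteqP; split => // w [Vw /QU Uw].
  by rewrite -UV.
have VU := etrans (setIC V U) UV.
have QV : Q `<=` V.
  apply: (connected_sub_open cQ oV oU _ _ Q0 h); first by rewrite setUC -E.
  by rewrite -setIA VU setI0.
apply: (piece U V u) => //.
apply/seteqP; split => // w [Uw /QV Vw].
by rewrite -UV.
Qed.

End Lemniscates.

(** * Boundaries of full continua *)

Section Unicoherence.
Variable R : realType.
Local Notation C := (complex R).
Local Notation T := (cplane R).
Implicit Types (f g : C -> C).

(** Continuity at a point in terms of the modulus, so that products, inverses and square roots of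
    maps are handled by plain estimates. *)
Definition ctn f (z : C) := forall e : R, 0 < e ->
  exists2 r : R, 0 < r & forall w, nc (w - z) < r -> nc (f w - f z) < e.

Lemma ctn_id z : ctn id z.
Proof. by move=> e e0; exists e. Qed.

Lemma ctn_cst c z : ctn (fun=> c) z.
Proof. by move=> e e0; exists 1 => // w _; rewrite subrr nc0. Qed.

Lemma ctn_comp f g z : ctn f z -> ctn g (f z) -> ctn (fun w => g (f w)) z.
Proof.
move=> cf cg e /cg[r r0 rP]; have [r' r'0 r'P] := cf r r0.
by exists r' => // w /r'P /rP.
Qed.

Lemma ctn_add f g z : ctn f z -> ctn g z -> ctn (fun w => f w + g w) z.
Proof.
move=> cf cg e e0; have e20 : 0 < e / 2 by rewrite divr_gt0.
have [r r0 rP] := cf _ e20; have [s s0 sP] := cg _ e20.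
exists (Num.min r s); first by rewrite lt_min r0.
move=> w; rewrite lt_min => /andP[/rP h1 /sP h2].
have -> : f w + g w - (f z + g z) = (f w - f z) + (g w - g z) by ring.
by apply: le_lt_trans (ncD _ _) _; rewrite [e]splitr ltrD.
Qed.

Lemma ctn_mul f g z : ctn f z -> ctn g z -> ctn (fun w => f w * g w) z.
Proof.
move=> cf cg e e0; pose M := nc (f z) + nc (g z) + 1.
have [nf ng] := (nc_ge0 (f z), nc_ge0 (g z)).
have M1 : 0 < M by rewrite /M; lra.
have M2 : 0 < M + M by lra.
pose d := Num.min 1 (e / (M + M)).
have d0 : 0 < d by rewrite lt_min ltr01 divr_gt0.
have d1 : d <= 1 by rewrite ge_min lexx.
have dM : d * (M + M) <= e by rewrite -ler_pdivlMr // ge_min lexx orbT.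
have [r r0 rP] := cf _ d0; have [s s0 sP] := cg _ d0.
exists (Num.min r s); first by rewrite lt_min r0.
move=> w; rewrite lt_min => /andP[/rP h1 /sP h2].
have -> : f w * g w - f z * g z = (f w - f z) * (g w - g z) + (f w - f z) * g z
   + f z * (g w - g z) by ring.
apply: le_lt_trans (ncD _ _) _.
have := ncD ((f w - f z) * (g w - g z)) ((f w - f z) * g z); rewrite !ncM => h3.
have [a0 b0] := (nc_ge0 (f w - f z), nc_ge0 (g w - g z)).
move: h1 h2 h3 a0 b0; set a := nc (f w - f z); set b := nc (g w - g z).
set t := nc (_ + _) => h1 h2 h3 a0 b0.
have : a * b <= d by nra.
have : a * nc (g z) <= d * nc (g z) by nra.
have : nc (f z) * b <= nc (f z) * d by nra.
have : d * M = d * nc (f z) + d * nc (g z) + d by rewrite /M; ring.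
have : 0 < d * M by rewrite mulr_gt0.
by nra.
Qed.

Lemma ctn_opp f z : ctn f z -> ctn (fun w => - f w) z.
Proof.
move=> cf e /cf[r r0 rP]; exists r => // w /rP.
by rewrite -opprD ncN.
Qed.

Lemma ctn_inv f z : f z != 0 -> ctn f z -> ctn (fun w => (f w)^-1) z.
Proof.
move=> fz cf e e0; have n0 : 0 < nc (f z) by rewrite nc_gt0.
pose d := Num.min (nc (f z) / 2) (e * nc (f z) * nc (f z) / 2).
have d0 : 0 < d by rewrite lt_min !divr_gt0 // !mulr_gt0.
have [r r0 rP] := cf _ d0; exists r => // w /rP.
rewrite lt_min => /andP[h1 h2].
have h3 : nc (f z) / 2 < nc (f w).
  have := nc_sub (f z) (f w); rewrite ncBC; lra.
have fw : f w != 0 by rewrite -nc_gt0; lra.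
have -> : (f w)^-1 - (f z)^-1 = - (f w - f z) / (f w * f z).
  by field; rewrite fz fw.
rewrite ncM ncV ncM ncN ltr_pdivrMr ?mulr_gt0 //; last by lra.
apply: (lt_trans h2).
have -> : e * nc (f z) * nc (f z) / 2 = e * (nc (f z) / 2 * nc (f z)) by ring.
by rewrite ltr_pM2l // ltr_pM2r.
Qed.

Lemma ctn_real (h : C -> R) (k : R) z : (forall w, `|h w - h z| <= k * nc (w - z)) ->
  ctn (fun w => (h w)%:C%C) z.
Proof.
move=> H e e0; exists (e / (`|k| + 1)); first by rewrite divr_gt0 // ltr_wpDl.
move=> w; rewrite ltr_pdivlMr ?ltr_wpDl // => wz.
rewrite -rmorphB nc_real; apply: le_lt_trans (H w) (le_lt_trans _ wz).
rewrite mulrC ler_wpM2l ?nc_ge0 //; have := ler_norm k; lra.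
Qed.

Lemma ctn_nc z : ctn (fun w => (nc w)%:C%C) z.
Proof. by apply: (@ctn_real _ 1) => w; rewrite mul1r; exact: nc_dist. Qed.

Lemma ctn_sdist (E : set T) z : E !=set0 -> ctn (fun w => (sdist E w)%:C%C) z.
Proof.
move=> E0; apply: (@ctn_real _ 1) => w; rewrite mul1r.
have h1 := sdist_lip w z E0; have h2 := sdist_lip z w E0.
rewrite ncBC in h2; rewrite ler_norml; apply/andP; split; lra.
Qed.

Lemma ctn_prod (n : nat) (F : nat -> C -> C) z : (forall j, (j < n)%N -> ctn (F j) z) ->
  ctn (fun w => \prod_(j < n) F j w) z.
Proof.
elim: n => [|n IH] H.
  rewrite (_ : (fun w => _) = (fun=> 1)); first exact: ctn_cst.
  by apply/funext => w; rewrite big_ord0.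
rewrite (_ : (fun w => _) = (fun w => \prod_(j < n) F j w * F n w)).
  apply: ctn_mul; last exact: H.
  by apply: IH => j jn; apply: H; exact: leqW.
by apply/funext => w; rewrite big_ord_recr.
Qed.

(** The principal square root of a unimodular w <> -1: the direction of the bisector of 1 and w. *)
Definition usqrt (w : C) := (1 + w) / (nc (1 + w))%:C%C.

Lemma real_neq0 (x : R) : (x%:C%C != 0 :> C) = (x != 0).
Proof. by rewrite -!(inj_eq (@complexI R)). Qed.

Lemma usqrt_cont w : 1 + w != 0 -> ctn usqrt w.
Proof.
move=> w1; have c1 : ctn (fun v => 1 + v) w by apply: ctn_add; [exact: ctn_cst|exact: ctn_id].
apply: (ctn_mul c1); apply: ctn_inv; first by rewrite real_neq0 nc_eq0.
exact: ctn_comp c1 (@ctn_nc _).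
Qed.

Lemma nc_sqr (z : C) : (nc z)%:C%C ^+ 2 = z * z^*%C.
Proof. by rewrite -sqr_normc. Qed.

Lemma usqrtK w : nc w = 1 -> 1 + w != 0 -> usqrt w ^+ 2 = w.
Proof.
move=> w1 nw; have w0 : w != 0 by rewrite -nc_eq0 w1 oner_eq0.
have wc : w^*%C = w^-1.
  apply: (mulfI w0); rewrite mulfV // -nc_sqr w1.
  by rewrite expr2 -rmorphM mulr1.
rewrite /usqrt exprMn exprVn nc_sqr rmorphD rmorph1 /= wc.
have h : w + 1 != 0 by rewrite addrC.
by field; rewrite ?w0 ?h ?nw.
Qed.

Lemma avg1 (x r : R) : x < r -> x < (r + x) / 2.
Proof. lra. Qed.

Lemma avg2 (x r a b : R) : a < (r + x) / 2 -> b < (r - x) / 2 -> a + b < r.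
Proof. lra. Qed.

Lemma unif_cont f (rho : R) : (forall z, ctn f z) -> forall e : R, 0 < e ->
  exists2 d : R, 0 < d & forall z w, nc z <= rho -> nc w <= rho ->
    nc (z - w) <= d -> nc (f z - f w) < e.
Proof.
move=> cf e e0; have e20 : 0 < e / 2 by rewrite divr_gt0.
pose U k : set T := [set z | exists2 r : R, k.+1%:R^-1 < r &
   forall v w, nc (v - z) < r -> nc (w - z) < r -> nc (f v - f w) < e].
have [||z _|k kP] := @compact_increasing_cover T _ U (@compact_cdisc R 0 rho).
- move=> k; rewrite openE => z [r rk rP]; apply/nbhs_disc.
  exists ((r - k.+1%:R^-1) / 2); first by rewrite divr_gt0 ?subr_gt0.
  move=> w; rewrite /disc /= => wz; exists ((r + k.+1%:R^-1) / 2); first exact: avg1.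
  have tri v : nc (v - w) < (r + k.+1%:R^-1) / 2 -> nc (v - z) < r.
    move=> vw; have -> : v - z = (v - w) + (w - z) by ring.
    exact: le_lt_trans (ncD _ _) (avg2 vw wz).
  by move=> v v' /tri vr /tri vr'; exact: rP.
- move=> k z [r rk rP]; exists r => //; apply: le_lt_trans rk.
  by rewrite lef_pV2 ?posrE // ler_nat.
- have [r r0 rP] := cf z _ e20.
  exists (Num.truncn r^-1); exists r.
    by rewrite invf_plt ?posrE //; exact: truncnS_gt.
  move=> v w /rP h1 /rP h2; have -> : f v - f w = (f v - f z) - (f w - f z) by ring.
  by apply: le_lt_trans (ncB _ _) _; rewrite [e]splitr ltrD.
exists k.+1%:R^-1; first by rewrite invr_gt0.
move=> z w zr wr zw; have [|r rk rP] := kP z; first by rewrite /cdisc /= subr0.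
apply: rP; last by rewrite ncBC; exact: le_lt_trans rk.
by rewrite subrr nc0; apply: lt_trans rk; rewrite invr_gt0.
Qed.

(* A square root of a unimodular map along rays, as a product of principal
   square roots of ratios close to 1. *)
Lemma sqrt_lift f (rho : R) : (forall z, ctn f z) -> (forall z, nc (f z) = 1) ->
  0 <= rho ->
  exists h : C -> C, forall z, nc z <= rho -> ctn h z /\ h z ^+ 2 = f z.
Proof.
move=> cf f1 rho0; have [d d0 dP] := unif_cont rho cf ltr01.
(* Along a ray cut into n steps, [f] moves by less than 1 at each step, so the ratios [q j] of
   consecutive values never equal -1. *)
pose n := (Num.truncn (rho / d)).+1.
have n0 : 0 < n%:R :> R by rewrite ltr0n.
have nd : rho / n%:R <= d.
  rewrite ler_pdivrMr // mulrC -ler_pdivrMr //; apply/ltW; exact: truncnS_gt.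
pose x j (z : C) := (j%:R / n%:R)%:C%C * z.
have xb j z : (j <= n)%N -> nc z <= rho -> nc (x j z) <= rho.
  move=> jn zr; rewrite nc_scale_real ?divr_ge0 //; apply: le_trans zr.
  by rewrite ler_piMl ?nc_ge0 // ler_pdivrMr // mul1r ler_nat.
pose q j z := f (x j.+1 z) / f (x j z).
have fn0 z : f z != 0 by rewrite -nc_eq0 f1 oner_eq0.
have q1 j z : nc (q j z) = 1 by rewrite ncM ncV !f1 invr1 mulr1.
have qn j z : (j < n)%N -> nc z <= rho -> 1 + q j z != 0.
  move=> jn zr; apply/eqP => /eqP; rewrite addr_eq0 eq_sym eqr_oppLR => /eqP qm.
  have : nc (f (x j.+1 z) - f (x j z)) < 1.
    apply: dP; [exact: xb|by apply: xb => //; exact: ltnW|].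
    rewrite /x -mulrBl -rmorphB -mulrBl -natrB // subSnn.
    rewrite nc_scale_real ?divr_ge0 // mul1r mulrC; apply: le_trans nd.
    by rewrite ler_wpM2r ?invr_ge0 // ltW.
  have -> : f (x j.+1 z) - f (x j z) = (q j z - 1) * f (x j z).
    by rewrite /q; field.
  rewrite ncM f1 mulr1 qm -opprD ncN -[1 + 1]/(2%:R) nc_nat; lra.
pose h z := sqrtc (f 0) * \prod_(j < n) usqrt (q j z).
exists h => z zr; split.
  apply: (@ctn_mul (fun=> sqrtc (f 0)) (fun w => \prod_(j < n) usqrt (q j w))).
    exact: ctn_cst.
  apply: (@ctn_prod n (fun j w => usqrt (q j w))) => j jn; apply: (@ctn_comp (q j) usqrt); last by apply/usqrt_cont/qn.
  have cx i : ctn (x i) z by apply: ctn_mul; [exact: ctn_cst|exact: ctn_id].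
  apply: ctn_mul; first exact: ctn_comp (cx _) (cf _).
  by apply: ctn_inv => //; exact: ctn_comp (cx _) (cf _).
rewrite /h exprMn sqr_sqrtc -prodrXl.
rewrite (eq_bigr (fun j : 'I_n => q j z)); last first.
  by move=> j _; apply: usqrtK => //; apply: qn.
have tele k : (k <= n)%N -> f 0 * \prod_(j < k) q j z = f (x k z).
  elim: k => [|k IH] kn; first by rewrite big_ord0 mulr1 /x mul0r mul0r.
  rewrite big_ord_recr /= mulrA IH ?(ltnW kn) // /q; by field.
by rewrite tele // /x divff ?gt_eqF // mul1r.
Qed.

(** The radial retraction onto a closed disc; it extends to the plane a square root that is
    controlled only on the disc. *)
Definition retr (rho : R) (z : C) := (rho / Num.max rho (nc z))%:C%C * z.

Lemma retr_in rho z : 0 < rho -> nc z <= rho -> retr rho z = z.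
Proof. by move=> r0 zr; rewrite /retr (max_idPl zr) divff ?gt_eqF // mul1r. Qed.

Lemma retr_le rho z : 0 < rho -> nc (retr rho z) <= rho.
Proof.
move=> r0; rewrite nc_scale_real; last by rewrite divr_ge0 ?ltW // lt_max r0.
have [zr|zr] := leP (nc z) rho; first by rewrite divff ?gt_eqF ?mul1r.
by rewrite mulfVK // gt_eqF // (lt_trans r0).
Qed.

Lemma retr_out rho z : 0 < rho -> rho < nc z -> nc (retr rho z) = rho.
Proof.
move=> r0 zr; rewrite nc_scale_real; last by rewrite divr_ge0 ?ltW // lt_max r0.
by rewrite (max_idPr (ltW zr)) mulfVK // gt_eqF // (lt_trans r0).
Qed.

Lemma max_lip (r a b : R) : `|Num.max r a - Num.max r b| <= `|a - b|.
Proof.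
have h1 := ler_norm (a - b); have := ler_norm (b - a); rewrite distrC => h2.
rewrite ler_norml; case: (leP r a) => ra; case: (leP r b) => rb;
  apply/andP; split; lra.
Qed.

Lemma ctn_retr rho z : 0 < rho -> ctn (retr rho) z.
Proof.
move=> r0; apply: ctn_mul; last exact: ctn_id.
rewrite (_ : (fun w => _) = (fun w => rho%:C%C * ((Num.max rho (nc w))%:C%C)^-1)); last first.
  by apply/funext => w; rewrite rmorphM fmorphV.
apply: ctn_mul; first exact: ctn_cst.
apply: ctn_inv; first by rewrite real_neq0 gt_eqF // lt_max r0.
apply: (@ctn_real _ 1) => w; rewrite mul1r.
apply: le_trans (nc_dist w z).
exact: max_lip.
Qed.

Lemma connected_pm (A : set T) (a : C -> C) : (forall z, ctn a z) -> connected A ->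
  (forall z, A z -> a z ^+ 2 = 1) -> forall z w, A z -> A w -> a z = a w.
Proof.
move=> ca cA a1 z w Az Aw.
have clo (c : C) : closed ([set v | a v = c] : set T).
  rewrite (_ : [set v | a v = c] = [set v : T | nc (a v - c) <= 0]); last first.
    apply/seteqP; split => v /=; first by move=> ->; rewrite subrr nc0.
    move=> h; apply/eqP; rewrite -subr_eq0 -nc_eq0 eq_le h; exact: nc_ge0.
  apply: closed_le_cont => v; apply: cont_discR => e e0.
  have [r r0 rP] := ca v e e0; exists r => // u /rP h.
  apply: le_lt_trans (nc_dist _ _) _.
  by have -> : a u - c - (a v - c) = a u - a v by ring.
have pm v : A v -> a v = a z \/ a v = - a z.
  move=> Av; have /eqP := etrans (a1 v Av) (esym (a1 z Az)).
  by rewrite eqf_sqr => /orP[]/eqP; [left|right].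
have az : a z != 0.
  by apply/eqP => az; have := a1 z Az; rewrite az expr0n /= => /esym/eqP; rewrite oner_eq0.
have : A `<=` [set v | a v = a z].
  apply: (@connected_sub_closed T A _ ([set v | a v = - a z]) z) => //.
  apply/seteqP; split => // v [[_ /= h1] h2].
  move: h2; rewrite h1 => /eqP; rewrite -subr_eq0 opprK -mulr2n mulrn_eq0 /=.
  by rewrite (negbTE az).
by move=> /(_ w Aw) /= ->.
Qed.

(* If the boundary splits as E1 + E2, take gam unimodular with gam = 1 on E1 and
   gam = i on E2; the map equal to gam^2 on X and gam^-2 off X is continuous, so
   it has a square root h. The ratios h / gam on X and h * gam off X are then
   constant signs, which gives i^2 = 1. *)
Lemma boundary_connected (X : set T) : compact X -> closed X -> connected X ->
  connected (~` X) -> connected (closure X `&` closure (~` X)).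
Proof.
move=> cpX cX coX coXc; rewrite -((closure_id X).1 cX).
set Y := closure (~` X).
have coY : connected Y by exact: connected_closure.
have cY : closed Y by exact: closed_closure.
apply: connected_sep_closed; first exact: closedI.
move=> E1 E2 cE1 cE2 E12 [e1 Ee1] [e2 Ee2] EE.
have n1 : E1 !=set0 by exists e1.
have n2 : E2 !=set0 by exists e2.
have [rho rho0 XR] : exists2 rho : R, 0 < rho & forall z, X z -> nc z < rho.
  have [||k _|k kP] := @compact_increasing_cover T X (fun k => disc 0 k.+1%:R) cpX.
  - by move=> k; exact: open_disc.
  - by move=> k z; rewrite /disc /= => h; apply: lt_trans h _; rewrite ltr_nat.
  - exists (Num.truncn (nc (k - 0))); exact: truncnS_gt.
  exists k.+1%:R => // z /kP; by rewrite /disc /= subr0.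
pose d1 := sdist E1; pose d2 := sdist E2.
have dpos z : 0 < d1 z + d2 z.
  have [h1 h2] := (sdist_ge0 z n1, sdist_ge0 z n2).
  have [zE1|zE1] := pselect (E1 z).
    have zE2 : ~ E2 z by move=> zE2; suff : set0 z by []; rewrite -E12.
    by have := sdist_gt0 n2 cE2 zE2; rewrite /d1 /d2; lra.
  by have := sdist_gt0 n1 cE1 zE1; rewrite /d1 /d2; lra.
pose phi z := d1 z / (d1 z + d2 z).
have cphi z : ctn (fun w => (phi w)%:C%C) z.
  rewrite (_ : (fun w => _) = (fun w => (d1 w)%:C%C / ((d1 w)%:C%C + (d2 w)%:C%C))); last first.
    by apply/funext => w; rewrite rmorphM fmorphV rmorphD.
  apply: ctn_mul; first exact: ctn_sdist.
  apply: ctn_inv; first by rewrite -rmorphD real_neq0 gt_eqF.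
  by apply: ctn_add; exact: ctn_sdist.
(* [g] runs along the segment from 1 to i, which misses 0, so it can be normalised to [gam]. *)
pose g z : C := 1 - (phi z)%:C%C + 'i%C * (phi z)%:C%C.
have gE z : g z = Complex (1 - phi z) (phi z).
  by rewrite [RHS]complexE /= /g rmorphB rmorph1.
have g0 z : g z != 0.
  by rewrite gE eq_complex /=; apply/negP => /andP[/eqP h1 /eqP h2]; move: h1; rewrite h2 subr0 => /eqP; rewrite oner_eq0.
have cg z : ctn g z.
  apply: ctn_add; last by apply: ctn_mul => //; exact: ctn_cst.
  by apply: ctn_add; [exact: ctn_cst|exact: ctn_opp].
pose gam z := g z / (nc (g z))%:C%C.
have cgam z : ctn gam z.
  apply: ctn_mul => //; apply: ctn_inv; first by rewrite real_neq0 nc_eq0.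
  exact: ctn_comp (cg z) (@ctn_nc _).
have gam1 z : nc (gam z) = 1.
  by rewrite ncM ncV nc_real ger0_norm ?nc_ge0 // divff // nc_eq0.
have gamn0 z : gam z != 0 by rewrite -nc_eq0 gam1 oner_eq0.
have gamE1 z : E1 z -> gam z = 1.
  move=> Ez; rewrite /gam gE /phi /d1 (sdist_eq0 Ez) mul0r subr0.
  by rewrite -[Complex 1 0]/(1 : C) nc1 divr1.
have gamE2 z : E2 z -> gam z = 'i%C.
  move=> Ez; have := dpos z; rewrite /gam gE /phi /d2 (sdist_eq0 Ez) addr0 => d0.
  rewrite divff ?gt_eqF // subrr /Normc.normc /= expr0n expr1n /= add0r sqrtr1.
  by rewrite divr1.
(* On the boundary [gam] is 1 or i, so its fourth power is 1: the two formulas for [f] agree where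
   [X] and [Y] meet. *)
have gam4 z : (X `&` Y) z -> gam z ^+ 2 = gam z ^- 2.
  rewrite EE => -[/gamE1 ->|/gamE2 ->]; first by rewrite expr1n invr1.
  by rewrite sqr_i invrN invr1.
pose f z := if z \in X then gam z ^+ 2 else gam z ^- 2.
have fY z : Y z -> f z = gam z ^- 2.
  by move=> Yz; rewrite /f; case: ifPn => // /set_mem Xz; apply: gam4.
have fX z : X z -> f z = gam z ^+ 2 by move=> Xz; rewrite /f mem_set.
have c2 z : ctn (fun w => gam w ^+ 2) z by apply: ctn_mul.
have cm2 z : ctn (fun w => gam w ^- 2) z by apply: ctn_inv => //; rewrite expf_neq0.
have cf z : ctn f z.
  have [Xz|Xz] := pselect (X z); have [Yz|Yz] := pselect (Y z).
  - move=> e e0; have [r r0 rP] := c2 z e e0; have [s s0 sP] := cm2 z e e0.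
    exists (Num.min r s); first by rewrite lt_min r0.
    move=> w; rewrite lt_min => /andP[/rP h1 /sP h2].
    have [Xw|Xw] := pselect (X w); first by rewrite !fX.
    have Yw : Y w by exact: subset_closure.
    by rewrite (fY _ Yw) (fY _ Yz); exact: h2.
  - move=> e e0; have [r r0 rP] := c2 z e e0.
    have [s s0 sP] := open_near (closed_openC cY) Yz.
    exists (Num.min r s); first by rewrite lt_min r0.
    move=> w; rewrite lt_min => /andP[/rP h1 /sP h2]; rewrite !fX //.
    by apply: contrapT => nX; apply: h2; exact: subset_closure.
  - move=> e e0; have [r r0 rP] := cm2 z e e0.
    have [s s0 sP] := open_near (closed_openC cX) Xz.
    exists (Num.min r s); first by rewrite lt_min r0.
    move=> w; rewrite lt_min => /andP[/rP h1 /sP h2].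
    have Yw : Y w by exact: subset_closure.
    by rewrite (fY _ Yw) (fY _ Yz); exact: h1.
  - by exfalso; apply: Yz; exact: subset_closure.
have f1 z : nc (f z) = 1.
  by rewrite /f; case: ifP => _; rewrite ?ncV ncX gam1 expr1n ?invr1.
have [h hP] := sqrt_lift cf f1 (ltW rho0).
pose r := retr rho.
have cr z : ctn (fun w => h (r w)) z.
  apply: ctn_comp; first exact: ctn_retr.
  by have [] := hP (r z) (retr_le z rho0).
have cgr z : ctn (fun w => gam (r w)) z by apply: ctn_comp; [exact: ctn_retr|].
pose a z := h (r z) / gam (r z); pose b z := h (r z) * gam (r z).
have ca z : ctn a z by apply: ctn_mul => //; apply: ctn_inv.
have cb z : ctn b z by apply: ctn_mul.
have rX z : X z -> r z = z by move=> /XR /ltW; exact: retr_in.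
(* [X] lies in the open disc of radius rho, so a point retracted onto the circle is outside [X]. *)
have rY z : Y z -> Y (r z).
  move=> Yz; have [zr|zr] := leP (nc z) rho; first by rewrite /r retr_in.
  by apply: subset_closure => /XR; rewrite retr_out // ltxx.
have hr z : h (r z) ^+ 2 = f (r z) by have [] := hP (r z) (retr_le z rho0).
have aX : forall z w, X z -> X w -> a z = a w.
  apply: connected_pm => // z Xz.
  by rewrite /a exprMn exprVn hr rX // fX // divff // expf_neq0.
have bY : forall z w, Y z -> Y w -> b z = b w.
  apply: connected_pm => // z /rY Yz.
  by rewrite /b exprMn hr fY // mulVf // expf_neq0.
have [Xe1 Ye1] : (X `&` Y) e1 by rewrite EE; left.
have [Xe2 Ye2] : (X `&` Y) e2 by rewrite EE; right.
have := aX e1 e2 Xe1 Xe2; have := bY e1 e2 Ye1 Ye2.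
rewrite /a /b !rX // gamE1 // gamE2 // invr1 mulr1 => -> /eqP.
have i0 : ('i%C : C) != 0 by rewrite eq_complex /= oner_eq0 andbF.
have h20 : h e2 != 0.
  have := hr e2; rewrite rX // => h2; apply/eqP => h0; move: h2.
  rewrite h0 expr0n /= => /esym h2; have := f1 e2; rewrite h2 nc0 => /eqP.
  by rewrite eq_sym oner_eq0.
rewrite (inj_eq (mulfI h20)) => /eqP h4.
have : ('i%C : C) * 'i%C = 1 by rewrite {2}h4 mulfV.
rewrite -expr2 sqr_i => /eqP; rewrite eq_sym -subr_eq0 opprK -mulr2n mulrn_eq0 /=.
by rewrite oner_eq0.
Qed.

End Unicoherence.

(** * A Harnack inequality for polynomials without zeros *)

Section RootsOfUnity.
Variable R : realType.
Local Notation C := (complex R).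
Implicit Types (p P : {poly C}).

Lemma prim_root_exists N : (0 < N)%N -> exists w : C, N.-primitive_root w.
Proof.
pose p : {poly C} := 'X^N - 1; have [r Dp] := closed_field_poly_normal p.
move=> n_gt0; rewrite (monicP _) ?monicXnsubC // scale1r in Dp.
have rn1: all N.-unity_root r by apply/allP=> z; rewrite -root_prod_XsubC -Dp.
have sz_r: (N < (size r).+1)%N.
  by rewrite -(size_prod_XsubC r id) -Dp size_XnsubC.
have [|z _ zP] := hasP (has_prim_root n_gt0 rn1 _ sz_r); last by exists z.
by rewrite -separable_prod_XsubC -Dp separable_Xn_sub_1 // pnatr_eq0 -lt0n.
Qed.

Lemma nc_prim N (w : C) : N.-primitive_root w -> nc w = 1.
Proof.
move=> pw; have N0 := prim_order_gt0 pw.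
apply/eqP; rewrite -(eqrXn2 (n := N)) ?nc_ge0 // expr1n -ncX (prim_expr_order pw).
by rewrite nc1.
Qed.

Lemma sum_prim N (w : C) m : N.-primitive_root w ->
  \sum_(j < N) w ^+ (j * m) = if (N %| m)%N then N%:R else 0.
Proof.
move=> pw; case: ifPn => Nm.
  rewrite (eq_bigr (fun=> 1)) ?sumr_const ?card_ord // => j _.
  by apply/eqP; rewrite -(prim_order_dvd pw) dvdn_mull.
have wm : w ^+ m - 1 != 0 by rewrite subr_eq0 -(prim_order_dvd pw).
apply: (mulfI wm); rewrite mulr0.
rewrite (eq_bigr (fun j : 'I_N => (w ^+ m) ^+ j)) => [|j _]; last by rewrite -exprM mulnC.
by rewrite -subrX1 exprAC (prim_expr_order pw) expr1n subrr.
Qed.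

(** A discrete Cauchy integral over N points of a circle, exact because N is at least the size of
    [p]; the exponent N - k stands for -k. *)
Lemma coef_sum_prim N (w : C) p (r : C) k : N.-primitive_root w ->
  (size p <= N)%N -> (k < N)%N ->
  \sum_(j < N) p.[r * w ^+ j] * w ^+ (j * (N - k)) = N%:R * (p`_k * r ^+ k).
Proof.
move=> pw pN kN.
transitivity (\sum_(j < N) \sum_(m < N) p`_m * r ^+ m * w ^+ (j * (m + (N - k)))).
  apply: eq_bigr => j _; rewrite (horner_coef_wide _ pN) mulr_suml.
  apply: eq_bigr => m _; rewrite mulnDr exprD mulrA; congr (_ * _).
  by rewrite exprMn -exprM mulrA.
rewrite exchange_big /= (bigD1 (Ordinal kN)) //= [X in _ + X]big1 ?addr0.
  by rewrite -mulr_sumr (sum_prim _ pw) subnKC 1?ltnW // dvdnn mulrC.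
move=> m mk; rewrite -mulr_sumr (sum_prim _ pw).
case: ifPn => [|_]; last by rewrite mulr0.
rewrite addnBA 1?ltnW // -eqn_mod_dvd; last by rewrite (leq_trans (ltnW kN)) ?leq_addl.
rewrite modnDr !modn_small // => mk'; exfalso; move/eqP: mk; apply.
by apply: val_inj; apply/eqP.
Qed.

Lemma cauchy_coef p (r M : R) k : 0 < r -> (forall z, nc z = r -> nc p.[z] <= M) ->
  nc p`_k * r ^+ k <= M.
Proof.
move=> r0 pM; pose N := (size p + k).+1.
have [w pw] := @prim_root_exists N isT.
have := @coef_sum_prim N w p r%:C%C k pw; rewrite ltnS leq_addl => H.
have {}H := H (leqW (leq_addr _ _)) isT.
have N0 : 0 < N%:R :> R by rewrite ltr0n.
rewrite -(ler_pM2l N0) -[X in X * _ <= _](nc_nat R) -[r in r ^+ k](gtr0_norm r0).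
rewrite -nc_real -ncX -!ncM -H; apply: le_trans (nc_sum _ _ _) _.
apply: (@le_trans _ _ (\sum_(j < N) M)); last by rewrite sumr_const card_ord mulr_natl.
apply: ler_sum => j _; rewrite ncM ncX (nc_prim pw) expr1n mulr1; apply: pM.
by rewrite ncM ncX (nc_prim pw) expr1n mulr1 nc_real gtr0_norm.
Qed.

Lemma conj_prim N (w : C) : N.-primitive_root w -> w^*%C = w ^+ N.-1.
Proof.
move=> pw; have w0 : w != 0 by rewrite -nc_gt0 (nc_prim pw).
apply: (mulfI w0); rewrite -exprS prednK ?(prim_order_gt0 pw) // (prim_expr_order pw).
by rewrite -sqr_normc normcE' (nc_prim pw) expr1n.
Qed.

Lemma conj_horner p (z : C) : (p.[z])^*%C = (map_poly (@conjc R) p).[z^*%C].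
Proof. by rewrite horner_map. Qed.

(** The numbers a_j = A - Re P(x_j) are nonnegative with mean A, because P(0) = 0. Their k-th
    discrete Fourier coefficient is -P_k r^k / 2, and its modulus is at most that mean. *)
Lemma borel_caratheodory_coef P (r A : R) k : 0 < r -> P`_0 = 0 ->
  (forall z, nc z = r -> complex.Re P.[z] <= A) -> (0 < k)%N ->
  nc P`_k * r ^+ k <= 2 * A.
Proof.
move=> r0 P0 PA k0; pose N := (size P + k).+1.
have [w pw] := @prim_root_exists N isT.
have N0 : 0 < N%:R :> R by rewrite ltr0n.
pose x j : C := r%:C%C * w ^+ j.
have xr j : nc (x j) = r by rewrite ncM ncX (nc_prim pw) expr1n mulr1 nc_real gtr0_norm.
pose a j := A - complex.Re P.[x j].
have a0 j : 0 <= a j by rewrite subr_ge0 PA.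
have kN : (k < N)%N by rewrite ltnS leq_addl.
have PN : (size P <= N)%N by rewrite leqW // leq_addr.
have S1 := coef_sum_prim r%:C%C pw PN kN.
have S0 : \sum_(j < N) P.[x j] = 0.
  have := coef_sum_prim r%:C%C pw PN (ltn0Sn _).
  rewrite P0 mul0r mulr0 subn0 => {2}<-; apply: eq_bigr => j _.
  by rewrite mulnC exprM (prim_expr_order pw) expr1n mulr1.
(* The conjugated terms carry the frequencies -(m + k) with 0 < m + k < N for m < size P, so each
   averages to 0. *)
have S2 : \sum_(j < N) (P.[x j])^*%C * w ^+ (j * (N - k)) = 0.
  pose Pc := map_poly (@conjc R) P.
  have PcN : (size Pc <= N)%N by apply: leq_trans (size_poly _ _) PN.
  transitivity (\sum_(j < N) \sum_(m < N) Pc`_m * r%:C%C ^+ m * w ^+ (j * (N.-1 * m + (N - k)))).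
    apply: eq_bigr => j _; rewrite conj_horner (horner_coef_wide _ PcN) mulr_suml.
    apply: eq_bigr => m _; rewrite mulnDr exprD mulrA; congr (_ * _).
    have -> : (x j)^*%C = r%:C%C * (w ^+ N.-1) ^+ j.
      by rewrite /x rmorphM rmorphXn /= (conj_prim pw) oppr0.
    rewrite exprMn -mulrA; congr (_ * (_ * _)).
    by rewrite -!exprM [(N.-1 * j)%N]mulnC mulnA.
  rewrite exchange_big big1 //= => m _; rewrite -mulr_sumr (sum_prim _ pw).
  have [mP|mP] := ltnP m (size P); last first.
    by rewrite /Pc coef_map nth_default // raddf0 mul0r mul0r.
  case: ifPn => [|_]; last by rewrite mulr0.
  have mk : (0 < m + k < N)%N by rewrite addn_gt0 k0 orbT /= ltnS leq_add2r ltnW.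
  have e : (N.-1 * m + (N - k) + (m + k) = N * m.+1)%N.
    by rewrite addnACA subnK 1?ltnW // [(N.-1 * m + m)%N]addnC -mulSn prednK // mulnS addnC.
  move=> d; exfalso.
  have : (N %| m + k)%N by rewrite -(dvdn_addr _ d) e dvdn_mulr.
  by case/andP: mk => mk0 mkN; rewrite gtnNdvd.
have E : \sum_(j < N) (a j)%:C%C * w ^+ (j * (N - k)) = - (N%:R * (P`_k * r%:C%C ^+ k)) / 2.
  have Sw : \sum_(j < N) w ^+ (j * (N - k)) = 0.
    rewrite (sum_prim _ pw) gtnNdvd // ?subn_gt0 //.
    by rewrite ltn_subrL k0.
  transitivity (A%:C%C * \sum_(j < N) w ^+ (j * (N - k))
    - (\sum_(j < N) P.[x j] * w ^+ (j * (N - k))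
      + \sum_(j < N) (P.[x j])^*%C * w ^+ (j * (N - k))) / 2); last first.
    by rewrite Sw S1 S2 mulr0 sub0r addr0 mulNr.
  rewrite mulr_sumr -big_split mulr_suml -sumrB; apply: eq_bigr => j _ /=.
  have -> : (a j)%:C%C = A%:C%C - (P.[x j] + (P.[x j])^*%C) / 2.
    by rewrite /a rmorphB /= ReJ_add.
  by rewrite mulrBl -mulrDl mulrAC.
have Sa : \sum_(j < N) a j = N%:R * A.
  rewrite sumrB sumr_const card_ord -[X in X - _]mulr_natl.
  have -> : \sum_(j < N) complex.Re P.[x j] = 0.
    have /= <- := raddf_sum (@complex.Re R : {additive Rcomplex R -> R}) _ _ (fun j : 'I_N => P.[x j]).
    by rewrite S0.
  by rewrite subr0.
have le : nc (- (N%:R * (P`_k * r%:C%C ^+ k)) / 2) <= N%:R * A.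
  rewrite -E -Sa; apply: le_trans (nc_sum _ _ _) _; apply: ler_sum => j _.
  by rewrite ncM nc_real ncX (nc_prim pw) expr1n mulr1 ger0_norm.
move: le; rewrite ncM ncN !ncM ncX nc_real ncV !nc_nat gtr0_norm //.
rewrite -mulrA ler_pM2l // => le; lra.
Qed.

Lemma geom_half_le (t : R) n : 0 <= t -> t <= 1 / 2 -> \sum_(i < n) t ^+ i.+1 <= 2 * t.
Proof.
move=> t0 t1.
suff : \sum_(i < n) t ^+ i.+1 <= 2 * t * (1 - (1/2) ^+ n).
  have : 0 <= (1/2 : R) ^+ n by rewrite exprn_ge0.
  by set Y := _ ^+ n => Y0; set S := \sum_(_ < _) _; nra.
elim: n => [|n IH]; first by rewrite big_ord0 expr0 subrr mulr0.
rewrite big_ord_recr /=; have h : t ^+ n <= (1/2) ^+ n by rewrite lerXn2r // nnegrE; lra.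
have h2 : 0 <= t ^+ n by rewrite exprn_ge0.
rewrite !exprS; move: IH h h2.
set X := t ^+ n; set Y := (1 / 2) ^+ n; set S := \sum_(_ < _) _; nra.
Qed.

Lemma horner_dev P (r M : R) : 0 < r -> P`_0 = 0 ->
  (forall k, (0 < k)%N -> nc P`_k * r ^+ k <= M) ->
  forall z, nc z <= r / 2 -> nc P.[z] <= 2 * M * (nc z / r).
Proof.
move=> r0 P0 PM z zr.
have M0 : 0 <= M by apply: le_trans (PM 1%N isT); rewrite mulr_ge0 ?nc_ge0 ?exprn_ge0 // ltW.
rewrite (horner_coef_wide z (leqnSn _)) big_ord_recl P0 mul0r add0r.
apply: le_trans (nc_sum _ _ _) _.
apply: (@le_trans _ _ (\sum_(i < size P) M * (nc z / r) ^+ i.+1)).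
  apply: ler_sum => i _; rewrite ncM ncX lift0 expr_div_n.
  rewrite mulrA ler_pdivlMr ?exprn_gt0 // mulrAC.
  by rewrite ler_wpM2r ?exprn_ge0 ?nc_ge0 // PM.
rewrite -mulr_sumr [2 * M]mulrC -mulrA ler_wpM2l //.
by apply: geom_half_le; rewrite ?divr_ge0 ?nc_ge0 ?(ltW r0) // ler_pdivrMr // mulrC mul1r.
Qed.

End RootsOfUnity.

(** * Truncated logarithms and positive log-moduli *)

Section Harnack.
Variable R : realType.
Local Notation C := (complex R).
Implicit Types (p P : {poly C}) (w z : C).

(** Partial sum of the series of -log(1 - w). *)
Definition logS w K : C := \sum_(i < K) w ^+ i.+1 / i.+1%:R.

Lemma Re_sum (I : Type) (s : seq I) (F : I -> C) :
  complex.Re (\sum_(i <- s) F i) = \sum_(i <- s) complex.Re (F i).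
Proof. exact: (raddf_sum (@complex.Re R : {additive Rcomplex R -> R})). Qed.

Lemma Re_rM (x : R) w : complex.Re (x%:C%C * w) = x * complex.Re w.
Proof. by case: w => a b; rewrite /= mul0r subr0. Qed.

Lemma inv_nat_real n : (n%:R^-1 : C) = (n%:R^-1 : R)%:C%C.
Proof. by rewrite fmorphV rmorph_nat. Qed.

(** The mean value theorem on [0, 1] for t |-> log|1 - tw| + Re S(tw), with S the K-th partial sum:
    its derivative telescopes to -Re(w (tw)^K / (1 - tw)). *)
Lemma log_trunc w K : nc w < 1 ->
  `|ln (nc (1 - w)) + complex.Re (logS w K)| <= nc w ^+ K.+1 / (1 - nc w).
Proof.
move=> w1; pose a := complex.Re w; pose b := complex.Im w.
(* Q(t) = |1 - tw|^2 and [H] is the real part of the partial sum along the segment; as real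
   polynomials in t they can be differentiated formally. *)
pose Q : {poly R} := (1 - a *: 'X) ^+ 2 + (b *: 'X) ^+ 2.
pose H : {poly R} := \poly_(i < K.+1) (complex.Re (w ^+ i) / i%:R).
have QE t : Q.[t] = nc (1 - t%:C%C * w) ^+ 2.
  rewrite /Q !hornerE /Normc.normc.
  have -> : 1 - t%:C%C * w = Complex (1 - a * t) (- (b * t)).
    by rewrite [w]complexE -/a -/b; apply/eqP; rewrite eq_complex /=; apply/andP; split; apply/eqP; ring.
  by rewrite sqr_sqrtr ?addr_ge0 ?sqr_ge0 // sqrrN.
have tw (t : R) : 0 <= t -> t <= 1 -> nc (t%:C%C * w) <= nc w.
  by move=> t0 t1; rewrite nc_scale_real // ler_piMl ?nc_ge0.
have u0 (t : R) : 0 <= t -> t <= 1 -> 1 - nc w <= nc (1 - t%:C%C * w).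
  move=> t0 t1; apply: le_trans (nc_sub _ _); rewrite nc1.
  by have := tw t t0 t1; lra.
have upos (t : R) : 0 <= t -> t <= 1 -> 0 < nc (1 - t%:C%C * w).
  by move=> t0 t1; apply: lt_le_trans (u0 t t0 t1); rewrite subr_gt0.
have Q0 (t : R) : 0 <= t -> t <= 1 -> 0 < Q.[t] by move=> t0 t1; rewrite QE exprn_gt0 // upos.
pose phi : R -> R := (2^-1 \*: (@ln R \o horner Q)) + horner H.
pose dphi t := 2^-1 *: (Q.[t]^-1 * Q^`().[t]) + H^`().[t].
have dP (t : R) : 0 <= t -> t <= 1 -> is_derive t 1 phi (dphi t).
  move=> t0 t1; apply: is_deriveD; apply: is_deriveZ; apply: is_derive1_comp.
  by apply: is_derive1_ln; exact: Q0.
have [||c] := @MVT_segment R phi dphi 0 1 ler01.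
- by move=> x; rewrite in_itv /= => /andP[/ltW x0 /ltW x1]; exact: dP.
- apply: derivable_within_continuous => x; rewrite in_itv /= => /andP[x0 x1].
  by have [] := dP x x0 x1.
rewrite in_itv /= => /andP[c0 c1]; rewrite subr0 mulr1.
have phiE t : phi t = 2^-1 * ln Q.[t] + H.[t] by [].
have Hder t : H^`().[t] = complex.Re (\sum_(i < K) w ^+ i.+1 * t%:C%C ^+ i).
  rewrite (horner_coef_wide (n := K)); last first.
    apply: leq_trans (size_poly _ _) _ => /=; rewrite -subn1 leq_subLR add1n.
    exact: size_poly.
  rewrite Re_sum; apply: eq_bigr => i _.
  have -> : w ^+ i.+1 * t%:C%C ^+ i = (t ^+ i)%:C%C * w ^+ i.+1.
    by rewrite rmorphXn mulrC.
  rewrite Re_rM mulrC coef_deriv coef_poly ltnS ltn_ord.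
  by rewrite -[_ *+ i.+1]mulr_natr mulfVK ?pnatr_eq0.
have H1 : H.[1] = complex.Re (logS w K).
  rewrite (horner_coef_wide (n := K.+1)) ?size_poly // big_ord_recl.
  rewrite coef_poly /= invr0 mulr0 mul0r add0r /logS Re_sum.
  apply: eq_bigr => i _; rewrite coef_poly ?lift0 /= /bump ?leq0n ?add1n ltnS ltn_ord expr1n mulr1.
  by rewrite [_ / i.+1%:R in RHS]mulrC inv_nat_real Re_rM mulrC.
have H0 : H.[0] = 0.
  by rewrite horner_coef0 coef_poly /= invr0 mulr0.
rewrite !phiE H1 H0 !QE mul0r subr0 nc1 expr1n ln1 mulr0 addr0 subr0 mul1r.
rewrite lnXn; last by rewrite -[w]mul1r -[1 * w]/(1%:C%C * w) upos.
rewrite -(mulr_natl (ln _) 2) mulKf ?pnatr_eq0 // => ->.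
have u := upos c c0 c1.
pose U := 1 - c%:C%C * w.
have U0 : U != 0 by rewrite -nc_gt0.
have geom : \sum_(i < K) w ^+ i.+1 * c%:C%C ^+ i = w * (1 - (c%:C%C * w) ^+ K) / U.
  have g : 1 - (c%:C%C * w) ^+ K = U * \sum_(i < K) (c%:C%C * w) ^+ i.
    by rewrite -opprB subrX1 -mulNr opprB.
  rewrite g mulrCA mulrAC divff // mul1r mulr_sumr; apply: eq_bigr => i _.
  by rewrite exprMn exprS -mulrA [w ^+ i * _]mulrC.
have QD : 2^-1 * (Q.[c]^-1 * Q^`().[c]) = complex.Re (- w / U).
  have e1 : Q^`().[c] = 2 * (- a * (1 - a * c) + b * (b * c)).
    rewrite /Q !poly.derivE !hornerE /=; ring.
  have e2 : - w / U = ((Q.[c])^-1)%:C%C * (- w * U^*%C).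
    have nU : (nc U)%:C%C ^+ 2 != 0 :> C.
      by rewrite expf_neq0 // real_neq0 gt_eqF.
    rewrite QE -/U fmorphV rmorphXn /=; apply: (mulIf nU).
    rewrite [RHS]mulrAC mulVf // mul1r.
    by rewrite nc_sqr mulrA mulfVK.
  rewrite e2 Re_rM e1 mulrCA; congr (_ * _).
  rewrite mulKf ?pnatr_eq0 // /U.
  by rewrite [in RHS](complexE w) -/a -/b /=; ring.
rewrite /dphi -[_ *: _]/(2^-1 * _) QD Hder geom -raddfD /=.
have -> : - w / U + w * (1 - (c%:C%C * w) ^+ K) / U = - (w * (c%:C%C * w) ^+ K / U).
  by rewrite -mulrDl -mulNr; congr (_ / _); ring.
apply: le_trans (Re_le_nc _) _; rewrite ncN !ncM ncV ncX.
rewrite exprS; apply: ler_pM; rewrite ?mulr_ge0 ?exprn_ge0 ?nc_ge0 ?invr_ge0 ?nc_ge0 //.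
  by rewrite ler_wpM2l ?nc_ge0 // lerXn2r ?nnegrE ?nc_ge0 ?tw.
by rewrite lef_pV2 ?posrE ?subr_gt0 // u0.
Qed.

Lemma ln_prod (rs : seq C) (F : C -> C) : (forall t, t \in rs -> F t != 0) ->
  ln (nc (\prod_(t <- rs) F t)) = \sum_(t <- rs) ln (nc (F t)).
Proof.
elim: rs => [|t rs IH] H; first by rewrite !big_nil nc1 ln1.
have Hrs u : u \in rs -> F u != 0 by move=> us; apply: H; rewrite inE us orbT.
rewrite !big_cons ncM lnM ?posrE ?nc_gt0 ?IH //; first exact/H/mem_head.
elim: rs {IH H} Hrs => [|u rs IH] H; first by rewrite big_nil oner_neq0.
rewrite big_cons mulf_neq0 // ?H ?mem_head // IH // => v vs.
by apply: H; rewrite inE vs orbT.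
Qed.

Lemma expr_small (q e : R) : 0 < q -> q < 1 -> 0 < e -> exists K, q ^+ K < e.
Proof.
move=> q0 q1 e0; have qi : 1 < q^-1 by rewrite invf_gt1.
have [K] := exprn_unbounded e^-1 qi.
by rewrite exprVn ltf_pV2 ?posrE ?exprn_gt0 // => h; exists K.
Qed.

(** All roots lie outside the disc, so on it ln|p| = l - Re P up to a small eps, where l = ln|p(0)|
    and [P] sums truncated logarithms over the roots. From ln|p| >= 0 comes Re P <= l + eps; the
    Borel-Caratheodory bound on coefficients then yields |P| <= 2(l + eps) on the half disc, and 3
    is 1 + 2. *)
Lemma harnack p (r : R) : 0 < r -> (forall z, nc z <= r -> 1 <= nc p.[z]) ->
  forall z, nc z <= r / 2 -> ln (nc p.[z]) <= 3 * ln (nc p.[0]).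
Proof.
move=> r0 p1 z zr; have [rs srs rsP] := poly_rootsP p.
have big t : t \in rs -> r < nc t.
  move=> trs; rewrite ltNge; apply/negP => /p1.
  rewrite rsP (perm_big _ (perm_to_rem trs)) big_cons /= subrr mul0r mulr0 nc0.
  by rewrite ler10.
(* There are finitely many roots, so one ratio q < 1 serves for all of them and controls the
   truncation uniformly. *)
have [q /andP[q0 q1] qP] : exists2 q : R, 0 < q < 1 & forall t, t \in rs -> r <= q * nc t.
  elim: rs big {srs rsP} => [|t rs IH] big; first by exists (1 / 2) => //; lra.
  have [|q /andP[q0 q1] qP] := IH; first by move=> u us; apply: big; rewrite inE us orbT.
  have rt := big t (mem_head _ _); have t0 := lt_trans r0 rt.
  exists (Num.max q (r / nc t)); first by rewrite lt_max q0 gt_max q1 ltr_pdivrMr // mul1r.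
  move=> u; rewrite inE => /predU1P[->|/qP h].
    by rewrite -ler_pdivrMr // le_max lexx orbT.
  by apply: (le_trans h); rewrite ler_wpM2r ?nc_ge0 // le_max lexx.
have tn0 t : t \in rs -> t != 0 by move=> /big h; rewrite -nc_gt0; exact: lt_trans h.
have zt w t : nc w <= r -> t \in rs -> nc (w / t) <= q.
  move=> wr trs; rewrite ncM ncV ler_pdivrMr ?nc_gt0 ?tn0 //.
  exact: le_trans wr (qP t trs).
pose l := ln (nc p.[0]).
have lnE w : nc w <= r -> ln (nc p.[w]) = l + \sum_(t <- rs) ln (nc (1 - w / t)).
  move=> wr; have pw : p.[w] = p.[0] * \prod_(t <- rs) (1 - w / t).
    rewrite !rsP -mulrA; congr (_ * _).
    rewrite -big_split; apply: eq_big_seq => t /tn0 t0 /=.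
    by field.
  have ne t : t \in rs -> 1 - w / t != 0.
    move=> trs; rewrite -nc_gt0; apply: lt_le_trans (nc_sub _ _).
    rewrite nc1 subr_gt0; exact: le_lt_trans (zt _ _ wr trs) q1.
  rewrite pw ncM lnM ?posrE ?ln_prod //.
    by apply: lt_le_trans ltr01 _; apply: p1; rewrite nc0 ltW.
  rewrite nc_gt0; apply: contraTneq (p1 w wr) => h.
  by rewrite pw h mulr0 nc0 ler10.
apply/ler_addgt0Pr => e e0.
(* d q^K bounds the sum over the roots of the truncation errors; the summand 1 keeps d positive when
   there is no root. *)
pose d := (size rs)%:R / (1 - q) + 1.
have q1' : 0 < 1 - q by rewrite subr_gt0.
have d0 : 0 < d by rewrite ltr_wpDl // divr_ge0 // ltW.
have [K Ke] := @expr_small q (e / (3 * d)) q0 q1 (divr_gt0 e0 (mulr_gt0 (ltr0Sn _ _) d0)).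
pose P : {poly C} := \sum_(t <- rs) \sum_(i < K) (t ^- i.+1 / i.+1%:R) *: 'X^(i.+1).
pose eps := d * q ^+ K.
have eps3 : 3 * eps <= e.
  move: Ke; rewrite ltr_pdivlMr ?mulr_gt0 // /eps => h.
  by rewrite mulrA mulrC ltW.
have eps0 : 0 <= eps by rewrite mulr_ge0 ?exprn_ge0 // ltW.
have PE w : P.[w] = \sum_(t <- rs) logS (w / t) K.
  rewrite /P horner_sum; apply: eq_bigr => t _; rewrite horner_sum.
  apply: eq_bigr => i _; rewrite hornerZ hornerXn exprMn exprVn.
  by rewrite [LHS]mulrC mulrA.
have PK w : nc w <= r -> `|ln (nc p.[w]) - l + complex.Re P.[w]| <= eps.
  move=> wr; rewrite lnE // PE Re_sum [l + _]addrC addrK -big_split /=.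
  apply: le_trans (ler_norm_sum _ _ _) _.
  apply: (@le_trans _ _ (\sum_(t <- rs) q ^+ K / (1 - q))).
    rewrite big_seq [leRHS]big_seq; apply: ler_sum => t trs; have zq := zt w t wr trs.
    apply: le_trans (log_trunc _ (le_lt_trans zq q1)) _.
    apply: ler_pM; rewrite ?exprn_ge0 ?nc_ge0 ?invr_ge0 //.
    - by rewrite subr_ge0 ltW // (le_lt_trans zq).
    - rewrite exprS -[leRHS]mul1r; apply: ler_pM; rewrite ?exprn_ge0 ?nc_ge0 //.
        by rewrite (le_trans zq) // ltW.
      by rewrite lerXn2r ?nnegrE ?nc_ge0 // ltW.
    - by rewrite lef_pV2 ?posrE ?subr_gt0 ?(le_lt_trans zq) // lerD2l lerN2.
  rewrite big_const_seq count_predT iter_addr addr0 -mulr_natl mulrCA mulrC.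
  rewrite /eps ler_wpM2r ?exprn_ge0 ?(ltW q0) // /d.
  by rewrite lerDl ler01.
have P0 : P`_0 = 0.
  rewrite /P coef_sum big1 // => t _; rewrite coef_sum big1 // => i _.
  by rewrite coefZ coefXn mulr0.
have l0 : 0 <= l by apply: ln_ge0; apply: p1; rewrite nc0 ltW.
have coefb k : (0 < k)%N -> nc P`_k * r ^+ k <= 2 * (l + eps).
  apply: borel_caratheodory_coef => // w wr.
  have := PK w; rewrite wr lexx => /(_ isT); rewrite ler_norml => /andP[_ h].
  have : 0 <= ln (nc p.[w]) by apply: ln_ge0; apply: p1; rewrite wr.
  move: h; rewrite -/l; lra.
have := horner_dev r0 P0 coefb zr.
have zr2 : nc z / r <= 1 / 2 by rewrite ler_pdivrMr // mulrC mul1r.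
have zle : nc z <= r by apply: le_trans zr _; rewrite ler_pdivrMr // ler_peMr ?ltW // ltr1n.
have := PK z zle; rewrite ler_norml => /andP[_ h] h2.
have h3 : - complex.Re P.[z] <= nc P.[z].
  by apply: le_trans (Re_le_nc _); rewrite -normrN ler_norm.
have h4 : 2 * (2 * (l + eps)) * (nc z / r) <= 2 * (l + eps).
  have : 0 <= nc z / r by rewrite divr_ge0 ?nc_ge0 // ltW.
  by have : 0 <= l + eps by [rewrite addr_ge0]; nra.
rewrite -/l; lra.
Qed.

End Harnack.

(** * Preimages of a filled Julia set *)

Section Degree.
Variable R : realType.
Local Notation C := (complex R).
Implicit Types (p q u g : {poly C}).

Definition deg p := (size p).-1.
Definition lnlead p : R := ln (nc (lead_coef p)).

Lemma deg_comp p q : deg (p \Po q) = (deg p * deg q)%N.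
Proof. exact: size_comp_poly. Qed.

Lemma deg_gt0 p : (1 < size p)%N -> (0 < deg p)%N.
Proof. by move=> p1; rewrite /deg -ltnS prednK // (leq_trans _ p1). Qed.

Lemma size_comp_gt1 p q : (1 < size p)%N -> (1 < size q)%N -> (1 < size (p \Po q))%N.
Proof.
move=> p1 q1; have := deg_comp p q; have := deg_gt0 p1; have := deg_gt0 q1.
rewrite /deg; case: (size (p \Po q)) => [|[|n]] //= q0 p0 /esym/eqP.
  by rewrite muln_eq0 -!leqn0 leqNgt p0 leqNgt q0.
by rewrite muln_eq0 -!leqn0 leqNgt p0 leqNgt q0.
Qed.

Lemma lnlead_comp p q : (1 < size p)%N -> (1 < size q)%N ->
  lnlead (p \Po q) = lnlead p + (deg p)%:R * lnlead q.
Proof.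
move=> p1 q1; rewrite /lnlead lead_coef_comp // ncM ncX.
have lp : 0 < nc (lead_coef p) by rewrite nc_gt0 lead_neq0.
have lq : 0 < nc (lead_coef q) by rewrite nc_gt0 lead_neq0.
by rewrite lnM ?posrE ?exprn_gt0 // lnXn // mulr_natl.
Qed.

End Degree.

Section Escape.
Variable R : realType.
Local Notation C := (complex R).
Local Notation T := (cplane R).
Variable h : {poly C}.
Hypothesis h2 : (2 < size h)%N.
Implicit Types (p q u g w : {poly C}).

Let d := deg h.
Let h1 : (1 < size h)%N. Proof. exact: ltn_trans h2. Qed.
Let d2 : (1 < d)%N.
Proof. by rewrite /d /deg -ltnS prednK // (leq_trans _ h2). Qed.
Let dR : 0 < d%:R - 1 :> R.
Proof. by rewrite subr_gt0 ltr1n. Qed.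

(* The fixed point of [Psi p]. *)
Definition xfix p : R := - lnlead p / ((deg p)%:R - 1).

(** The second clause makes the correction term of [logcap_itp] nonnegative for s = r; the third
    makes every orbit starting beyond r tend to infinity. *)
Definition escape_radius (r : R) :=
  [/\ 1 <= r, xfix h <= ln r & forall z, r <= nc z -> 2 * nc z <= nc h.[z]].

Lemma escape_radius_exists (r0 : R) : exists2 r, r0 < r & escape_radius r.
Proof.
have h0 : h != 0 by rewrite -size_poly_gt0 (leq_trans _ h1).
have [c c0 [r r1 rP]] := poly_lower h0.
exists (`|r0| + r + 2 / c + expR (xfix h)).
  have := ler_norm r0; have : 0 < expR (xfix h) by exact: expR_gt0.
  have : 0 < 2 / c by rewrite divr_gt0.
  lra.
have e0 := expR_gt0 (xfix h); have c2 : 0 < 2 / c by rewrite divr_gt0.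
have nr := normr_ge0 r0.
split; first by lra.
  by rewrite -{1}[xfix h]expRK ler_ln ?posrE //; lra.
move=> z zr; have rz : r <= nc z by lra.
apply: le_trans (rP z rz); have cz : 2 / c <= nc z by lra.
have z1 : 1 <= nc z by lra.
have : 2 <= c * nc z by rewrite mulrC -ler_pdivrMr.
have -> : (size h).-1 = ((size h).-1 - 2).+2 by rewrite -addn2 subnK.
rewrite !exprS => cz2; rewrite [leRHS]mulrA; apply: ler_pM => //; first exact: nc_ge0.
rewrite ler_peMr ?nc_ge0 // exprn_ege1 //.
Qed.

Fixpoint itp k u := if k is k'.+1 then h \Po itp k' u else u.

Lemma horner_itp k u z : (itp k u).[z] = iter k (horner h) u.[z].
Proof. by elim: k => //= k IH; rewrite horner_comp IH. Qed.

Lemma size_itp k u : (1 < size u)%N -> (1 < size (itp k u))%N.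
Proof. by move=> u1; elim: k => //= k IH; exact: size_comp_gt1. Qed.

Lemma deg_itp k u : deg (itp k u) = (d ^ k * deg u)%N.
Proof. by elim: k => [|k IH]; rewrite ?mul1n //= deg_comp IH expnS mulnA. Qed.

(** Composing with [h] acts on [lnlead] by the affine map Psi(h), an expansion of factor d about its
    fixed point. *)
Lemma lnlead_itp k u : (1 < size u)%N ->
  lnlead (itp k u) - xfix h = (d ^ k)%:R * (lnlead u - xfix h).
Proof.
move=> u1; elim: k => [|k IH] /=; first by rewrite mul1r.
rewrite lnlead_comp ?size_itp // expnS natrM -mulrA -IH -/d.
have -> : lnlead h = - (d%:R - 1) * xfix h.
  by rewrite /xfix -/d mulrC mulNr mulrN mulNr mulfVK ?opprK ?gt_eqF.
by ring.
Qed.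

(* The fixed point of [Psi h] pulled back by [Psi u]; it is also the logarithmic
   capacity of the set [Xs u] below. *)
Definition xx u : R := (xfix h - lnlead u) / (deg u)%:R.

(** The correction tends to 0 as k grows, which identifies [xx u] as the limit of the capacities of
    the lemniscates that shrink to [Xs u]. *)
Lemma logcap_itp k u (s : R) : (1 < size u)%N ->
  logcap (itp k u) s = xx u + (ln s - xfix h) / (d ^ k * deg u)%:R.
Proof.
move=> u1; rewrite /logcap -[ln (nc _)]/(lnlead _) -/(deg _) deg_itp.
have /eqP := lnlead_itp k u1; rewrite subr_eq => /eqP ->.
have u0 : (deg u)%:R != 0 :> R by rewrite pnatr_eq0 -lt0n deg_gt0.
have d0 : (d ^ k)%:R != 0 :> R by rewrite pnatr_eq0 -lt0n expn_gt0 (ltn_trans _ d2).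
by rewrite /xx natrM; field; rewrite u0 d0.
Qed.

Section Radius.
Variable r : R.
Hypothesis hr : escape_radius r.

Let r1 : 1 <= r. Proof. by case: hr. Qed.
Let r0 : 0 < r. Proof. exact: lt_le_trans r1. Qed.

Lemma esc_step z : r <= nc z -> 2 * nc z <= nc h.[z].
Proof. by case: hr => _ _; apply. Qed.

Lemma esc_iter k z : r <= nc z -> 2 ^+ k * nc z <= nc (iter k (horner h) z).
Proof.
move=> rz; elim: k => [|k IH]; first by rewrite mul1r.
rewrite exprS -mulrA /=; apply: le_trans (esc_step _).
  by rewrite ler_wpM2l.
apply: le_trans IH; apply: le_trans rz _.
by rewrite ler_peMl ?nc_ge0 // exprn_ege1 // ler1n.
Qed.

Lemma esc_gt k z : r < nc z -> r < nc (iter k (horner h) z).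
Proof.
move=> rz; apply: lt_le_trans (esc_iter k (ltW rz)); apply: lt_le_trans rz _.
by rewrite ler_peMl ?nc_ge0 // exprn_ege1 // ler1n.
Qed.

Definition Fs k u : set T := [set z | nc (itp k u).[z] <= r].
(* The preimage under [u] of the filled Julia set of [h]. *)
Definition Xs u : set T := \bigcap_k Fs k u.
Definition Es u : set T := closure (Xs u) `&` closure (~` Xs u).

Lemma Xs_iter u z : Xs u z <-> forall k, nc (iter k (horner h) u.[z]) <= r.
Proof.
split=> [H k|H k _]; last by rewrite /Fs /= horner_itp.
by have := H k I; rewrite /Fs /= horner_itp.
Qed.

Lemma Fs_dec k u : Fs k.+1 u `<=` Fs k u.
Proof.
move=> z; rewrite /Fs /= horner_comp => h'; rewrite leNgt; apply/negP => lt.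
by have := @esc_gt 1 _ lt; rewrite /= ltNge h'.
Qed.

Lemma closed_Xs u : closed (Xs u).
Proof. by apply: closed_bigI => k _; exact: closed_sublevel. Qed.

Lemma compact_Xs u : (1 < size u)%N -> compact (Xs u).
Proof.
move=> u1; apply: (subclosed_compact (@closed_Xs u) (@compact_sublevel R u r u1)).
by move=> z /(_ 0%N I).
Qed.

Lemma Xs_bounded u : (1 < size u)%N -> exists b : R, forall z, Xs u z -> nc z <= b.
Proof.
move=> u1; have [b bP] := sublevel_bounded r u1; exists b => z /(_ 0%N I); exact: bP.
Qed.

(** The complement is a union of superlevel sets, each connected, with a common point chosen far
    away. *)
Lemma XsC_connected u : (1 < size u)%N -> connected (~` Xs u).
Proof.
move=> u1; have -> : ~` Xs u = \bigcup_k (~` Fs k u) by rewrite setC_bigcap.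
have Fc k : connected (~` Fs k u).
  rewrite (_ : ~` Fs k u = [set z : T | r < nc (itp k u).[z]]).
    by apply: superlevel_connected; exact: size_itp.
  apply/seteqP; split => z; rewrite /Fs /=.
      by move=> /negP; rewrite -ltNge.
    by rewrite ltNge => /negP.
apply: bigcup_connected => [|k _]; last exact: Fc.
have [b b0 bP] := poly_tends_infty (r + 1) u1.
have [z zb] := nc_exists (ltW b0); exists z => k _.
rewrite /Fs /= horner_itp; apply/negP; rewrite -ltNge; apply: esc_gt.
by have := bP z; rewrite zb lexx => /(_ isT); lra.
Qed.

Lemma Xs_lt u z k : Xs u z -> nc (itp k u).[z] < r.
Proof.
move=> /Xs_iter H; rewrite horner_itp lt_neqAle H andbT; apply/eqP => e.
have := H k.+1; rewrite iterS => h'.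
have := esc_step (_ : r <= nc (iter k (horner h) u.[z])); rewrite e lexx => /(_ isT).
have rp := r0; lra.
Qed.

Lemma Es_sub u : Es u `<=` Xs u.
Proof. by by move=> z [+ _]; apply: closure_closed_sub; [exact: closed_Xs|]. Qed.

(** Monotonicity of capacity together with its behaviour under the dilation by t. By compactness a
    whole lemniscate around [Xs u] is dilated into each lemniscate around [Xs w], so [logcap_le]
    applies. *)
Lemma xx_mono u w (t : R) : (1 < size u)%N -> (1 < size w)%N -> 0 < t ->
  (forall z, Xs u z -> Xs w (t%:C%C * z)) -> xx u + ln t <= xx w.
Proof.
move=> u1 w1 t0 uw; have [_ xr _] := hr.
have w0 : 0 < (deg w)%:R :> R by rewrite ltr0n deg_gt0.
have tC : t%:C%C != 0 :> C by rewrite real_neq0 gt_eqF.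
pose tX : {poly C} := t%:C%C *: 'X.
have stX : size tX = 2%N by rewrite size_scale // size_polyX.
have tXE z : tX.[z] = t%:C%C * z by rewrite !hornerE.
(* The bound holds up to the capacity excess of the l-th lemniscate around [Xs w]; the excess around
   [Xs u] has the favourable sign. Letting l grow concludes. *)
have key l : xx u + ln t <= xx w + (ln r - xfix h) / (d ^ l * deg w)%:R.
  pose q := itp l w \Po tX.
  have q1 : (1 < size q)%N by apply: size_comp_gt1; rewrite ?stX //; exact: size_itp.
  have [||k kP] := @compact_decreasing_sub T (fun k => Fs k u) [set z | nc q.[z] < r]
     (@compact_sublevel R u r u1) (fun k => @closed_sublevel R (itp k u) r) (fun k => @Fs_dec k u).
  - exact: sublevel_open.
  - by move=> z /uw Xz; rewrite /= /q horner_comp tXE; exact: Xs_lt.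
  have := @logcap_le R (itp k u) q r r0 (size_itp k u1) q1 _.
  have pq z : nc (itp k u).[z] <= r -> nc q.[z] <= r by move=> /kP /ltW.
  move=> /(_ pq); rewrite logcap_itp //.
  have -> : logcap q r = logcap (itp l w) r - ln t.
    rewrite /logcap -[ln (nc (lead_coef q))]/(lnlead q) -[ln (nc (lead_coef (itp l w)))]/(lnlead (itp l w)).
    rewrite -!/(deg _) lnlead_comp ?stX ?size_itp // deg_comp [deg tX]/deg stX muln1.
    have -> : lnlead tX = ln t.
      by rewrite /lnlead lead_coefZ lead_coefX mulr1 nc_real gtr0_norm.
    have D0 : (deg (itp l w))%:R != 0 :> R by rewrite pnatr_eq0 -lt0n deg_gt0 // size_itp.
    by field.
  rewrite logcap_itp // => H.
  have : 0 <= (ln r - xfix h) / (d ^ k * deg u)%:R by rewrite divr_ge0 // subr_ge0.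
  lra.
apply/ler_addgt0Pr => e e0.
have D1 : 1 < d%:R :> R by rewrite ltr1n.
have [l lP] := exprn_unbounded ((ln r - xfix h) / e) D1.
apply: le_trans (key l) _; rewrite lerD2l ler_pdivrMr; last first.
  by rewrite ltr0n muln_gt0 expn_gt0 (ltn_trans _ d2) ?deg_gt0.
move: lP; rewrite ltr_pdivrMr // mulrC -natrX => /ltW lP; apply: (le_trans lP).
by rewrite natrM mulrA ler_peMr ?ler1n ?deg_gt0 // mulr_ge0 // ltW.
Qed.

Lemma Xs_proper u : (1 < size u)%N -> exists z, ~ Xs u z.
Proof.
move=> u1; have [b bP] := Xs_bounded u1.
exists (`|b| + 1)%:C%C => /bP; rewrite nc_real ger0_norm ?addr_ge0 //.
have := ler_norm b; lra.
Qed.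

(** If [Es w] misses [Xs u], the connected set [Xs u] cannot leave [Xs w]. Otherwise the connected
    [Es w] lies entirely in [Xs u], since it does not meet [Es u]; then the connected complement of
    [Xs u], which reaches far points, cannot enter [Xs w] without crossing [Es w]. *)
Lemma nested u w z0 : (1 < size u)%N -> (1 < size w)%N ->
  connected (Xs u) -> connected (Es w) -> Xs u z0 -> Xs w z0 ->
  Es u `&` Es w = set0 -> Xs u `<=` Xs w \/ Xs w `<=` Xs u.
Proof.
move=> u1 w1 cXu cEw uz wz uw.
have [[e [Ewe Xue]]|n] := pselect (exists e, Es w e /\ Xs u e); last first.
  left => z Xuz; apply: contrapT => nw.
  have [v [Xv cv cv']] := connected_meets_boundary cXu uz wz Xuz nw.
  by apply: n; exists v.
right => z Xwz; apply: contrapT => nXuz.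
have EwX : Es w `<=` Xs u.
  move=> v Ewv; apply: contrapT => nv.
  have [y [Ey cy cy']] := connected_meets_boundary cEw Ewe Xue Ewv nv.
  by rewrite -[False]/(set0 y) -uw; split; [split; [exact: cy|exact: cy']|exact: Ey].
have [b bP] := Xs_bounded u1; have [b' bP'] := Xs_bounded w1.
pose y : C := (`|b| + `|b'| + 1)%:C%C.
have ny : nc y = `|b| + `|b'| + 1 by rewrite nc_real ger0_norm // !addr_ge0.
have [hb hb'] := (ler_norm b, ler_norm b').
have [hb1 hb1'] := (normr_ge0 b, normr_ge0 b').
have nXuy : (~` Xs u) y by move=> /bP; rewrite ny; lra.
have nXwy : ~ Xs w y by move=> /bP'; rewrite ny; lra.
have [v [nXv cv cv']] := connected_meets_boundary (XsC_connected u1) nXuz Xwz nXuy nXwy.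
exact: nXv (EwX v (conj cv cv')).
Qed.

(** The dilation by 1 + e/(2 rho) moves points of [Xs u] by at most e/2. If it took one out of
    [Xs w], the segment along which the point moves would meet both boundaries at a distance less
    than e. *)
Lemma xx_gap u w (rho e : R) : (1 < size u)%N -> (1 < size w)%N ->
  0 < rho -> 0 < e -> (forall z, Xs u z -> nc z <= rho) -> Xs u `<=` Xs w ->
  (forall a b, Es u a -> Es w b -> e <= nc (a - b)) ->
  xx u + ln (1 + e / (2 * rho)) <= xx w.
Proof.
move=> u1 w1 rho0 e0 ub uw gap.
have er0 : 0 < e / (2 * rho) by rewrite divr_gt0 // mulr_gt0.
apply: xx_mono => //; first by rewrite addr_gt0.
move=> z Xz; set t := 1 + _; apply: contrapT => nX.
have len v y : seg z (t%:C%C * z) v -> seg z (t%:C%C * z) y -> nc (v - y) < e.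
  move=> [a /= + <-] [b /= + <-]; rewrite !in_itv /= => /andP[a0 a1] /andP[b0 b1].
  have -> : z + a%:C%C * (t%:C%C * z - z) - (z + b%:C%C * (t%:C%C * z - z))
     = ((a - b) * (e / (2 * rho)))%:C%C * z.
    by rewrite /t rmorphM rmorphB rmorphD rmorph1; ring.
  rewrite ncM nc_real normrM (gtr0_norm er0).
  have ab : `|a - b| <= 1 by rewrite ler_norml; apply/andP; split; lra.
  apply: (@le_lt_trans _ _ (1 * (e / (2 * rho)) * rho)).
    apply: ler_pM; [by rewrite mulr_ge0 // ltW|exact: nc_ge0| |exact: ub].
    by rewrite ler_wpM2r // ltW.
  have -> : 1 * (e / (2 * rho)) * rho = e / 2 by field; rewrite gt_eqF.
  lra.
have [b [Sb cb cb']] := connected_meets_boundary (@seg_connected R z (t%:C%C * z)) (seg_l _ _) (uw z Xz) (seg_r _ _) nX.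
have Eb : Es w b by [].
have [Xb|nXb] := pselect (Xs u b).
  have Eub : Es u b.
    split; first exact: subset_closure.
    by apply: closureS cb' => y ny /uw.
  by have := gap b b Eub Eb; rewrite subrr nc0 leNgt e0.
have [a [Sa ca ca']] := connected_meets_boundary (@seg_connected R z (t%:C%C * z)) (seg_l _ _) Xz Sb nXb.
by have := gap a b (conj ca ca') Eb; rewrite leNgt len.
Qed.

End Radius.
End Escape.

(** * Normality on the sphere *)

Section Chordal.
Variable R : realType.
Local Notation C := (complex R).
Local Notation T := (cplane R).
Local Notation S := (rsphere R).
Implicit Types (z w t : C).
Local Arguments chordal : simpl never.

Definition qn z : R := Num.sqrt (1 + nc z ^+ 2).

Lemma qn_ge1 z : 1 <= qn z.
Proof. by rewrite -[leLHS]sqrtr1 ler_wsqrtr // lerDl sqr_ge0. Qed.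

Lemma qn_gt0 z : 0 < qn z.
Proof. exact: lt_le_trans (qn_ge1 z). Qed.

Lemma qn_sqr z : qn z ^+ 2 = 1 + nc z ^+ 2.
Proof. by rewrite sqr_sqrtr // addr_ge0 ?sqr_ge0. Qed.

Lemma nc_le_qn z : nc z <= qn z.
Proof. by rewrite -[leLHS]ger0_norm ?nc_ge0 // -sqrtr_sqr ler_wsqrtr // lerDr. Qed.

Lemma qn_le_nc z : qn z <= 1 + nc z.
Proof.
rewrite -(ler_pXn2r (n := 2)) ?nnegrE ?addr_ge0 ?nc_ge0 ?(ltW (qn_gt0 z)) //.
by rewrite qn_sqr sqrrD expr1n mul1r; have := nc_ge0 z; rewrite mulr2n; lra.
Qed.

Lemma qn_lip z w : qn z <= qn w + nc (z - w).
Proof.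
have [h1 h2] := (qn_gt0 w, nc_ge0 (z - w)).
rewrite -(ler_pXn2r (n := 2)) ?nnegrE ?addr_ge0 ?(ltW (qn_gt0 z)) ?(ltW h1) //.
rewrite sqrrD !qn_sqr.
have h3 : nc z <= nc w + nc (z - w) by rewrite addrC -lerBlDr nc_sub.
have h4 := nc_le_qn w; have h5 := nc_ge0 z; have h6 := nc_ge0 w.
have : nc z ^+ 2 <= (nc w + nc (z - w)) ^+ 2 by rewrite lerXn2r ?nnegrE ?addr_ge0.
rewrite sqrrD => h7.
have : nc w * nc (z - w) <= qn w * nc (z - w) by rewrite ler_wpM2r.
rewrite !mulr2n in h7 *; lra.
Qed.

Lemma cs_qn t w : nc (1 + t * w) <= qn t * qn w.
Proof.
have h : nc (1 + t * w) <= 1 + nc t * nc w.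
  by apply: le_trans (ncD _ _) _; rewrite nc1 ncM.
apply: le_trans h _.
have [a b] := (nc_ge0 t, nc_ge0 w).
rewrite -(ler_pXn2r (n := 2)) ?nnegrE ?addr_ge0 ?mulr_ge0 ?(ltW (qn_gt0 _)) //.
rewrite exprMn !qn_sqr.
have : 0 <= (nc t - nc w) ^+ 2 by exact: sqr_ge0.
rewrite !expr2; nra.
Qed.

Lemma nc_conj z : nc (z^*%C) = nc z.
Proof. by case: z => a b; rewrite /Normc.normc /= sqrrN. Qed.

(** For three finite points: (z - w)(1 + t t') = (z - t)(1 + t' w) + (t - w)(1 + t' z) with t' the
    conjugate of t, and Cauchy-Schwarz [cs_qn] on the second factors. *)
Lemma chordal_triangle (p q s : S) : chordal p q <= chordal p s + chordal s q.
Proof.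
have qi z : 0 <= 2 / qn z by rewrite divr_ge0 // ltW // qn_gt0.
have qi2 z w : 0 <= (qn z * qn w)^-1 by rewrite ltW // invr_gt0 mulr_gt0 ?qn_gt0.
case: p q s => [z|] [w|] [t|]; rewrite /chordal -?/(qn _); rewrite ?addr0 ?add0r //.
- have [hz hw ht] := And3 (qn_gt0 z) (qn_gt0 w) (qn_gt0 t).
  have key : nc (z - w) * qn t <= nc (z - t) * qn w + nc (t - w) * qn z.
    have tt : nc (1 + t * t^*%C) = qn t ^+ 2.
      rewrite qn_sqr -sqr_normc normcE' -rmorphXn -[1]/(1%:C%C) -rmorphD nc_real.
      by rewrite ger0_norm // addr_ge0 ?sqr_ge0.
    have e : (z - w) * (1 + t * t^*%C) = (z - t) * (1 + t^*%C * w) + (t - w) * (1 + t^*%C * z) by ring.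
    have : nc (z - w) * qn t ^+ 2 <= nc (z - t) * (qn t * qn w) + nc (t - w) * (qn t * qn z).
      rewrite -tt -ncM e; apply: le_trans (ncD _ _) _; rewrite !ncM.
      have h1 := cs_qn (t^*%C) w; have h2 := cs_qn (t^*%C) z.
      have qc : qn t^*%C = qn t by rewrite /qn nc_conj.
      by rewrite lerD // ler_wpM2l ?nc_ge0 // -qc.
    rewrite expr2 => h; rewrite -(ler_pM2r ht).
    apply: le_trans (_ : nc (z - w) * (qn t * qn t) <= _); first by rewrite mulrA.
    by apply: le_trans h _; rewrite mulrDl -!mulrA [qn w * _]mulrC [qn z * _]mulrC.
  have -> : 2 * nc (z - t) / (qn z * qn t) + 2 * nc (t - w) / (qn t * qn w) =
     2 * (nc (z - t) * qn w + nc (t - w) * qn z) / (qn z * qn w * qn t).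
    by field; rewrite !gt_eqF.
  rewrite ler_pdivlMr ?mulr_gt0 //.
  have -> : 2 * nc (z - w) / (qn z * qn w) * (qn z * qn w * qn t) = 2 * (nc (z - w) * qn t).
    by field; rewrite !gt_eqF.
  by rewrite ler_wpM2l.
- have [hz hw] := (qn_gt0 z, qn_gt0 w).
  have -> : 2 / qn z + 2 / qn w = 2 * (qn w + qn z) / (qn z * qn w).
    by field; rewrite !gt_eqF.
  rewrite ler_wpM2r ?qi2 // ler_wpM2l //.
  have := ncB z w; have := nc_le_qn z; have := nc_le_qn w; lra.
- have [hz ht] := (qn_gt0 z, qn_gt0 t).
  have -> : 2 * nc (z - t) / (qn z * qn t) + 2 / qn t = 2 * (qn z + nc (z - t)) / (qn z * qn t).
    by field; rewrite !gt_eqF.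
  have -> : 2 / qn z = 2 * qn t / (qn z * qn t) by field; rewrite !gt_eqF.
  rewrite ler_wpM2r ?qi2 // ler_wpM2l // ncBC; exact: qn_lip.
- have [hz ht] := (qn_gt0 w, qn_gt0 t).
  have -> : 2 / qn t + 2 * nc (t - w) / (qn t * qn w) = 2 * (qn w + nc (t - w)) / (qn t * qn w).
    by field; rewrite !gt_eqF.
  have -> : 2 / qn w = 2 * qn t / (qn t * qn w) by field; rewrite !gt_eqF.
  rewrite ler_wpM2r ?qi2 // ler_wpM2l //; exact: qn_lip.
- by rewrite addr_ge0.
Qed.

Lemma chordalC (p q : S) : chordal p q = chordal q p.
Proof.
by case: p q => [z|] [w|] //; rewrite /chordal ncBC [X in _ / X]mulrC.
Qed.

Lemma chordal_le z w : chordal (Some z : S) (Some w) <= 2 * nc (z - w).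
Proof.
rewrite /chordal -/(qn z) -/(qn w) ler_pdivrMr ?mulr_gt0 ?qn_gt0 //.
rewrite ler_peMr ?mulr_ge0 ?nc_ge0 //.
have := qn_ge1 z; have := qn_ge1 w; nra.
Qed.

Lemma chordal_infty z (r : R) : 0 < r -> r <= nc z -> chordal (Some z : S) None <= 2 / r.
Proof.
move=> r0 rz; rewrite /chordal -/(qn z) ler_wpM2l // lef_pV2 ?posrE ?qn_gt0 //.
exact: le_trans (nc_le_qn z).
Qed.

Lemma chordal_refl (p : S) : chordal p p = 0.
Proof. by case: p => // z; rewrite /chordal subrr nc0 mulr0 mul0r. Qed.

Lemma nbhs_infty (b : R) : nbhs (None : S) [set p : S | if p is Some z then b < nc z else True].
Proof.
exists (cdisc 0 b).
  by split; [exact: compact_cdisc|exact: closed_cdisc].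
move=> [z|] //= [[w nw [<-]]|//]; rewrite ltNge; apply/negP => h; apply: nw.
by rewrite /cdisc /= subr0.
Qed.

Lemma nbhs_inftyP (A : set S) : nbhs (None : S) A -> exists2 b : R, 0 < b &
  A None /\ forall z, b < nc z -> A (Some z).
Proof.
move=> nA; have AN : A None by exact: (@nbhs_singleton S None A nA).
case: nA => K [cK clK] KA.
have [||k _|k kP] := @compact_increasing_cover T K (fun k => disc 0 k.+1%:R) cK.
- by move=> k; exact: open_disc.
- by move=> k z; rewrite /disc /= => h; apply: lt_trans h _; rewrite ltr_nat.
- exists (Num.truncn (nc (k - 0))); exact: truncnS_gt.
exists k.+1%:R => //; split => // z zk; apply: KA; left; exists z => //= /kP.
by rewrite /disc /= subr0 ltNge (ltW zk).
Qed.

Lemma nbhs_someP z (A : set S) : nbhs (Some z : S) A <->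
  exists2 e : R, 0 < e & forall w, nc (w - z) < e -> A (Some w).
Proof. exact: (nbhs_disc z (Some @^-1` A)). Qed.

Lemma nbhs_chordal (p : S) (e : R) : 0 < e -> nbhs p [set q | chordal q p < e].
Proof.
move=> e0; case: p => [z|].
  apply/nbhs_someP; exists (e / 2); first by rewrite divr_gt0.
  move=> w wz; suff : chordal (Some w : S) (Some z) < e by [].
  by rewrite (le_lt_trans (chordal_le w z)) // mulrC -ltr_pdivlMr.
apply: filterS (nbhs_infty (2 / e)) => -[z|] /=; rewrite /chordal; last by [].
move=> h; have e2 : 0 < 2 / e by rewrite divr_gt0.
rewrite -/(qn z) ltr_pdivrMr ?qn_gt0 // mulrC -ltr_pdivrMr //.
exact: lt_le_trans h (nc_le_qn z).
Qed.

Definition equicont (G : set {poly C}) (p : S) := forall e : R, 0 < e ->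
  exists2 U : set S, open_nbhs p U & forall g q, G g -> U q ->
    chordal (sphere_map g q) (sphere_map g p) < e.

(** A dense sequence, the rational points of the plane; integers that encode no pair are sent to
    0. *)
Definition ratC (n : nat) : C :=
  if @unpickle (rat * rat)%type n is Some (a, b) then Complex (ratr a) (ratr b) else 0.

Lemma ratC_dense z (e : R) : 0 < e -> exists n, nc (ratC n - z) < e.
Proof.
move=> e0; have e2 : 0 < e / 2 by rewrite divr_gt0.
have h (x : R) : exists a : rat, `|ratr a - x| < e / 2.
  have [|a] := @rat_in_itvoo R (x - e / 2) (x + e / 2); first by lra.
  rewrite in_itv /= => /andP[h1 h2]; exists a; rewrite ltr_norml.
  by apply/andP; split; lra.
have [a ha] := h (complex.Re z); have [b hb] := h (complex.Im z).
exists (pickle (a, b)); rewrite /ratC pickleK.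
apply: le_lt_trans (nc_le_ReIm _) _; case: z ha hb => x y /= ha hb.
by rewrite [e]splitr ltrD.
Qed.

Lemma open_has_rat (U : set S) p : open_nbhs p U -> exists n, U (Some (ratC n)).
Proof.
move=> oU; have := open_nbhs_nbhs oU; case: p {oU} => [z|].
  move=> /nbhs_someP[e e0 eU]; have [n nz] := ratC_dense z e0.
  by exists n; exact: eU.
move=> /nbhs_inftyP[b b0 [_ bU]].
have [n nz] := ratC_dense (b + 1)%:C%C ltr01; exists n; apply: bU.
have := nc_sub (b + 1)%:C%C (ratC n); rewrite ncBC nc_real ger0_norm; last by lra.
lra.
Qed.

(** Tychonoff's theorem gives a pointwise cluster point [y] of the sequence; a diagonal subsequence
    converges to it at all rational points, and equicontinuity makes the convergence uniform on
    compact sets. *)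
Lemma ascoli (G : set {poly C}) (U : set S) : open U ->
  (forall p, U p -> equicont G p) -> normal_on U G.
Proof.
move=> oU eqU u uG.
pose x (n : nat) : prod_topology (fun _ : S => S) := fun p => sphere_map (u n) p.
have cpt := @tychonoff S (fun=> S) (fun=> setT) (fun=> one_point_compactification_compact).
have [y [_ yc]] : [set f : prod_topology (fun _ : S => S) | forall i, setT (f i)]
   `&` cluster (x @ \oo) !=set0.
  by apply: cpt; exists 0%N.
have freq (N : nat) (s : seq S) (e : R) : 0 < e -> exists n, (N <= n)%N /\
    forall p, p \in s -> chordal (x n p) (y p) < e.
  move=> e0.
  have nb : nbhs y [set f : prod_topology (fun _ : S => S) |
      forall p, p \in s -> chordal (f p) (y p) < e].
    elim: s => [|p s IH].
      rewrite (_ : [set f | _] = setT); first exact: filterT.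
      by apply/seteqP; split.
    have h : nbhs y [set f : prod_topology (fun _ : S => S) | chordal (f p) (y p) < e].
      exact: (@proj_continuous _ (fun=> S) p y _ (nbhs_chordal (y p) e0)).
    apply: filterS2 h IH => f h1 h2 q; rewrite inE => /predU1P[->|/h2//]; exact: h1.
  have xN : (x @ \oo) (x @` [set n | (N <= n)%N]).
    by exists N => // n /= Nn; exists n.
  by have [f [[n /= Nn <-] fy]] := yc _ _ xN nb; exists n.
(* The k-th term of the subsequence is taken within 1/(k + 1) of [y] at the first k + 1 rational
   points. *)
pose pts k := [seq (Some (ratC i) : S) | i <- iota 0 k.+1].
have /choice[g gP] : forall Nk : nat * nat, exists n, (Nk.1 <= n)%N /\
    forall p, p \in pts Nk.2 -> chordal (x n p) (y p) < Nk.2.+1%:R^-1.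
  by move=> [N k]; apply: freq; rewrite invr_gt0.
pose phi := fix phi k := if k is k'.+1 then g ((phi k').+1, k) else g (0%N, 0%N).
have phiP k p : p \in pts k -> chordal (x (phi k) p) (y p) < k.+1%:R^-1.
  by case: k => [|k]; [exact: (gP (0%N, 0%N)).2|exact: (gP ((phi k).+1, k.+1)).2].
have phiS k : (phi k < phi k.+1)%N by exact: (gP ((phi k).+1, k.+1)).1.
exists phi, y; split; first exact: homo_ltn (@ltn_trans) phiS.
(* From x(q) to y(q) by way of x(p), x and y at a rational point near p, and y(p): three steps below
   d and two of at most 3d. *)
move=> K cK KU e e0; pose d := e / 9.
have d0 : 0 < d by rewrite divr_gt0.
have /choice[V VP] : forall p, exists V : set S, U p -> open_nbhs p V /\
    forall g q, G g -> V q -> chordal (sphere_map g q) (sphere_map g p) < d.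
  move=> p; have [Up|] := pselect (U p); last by exists setT.
  by have [V oV VP] := eqU p Up d d0; exists V.
have yV p q : U p -> V p q -> chordal (y q) (y p) <= 3 * d.
  move=> Up Vq; have [n [_ nP]] := freq 0%N [:: p; q] d d0.
  have h1 := nP p (mem_head _ _).
  have h2 : chordal (x n q) (y q) < d by apply: nP; rewrite !inE eqxx orbT.
  have h3 : chordal (x n q) (x n p) < d := (VP p Up).2 _ _ (uG n) Vq.
  have t1 := chordal_triangle (y q) (y p) (x n q).
  have t2 := chordal_triangle (x n q) (y p) (x n p).
  rewrite chordalC in h2; lra.
have cK' := cK; rewrite compact_cover in cK'.
have [p Kp||D DK KD] := cK' S K V.
- exact: ((VP p (KU p Kp)).1).1.
- by move=> p Kp; exists p => //; exact: ((VP p (KU p Kp)).1).2.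
have /choice[idx idxP] : forall p : S, exists i, U p -> V p (Some (ratC i)).
  move=> p; have [Up|] := pselect (U p); last by exists 0%N.
  by have [i Vi] := open_has_rat (VP p Up).1; exists i.
pose N0 := (\max_(p <- finmap.enum_fset D) idx p)%N.
exists (maxn N0 (Num.truncn d^-1)) => // n /=; rewrite geq_max => /andP[nN nd] q Kq.
have [p /= pD Vq] := KD q Kq.
have Up : U p by apply: KU; have := DK p pD; rewrite inE.
have nd' : n.+1%:R^-1 < d.
  rewrite invf_plt ?posrE // (lt_le_trans (truncnS_gt _)) // ler_nat ltnS //.
have inr : (Some (ratC (idx p)) : S) \in pts n.
  apply/mapP; exists (idx p) => //; rewrite mem_iota add0n ltnS /=.
  by apply: leq_trans nN; exact: leq_bigmax_seq.
have h1 := lt_trans (phiP n _ inr) nd'.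
have Vr := idxP p Up.
have h2 : chordal (x (phi n) q) (x (phi n) p) < d := (VP p Up).2 _ _ (uG (phi n)) Vq.
have h3 : chordal (x (phi n) (Some (ratC (idx p)))) (x (phi n) p) < d :=
  (VP p Up).2 _ _ (uG (phi n)) Vr.
have h4 : chordal (y q) (y p) <= 3 * d by exact: yV.
have h5 : chordal (y (Some (ratC (idx p)))) (y p) <= 3 * d by exact: yV.
rewrite -/(x (phi n) q).
have t1 := chordal_triangle (x (phi n) q) (y q) (x (phi n) p).
have t2 := chordal_triangle (x (phi n) p) (y q) (x (phi n) (Some (ratC (idx p)))).
have t3 := chordal_triangle (x (phi n) (Some (ratC (idx p)))) (y q) (y (Some (ratC (idx p)))).
have t4 := chordal_triangle (y (Some (ratC (idx p)))) (y q) (y p).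
rewrite chordalC in h3; rewrite chordalC in h4.
have dE : 9 * d = e by rewrite /d; field.
lra.
Qed.

Lemma equicont_Fatou (G : set {poly C}) (U : set S) : open U ->
  (forall p, U p -> equicont G p) -> U `<=` Fatou G.
Proof. by move=> oU eqU p Up; exists U; split => //; exact: ascoli. Qed.

Lemma open_Fatou (G : set {poly C}) : open (Fatou G).
Proof.
rewrite openE => p [U [[oU Up] nU]].
apply: filterS (open_nbhs_nbhs (conj oU Up)) => q Uq.
by exists U.
Qed.

Lemma closed_Julia (G : set {poly C}) : closed (Julia G).
Proof. exact/open_closedC/open_Fatou. Qed.

(** Near z0 a uniform limit would be close to a bounded value, by continuity of one fixed term, and
    close to infinity at some point that escapes. *)
Lemma not_normal_Julia (G : set {poly C}) (u : nat -> {poly C}) (z0 : C) (r : R) :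
  (forall n, G (u n)) -> 0 <= r -> (forall n, nc (u n).[z0] <= r) ->
  (forall e : R, 0 < e -> exists2 z, nc (z - z0) < e &
     forall M : R, exists N, forall n, (N <= n)%N -> M < nc (u n).[z]) ->
  Julia G (Some z0).
Proof.
move=> uG r0 ur esc [U [[oU Uz0] nU]].
have [phi [f [phim cv]]] := nU u uG.
have [e1 e10 e1U] := (nbhs_someP z0 U).1 (open_nbhs_nbhs (conj oU Uz0)).
pose K : set S := Some @` (cdisc z0 (e1 / 2)).
have cK : compact K.
  apply: (@continuous_compact T S); last exact: compact_cdisc.
  by apply: continuous_subspaceT => z; exact: one_point_compactification_some_continuous.
have KU : K `<=` U.
  move=> _ [z zK <-]; apply: e1U; apply: le_lt_trans zK _; lra.
(* A lower bound for the chordal distance from the disc |w| <= r to infinity; the three errors of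
   c/4 below cannot bridge it. *)
pose c : R := 2 / (1 + r).
have c0 : 0 < c by rewrite divr_gt0 // ltr_pwDl.
have cr w : nc w <= r -> c <= chordal (Some w : S) None.
  move=> wr; rewrite /chordal -/(qn w) ler_wpM2l // lef_pV2 ?posrE ?qn_gt0 ?ltr_pwDl //.
  by apply: le_trans (qn_le_nc w) _; rewrite lerD2l.
have e0 : 0 < c / 4 by rewrite divr_gt0.
have [N _ NP] := cv K cK KU _ e0.
have [e2 e20 e2P] := @poly_cont_at _ (u (phi N)) z0 (c / 8) (divr_gt0 c0 (ltr0Sn _ _)).
pose e3 := Num.min (e1 / 2) e2.
have e30 : 0 < e3 by rewrite lt_min divr_gt0.
have [z zz0 zesc] := esc e3 e30.
have [M MP] := zesc (8 / c).
have phi_ge n : (n <= phi n)%N.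
  by elim: n => // n IH; apply: leq_ltn_trans IH (phim _ _ (ltnSn n)).
pose m := maxn N M.
have Kz : K (Some z) by exists z => //; rewrite /cdisc /= ltW // (lt_le_trans zz0) // ge_min lexx.
have h1 := NP m (leq_maxl _ _) _ Kz.
have h2 := NP N (leqnn _) _ Kz.
have h3 : 8 / c < nc (u (phi m)).[z] by apply: MP; exact: leq_trans (leq_maxr _ _) (phi_ge _).
have h4 : chordal (Some (u (phi m)).[z] : S) None <= c / 4.
  apply: le_trans (chordal_infty (_ : 0 < 8 / c) (ltW h3)) _; first by rewrite divr_gt0.
  rewrite invf_div; lra.
have h5 : chordal (Some (u (phi N)).[z0] : S) (Some (u (phi N)).[z]) <= c / 4.
  apply: le_trans (chordal_le _ _) _; rewrite ncBC.
  have : nc ((u (phi N)).[z] - (u (phi N)).[z0]) < c / 8.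
    by apply: e2P; apply: lt_le_trans zz0 _; rewrite ge_min lexx orbT.
  lra.
have h6 := cr _ (ur (phi N)).
move: h1 h2; rewrite /= => h1 h2.
set a : S := Some (u (phi N)).[z0] in h5 h6; set b : S := Some (u (phi N)).[z] in h2 h5.
set b' : S := Some (u (phi m)).[z] in h1 h4.
have t1 := chordal_triangle a None b; have t2 := chordal_triangle b None (f (Some z)).
have t3 := chordal_triangle (f (Some z)) None b'.
rewrite chordalC in h1; lra.
Qed.

End Chordal.

#[local] Arguments chordal : simpl never.

(** * The Julia set as a closure of boundaries *)

Section Estimates.
Variable R : realType.
Local Notation C := (complex R).
Implicit Types (p g h : {poly C}).

Definition shift g (z : C) : {poly C} := g \Po ('X + z%:P).

Lemma shiftE g z w : (shift g z).[w] = g.[w + z].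
Proof. by rewrite horner_comp !hornerE. Qed.

Lemma lip_center g z (rho B : R) : 0 < rho ->
  (forall w, nc (w - z) <= rho -> nc g.[w] <= B) ->
  forall w, nc (w - z) <= rho / 2 -> nc (g.[w] - g.[z]) <= 2 * B * (nc (w - z) / rho).
Proof.
move=> rho0 gB w wz; pose P := shift g z - (g.[z])%:P.
have -> : g.[w] - g.[z] = P.[w - z] by rewrite hornerD hornerN hornerC shiftE subrK.
apply: horner_dev => //.
  by rewrite -horner_coef0 hornerD hornerN hornerC shiftE add0r subrr.
move=> k k0; have -> : P`_k = (shift g z)`_k by rewrite coefB coefC gtn_eqF // subr0.
apply: cauchy_coef => // v vr; rewrite shiftE; apply: gB.
by rewrite addrK vr.
Qed.

Lemma harnack_at p z (rho : R) : 0 < rho ->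
  (forall w, nc (w - z) <= rho -> 1 <= nc p.[w]) ->
  forall w, nc (w - z) <= rho / 2 -> ln (nc p.[w]) <= 3 * ln (nc p.[z]).
Proof.
move=> rho0 p1 w wz; have := @harnack R (shift p z) rho rho0 _ (w - z) wz.
rewrite !shiftE subrK add0r; apply => v vr; rewrite shiftE; apply: p1.
by rewrite addrK.
Qed.

Lemma harnack2 p z (rho : R) : 0 < rho ->
  (forall w, nc (w - z) <= rho -> 1 <= nc p.[w]) ->
  forall w, nc (w - z) <= rho / 4 -> ln (nc p.[w]) <= 3 * ln (nc p.[z]) /\
     ln (nc p.[z]) <= 3 * ln (nc p.[w]).
Proof.
move=> rho0 p1 w wz; split; first by apply: harnack_at p1 _ _ => //; lra.
have r2 : 0 < rho / 2 by rewrite divr_gt0.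
apply: (harnack_at r2); last by rewrite ncBC; lra.
move=> v vw; apply: p1; have -> : v - z = (v - w) + (w - z) by ring.
apply: le_trans (ncD _ _) _; lra.
Qed.

Section Iterates.
Variable h : {poly C}.
Hypothesis h2 : (2 < size h)%N.
Let d := deg h.
Let h1 : (1 < size h)%N. Proof. exact: ltn_trans h2. Qed.
Let dR : 0 < d%:R - 1 :> R.
Proof. by rewrite subr_gt0 ltr1n /d /deg -ltnS prednK // (leq_trans _ h2). Qed.

(** From max(1, |h|) <= C0 max(1, |w|)^d; the constant c solves ln C0 + c = d c, so that the bound
    reproduces itself under one more iteration. With [iter_lower] it relates |g| to |h^k o g|
    independently of k once logarithms are divided by d^k. *)
Lemma iter_upper : exists2 c : R, 0 <= c & forall k w,
  ln (Num.max 1 (nc (iter k (horner h) w))) <= (d ^ k)%:R * (ln (Num.max 1 (nc w)) + c).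
Proof.
have [C1 C10 C1P] := poly_upper h; have [C2 C20 C2P] := poly_bounded_on h 1.
pose C0 := 1 + C1 + C2.
have C01 : 1 <= C0 by rewrite /C0; lra.
have m1 w : 1 <= Num.max 1 (nc w) by rewrite le_max lexx.
have step w : Num.max 1 (nc h.[w]) <= C0 * Num.max 1 (nc w) ^+ d.
  have e1 : 1 <= Num.max 1 (nc w) ^+ d by rewrite exprn_ege1.
  rewrite ge_max; apply/andP; split; first by nra.
  have [w1|w1] := leP 1 (nc w).
    rewrite (le_trans (C1P _ w1)) // -/(deg h) -/d ler_wpM2r ?exprn_ge0 ?nc_ge0 //.
    by rewrite /C0; lra.
  by rewrite expr1n mulr1 (le_trans (C2P _ (ltW w1))) // /C0; lra.
exists (ln C0 / (d%:R - 1)); first by rewrite divr_ge0 ?ln_ge0 // ltW.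
elim=> [|k IH] w; first by rewrite mul1r lerDl divr_ge0 ?ln_ge0 // ltW.
set c := ln C0 / _; rewrite iterSr; apply: le_trans (IH _) _.
rewrite expnSr natrM -mulrA ler_wpM2l //.
have : ln (Num.max 1 (nc h.[w])) <= ln C0 + d%:R * ln (Num.max 1 (nc w)).
  have m0 : 0 < Num.max 1 (nc w) by rewrite lt_max ltr01.
  have c0 : 0 < C0 by exact: lt_le_trans ltr01 C01.
  rewrite mulr_natl -lnXn // -lnM ?posrE ?exprn_gt0 // ler_ln ?posrE ?mulr_gt0 ?exprn_gt0 //.
  by rewrite lt_max ltr01.
move=> H; have cE : ln C0 = d%:R * c - c.
  by rewrite /c; field; rewrite gt_eqF.
rewrite -/c mulrDr; lra.
Qed.

Lemma iter_lower (r : R) : escape_radius h r -> exists2 c : R, 0 <= c & forall k w,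
  r <= nc w -> (d ^ k)%:R * (ln (nc w) - c) <= ln (nc (iter k (horner h) w)).
Proof.
move=> hr; have [r1 _ _] := hr.
have h0 : h != 0 by rewrite -size_poly_gt0 (leq_trans _ h1).
have [c1 c10 [r2 r21 lowP]] := poly_lower h0.
pose b := Num.max r r2.
have b1 : 1 <= b by rewrite le_max r1.
have b0 : 0 < b by exact: lt_le_trans ltr01 b1.
(* The last term covers the annulus r <= |w| < r2, where b^(-d) |w|^d <= 1 <= |h(w)|. *)
pose c0 := Num.min (Num.min c1 1) (b ^- d).
have c00 : 0 < c0 by rewrite !lt_min c10 ltr01 invr_gt0 exprn_gt0.
have c01 : c0 <= 1 by rewrite !ge_min lexx orbT.
have low w : r <= nc w -> c0 * nc w ^+ d <= nc h.[w].
  move=> rw; have [w2|w2] := leP r2 (nc w).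
    apply: le_trans (lowP _ w2); rewrite ler_wpM2r ?exprn_ge0 ?nc_ge0 //.
    by rewrite !ge_min lexx.
  apply: (@le_trans _ _ 1).
    apply: (@le_trans _ _ (b ^- d * b ^+ d)); last by rewrite mulVf // expf_neq0 // gt_eqF.
    apply: ler_pM; rewrite ?exprn_ge0 ?nc_ge0 ?(ltW c00) //; first by rewrite !ge_min lexx orbT.
    by rewrite lerXn2r ?nnegrE ?nc_ge0 ?(ltW b0) // le_max (ltW w2) orbT.
  have := esc_step hr rw; lra.
exists (- ln c0 / (d%:R - 1)).
  by rewrite divr_ge0 ?(ltW dR) // oppr_ge0 ln_le0.
elim=> [|k IH] w rw.
  by rewrite mul1r lerBlDr lerDl divr_ge0 ?(ltW dR) // oppr_ge0 ln_le0.
set c := - ln c0 / _; rewrite iterSr.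
have w0 : 0 < nc w by apply: lt_le_trans rw; lra.
have rhw : r <= nc h.[w] by have := esc_step hr rw; lra.
apply: le_trans (IH _ rhw); rewrite expnSr natrM -mulrA ler_wpM2l //.
have : ln c0 + d%:R * ln (nc w) <= ln (nc h.[w]).
  rewrite mulr_natl -lnXn // -lnM ?posrE ?exprn_gt0 // ler_ln ?posrE ?mulr_gt0 ?exprn_gt0 ?low //.
  by apply: lt_le_trans rhw; lra.
have cE : ln c0 = - (d%:R * c - c).
  by rewrite /c; field; rewrite gt_eqF.
rewrite -/c mulrBr; lra.
Qed.

End Iterates.
End Estimates.

Section JuliaClosure.
Variable R : realType.
Local Notation C := (complex R).
Local Notation T := (cplane R).
Local Notation S := (rsphere R).
Variable G : set {poly C}.
Hypothesis Gc : forall g k, G g -> G k -> G (g \Po k).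
Hypothesis G2 : forall g, G g -> (2 < size g)%N.
Variable R0 : R.
Hypothesis crit : forall g c, G g -> root g^`() c -> nc g.[c] <= R0.
Variable h : {poly C}.
Hypothesis Gh : G h.
Variable r : R.
Hypothesis hr : escape_radius h r.
Hypothesis rR0 : R0 < r.

Let h2 : (2 < size h)%N. Proof. exact: G2. Qed.
Let G1 g : G g -> (1 < size g)%N. Proof. by move/G2; exact: ltn_trans. Qed.
Let r1 : 1 <= r. Proof. by case: hr. Qed.
Let d := deg h.
Let d0 k : 0 < (d ^ k)%:R :> R.
Proof. by rewrite ltr0n expn_gt0 deg_gt0 // G1. Qed.

Local Notation Xs := (Xs h r).
Local Notation Es := (Es h r).

Lemma itp_G k u : G u -> G (itp h k u).
Proof. by move=> Gu; elim: k => //= k IH; exact: Gc. Qed.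

Lemma Xs_connected u : G u -> connected (Xs u).
Proof.
move=> Gu; apply: decreasing_connected => k.
- by apply: compact_sublevel; apply: G1; exact: itp_G.
- exact: closed_sublevel.
- apply: closed_sublevel_connected; first by apply: G1; exact: itp_G.
    exact: lt_le_trans ltr01 r1.
  by move=> c rc; apply: le_lt_trans rR0; apply: crit => //; exact: itp_G.
- exact: (Fs_dec hr).
Qed.

(** A critical point c of [h] is critical for every composite g o h, so each g in [G] sends h(c) to
    a critical value, which is at most R0 < r in modulus. *)
Lemma common_point : exists p0, forall u, G u -> Xs u p0.
Proof.
have [c rc] : exists c, root h^`() c.
  apply/closed_rootP; apply/eqP => s1.
  have : h^`()`_(size h - 2) = 0.
    by rewrite nth_default // s1 subn_gt0.
  rewrite coef_deriv => /eqP; rewrite mulrn_eq0 /= -[(size h - 2).+1]addn1.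
  have -> : (size h - 2 + 1 = (size h).-1)%N by have := h2; case: (size h) => [|[|n]] // _; rewrite subn2 addn1.
  rewrite -lead_coefE lead_coef_eq0 => /eqP h0.
  by have := h2; rewrite h0 size_poly0.
exists h.[c] => u Gu k _; rewrite /Fs /= -horner_comp.
apply: le_trans (ltW rR0); apply: crit; first by apply: Gc => //; exact: itp_G.
by rewrite deriv_comp rootM rc orbT.
Qed.

Lemma Es_connected u : G u -> connected (Es u).
Proof.
move=> Gu; apply: boundary_connected.
- exact: compact_Xs (G1 Gu).
- exact: closed_Xs.
- exact: Xs_connected.
- exact: (XsC_connected (G2 Gh) hr (G1 Gu)).
Qed.

Lemma Es_nonempty u : G u -> Es u !=set0.
Proof.
move=> Gu; have [p0 /(_ u Gu) pX] := common_point.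
have [y ny] := @Xs_proper R h r u (G1 Gu).
have [v [_ a b]] := connected_meets_boundary (@seg_connected R p0 y) (seg_l _ _) pX (seg_r _ _) ny.
by exists v.
Qed.

Lemma escape_tends u z : ~ Xs u z -> forall M : R, exists N, forall n, (N <= n)%N ->
  M < nc (itp h n u).[z].
Proof.
move=> nX M.
have [k] : exists k, r < nc (iter k (horner h) u.[z]).
  apply: contrapT => /forallNP H; apply: nX; apply/Xs_iter => k.
  by rewrite leNgt; apply/negP; exact: H.
move=> rk; have [N NM] := exprn_unbounded M (ltr1n R 2 : 1 < 2 :> R).
exists (N + k)%N => n Nn; rewrite horner_itp -(subnK (leq_trans (leq_addl _ _) Nn)) iterD.
have /(esc_iter hr (n - k)) := ltW rk; apply: lt_le_trans.
apply: (lt_le_trans NM); apply: (@le_trans _ _ (2 ^+ (n - k))).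
  by rewrite ler_weXn2l ?ler1n // leq_subRL ?(leq_trans (leq_addl _ _) Nn) // addnC.
rewrite ler_peMr ?exprn_ge0 //; apply: (le_trans r1); exact: ltW.
Qed.

(** The sequence h^n o u is bounded at a boundary point and tends to infinity at points arbitrarily
    close to it. *)
Lemma Es_Julia u z : G u -> Es u z -> Julia G (Some z).
Proof.
move=> Gu Ez; apply: (@not_normal_Julia R G (fun n => itp h n u) z r).
- by move=> n; exact: itp_G.
- exact: le_trans r1.
- by move=> n; exact: (@Es_sub _ _ _ _ _ Ez n I).
- move=> e e0; case: Ez => _ /closure_disc /(_ e e0)[w nw wz].
  by exists w => //; exact: escape_tends.
Qed.

Lemma disc_in_or_out u z (rho : R) : (forall w, Es u w -> ~ disc z rho w) ->
  disc z rho `<=` Xs u \/ disc z rho `<=` ~` Xs u.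
Proof.
move=> H; have [[a [Da Xa]]|n] := pselect (exists a, disc z rho a /\ Xs u a).
  left => w Dw; apply: contrapT => nX.
  have [v [Dv c1 c2]] := connected_meets_boundary (@disc_connected R z rho) Da Xa Dw nX.
  exact: (H v).
by right => w Dw Xw; apply: n; exists w.
Qed.

Lemma uniform_escape u (K : set T) : compact K -> K `<=` ~` Xs u ->
  exists k, forall w, K w -> r < nc (itp h k u).[w].
Proof.
move=> cK KX.
have [||w Kw|k kP] := @compact_increasing_cover T K (fun k => [set w | r < nc (itp h k u).[w]]) cK.
- by move=> k; exact: (open_gt_cont (@nc_horner_cont R _)).
- by move=> k w /=; rewrite horner_comp => rw; have := @esc_gt _ _ _ hr 1 _ rw.
- have [N NP] := escape_tends (KX w Kw) r.
  by exists N; exact: NP.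
by exists k => w /kP.
Qed.

(** A disc without boundary points lies inside or outside [Xs g]. Inside, |g| <= r. Outside, some
    h^k o g exceeds r on a smaller disc, and Harnack's inequality for it, with the factor d^k
    cancelled, makes g either bounded by [B] or at least [T'] throughout a still smaller disc,
    uniformly in g although k depends on g. Cauchy's estimates settle the bounded case; the other
    one takes place near infinity. *)
Lemma equicont_off z (rho : R) : 0 < rho ->
  (forall u w, G u -> Es u w -> ~ disc z rho w) -> equicont G (Some z).
Proof.
move=> rho0 H e e0.
have [cu cu0 cuP] := iter_upper (G2 Gh); have [cl cl0 clP] := iter_lower (G2 Gh) hr.
rewrite -/d in cuP clP.
pose T' : R := 1 + 4 / e.
have T'1 : 1 <= T' by rewrite /T' lerDl divr_ge0 // ltW.
have T'0 : 0 < T' by exact: lt_le_trans ltr01 T'1.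
(* If ln|g(z)| > t, Harnack and the comparison of g with h^k o g force |g| > T' nearby; the summand
   ln r puts g(z) beyond r, where [iter_lower] applies. [B] comes from the same chain when ln|g(z)|
   <= t. *)
pose t : R := 3 * (ln T' + cu) + cl + ln r + 1.
have rln0 : 0 <= ln r by exact: ln_ge0.
have lT0 : 0 <= ln T' by exact: ln_ge0.
pose TT := expR t.
have TTr : r <= TT.
  rewrite -[r]lnK ?posrE ?(lt_le_trans ltr01 r1) // ler_expR /t; lra.
have TT1 : 1 <= TT by exact: le_trans TTr.
pose B := Num.max r (expR (3 * (t + cu) + cl)).
have rB : r <= B by rewrite le_max lexx.
pose rho' := rho / 8.
have rho'0 : 0 < rho' by rewrite divr_gt0.
pose del := Num.min (rho' / 2) (e * rho' / (8 * (B + 1))).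
have B0 : 0 < B + 1 by have := le_trans r1 rB; lra.
have del0 : 0 < del by rewrite lt_min !divr_gt0 // mulr_gt0.
have dichot g : G g -> (forall w, nc (w - z) <= rho' -> nc g.[w] <= B) \/
    (forall w, nc (w - z) <= rho' -> T' <= nc g.[w]).
  move=> Gg; case: (disc_in_or_out (H g ^~ Gg)) => D.
    left => w wz; apply: le_trans rB; have : disc z rho w.
      by apply: le_lt_trans wz _; rewrite /rho'; lra.
    by move=> /D /(_ 0%N I).
  have rho2 : rho / 2 < rho by lra.
  have rho20 : 0 < rho / 2 by lra.
  have [k kP] := @uniform_escape g (cdisc z (rho / 2)) (@compact_cdisc R _ _)
    (fun w wz => D w (le_lt_trans wz rho2)).
  have P1 w : nc (w - z) <= rho / 2 -> 1 <= nc (itp h k g).[w].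
    by move=> /kP /ltW; exact: le_trans.
  have rr : rho' <= rho / 2 / 4 by rewrite /rho'; lra.
  have har w : nc (w - z) <= rho' -> _ := fun wz => harnack2 rho20 P1 (le_trans wz rr).
  have Pup w : ln (nc (itp h k g).[w]) <= (d ^ k)%:R * (ln (Num.max 1 (nc g.[w])) + cu).
    rewrite horner_itp; apply: le_trans (cuP k g.[w]).
    have [lt1|ge1] := ltP (nc (iter k (horner h) g.[w])) 1; last by [].
    by rewrite ln1 ln_le0 // ltW.
  have Plow w : r <= nc g.[w] -> (d ^ k)%:R * (ln (nc g.[w]) - cl) <= ln (nc (itp h k g).[w]).
    by rewrite horner_itp; exact: clP.
  have dk := d0 k.
  have [aT|aT] := leP (nc g.[z]) TT.
    left => w wz; have [br|br] := ltP (nc g.[w]) r; first by apply: le_trans rB; exact: ltW.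
    have [h1 _] := har w wz; have h2' := Plow w br; have h3 := Pup z.
    have h4 : ln (Num.max 1 (nc g.[z])) <= t.
      rewrite -[t]expRK ler_ln ?posrE ?lt_max ?ltr01 ?expR_gt0 //.
      by rewrite ge_max aT TT1.
    have h5 : (d ^ k)%:R * (ln (nc g.[w]) - cl) <= (d ^ k)%:R * (3 * (t + cu)).
      apply: (le_trans h2'); apply: (le_trans h1).
      rewrite mulrCA ler_wpM2l //; apply: (le_trans h3).
      by rewrite ler_wpM2l ?(ltW dk) // lerD2r.
    rewrite ler_pM2l // in h5.
    have b0 : 0 < nc g.[w] by apply: lt_le_trans br; exact: lt_le_trans ltr01 r1.
    rewrite /B le_max -[nc g.[w]]lnK ?posrE // ler_expR; apply/orP; right; lra.
  right => w wz; have [_ h1] := har w wz.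
  have h2' := Plow z (le_trans TTr (ltW aT)); have h3 := Pup w.
  have h4 : t <= ln (nc g.[z]).
    by rewrite -[t]expRK ler_ln ?posrE ?expR_gt0 ?(lt_trans _ aT) ?expR_gt0 // ltW.
  have h5 : (d ^ k)%:R * (t - cl) <= (d ^ k)%:R * (3 * (ln (Num.max 1 (nc g.[w])) + cu)).
    apply: le_trans (le_trans (le_trans _ h2') h1) _.
      by rewrite ler_wpM2l ?(ltW dk) // lerD2r.
    by rewrite mulrCA ler_wpM2l.
  rewrite ler_pM2l // in h5.
  have : ln T' < ln (Num.max 1 (nc g.[w])) by rewrite /t in h5; lra.
  rewrite ltr_ln ?posrE ?lt_max ?ltr01 // => /orP[|/ltW//].
  by rewrite ltNge T'1.
exists (Some @` (disc z del)).
  split; first by apply: one_point_compactification_open_some; exact: open_disc.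
  by exists z => //; exact: disc_center.
move=> g _ Gg [w wz <-]; rewrite /sphere_map.
have {}wz : nc (w - z) < del := wz.
have [H1|H1] := dichot g Gg.
  apply: le_lt_trans (chordal_le _ _) _.
  have wr : nc (w - z) <= rho' / 2.
    by apply: ltW; apply: lt_le_trans wz _; rewrite ge_min lexx.
  have wr2 : nc (w - z) < e * rho' / (8 * (B + 1)).
    by apply: lt_le_trans wz _; rewrite ge_min lexx orbT.
  have := lip_center rho'0 H1 wr; move: wr2.
  rewrite ltr_pdivlMr ?mulr_gt0 // => wr2.
  rewrite mulrA ler_pdivlMr // => H2.
  rewrite -(ltr_pM2r rho'0).
  have nw := nc_ge0 (w - z).
  have : 0 <= nc (w - z) * (B + 1) by rewrite mulr_ge0 // ltW.
  have : 0 < e * rho' by rewrite mulr_gt0.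
  nra.
have wr : nc (w - z) <= rho'.
  apply: ltW; apply: lt_le_trans wz _; rewrite ge_min; apply/orP; left.
  by rewrite ler_pdivrMr // ler_peMr ?ltW // ltr1n.
have zr : nc (z - z) <= rho' by rewrite subrr nc0 ltW.
have h1 := chordal_infty T'0 (H1 w wr); have h3 := chordal_infty T'0 (H1 z zr).
apply: le_lt_trans (chordal_triangle _ _ None) _; rewrite (chordalC None).
have : 2 / T' < e / 2.
  rewrite ltr_pdivrMr // /T' mulrDr mulr1.
  have -> : e / 2 * (4 / e) = 2 by field; rewrite gt_eqF.
  lra.
lra.
Qed.

(** For large k all roots of h^k o g lie in |t| < rho + 1 while the polynomial exceeds r >= 1 at a
    point of modulus rho + 2. Comparing factor by factor gives growth at least y^(d^k) far away, and
    [iter_upper] turns this into a bound on |g| independent of k and g. *)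
Lemma equicont_infty (rho : R) : 0 < rho ->
  (forall u, G u -> Xs u `<=` cdisc 0 rho) -> equicont G None.
Proof.
move=> rho0 H e e0; have [c c0 cP] := iter_upper (G2 Gh); rewrite -/d in cP.
pose T' : R := 1 + 4 / e.
have T'1 : 1 < T' by rewrite /T' ltrDl divr_gt0.
have T'0 : 0 < T' by exact: lt_trans ltr01 T'1.
pose y := T' * expR c.
have y1 : 1 <= y.
  by rewrite /y -[leLHS]mulr1; apply: ler_pM => //; [exact: ltW|rewrite -expR0 ler_expR].
(* For a root t, the comparison point z1 has |z1 - t| <= 2 rho + 3, and |z| > b gives |z - t| >= (2
   rho + 3) y. *)
pose b := (2 * rho + 3) * y + rho + 1.
have big g z : G g -> b < nc z -> T' <= nc g.[z].
  move=> Gg zb; have g1 := G1 Gg.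
  have [||k kP] := @compact_decreasing_sub T (fun k => Fs h r k g) (disc 0 (rho + 1))
     (@compact_sublevel R g r g1) (fun k => @closed_sublevel R (itp h k g) r) (fun k => @Fs_dec R h r hr k g).
  - exact: open_disc.
  - by move=> w /(H g Gg) wr; apply: le_lt_trans wr _; lra.
  pose p := itp h k g; have p1 : (1 < size p)%N by apply: size_itp => //; exact: G1.
  have [rs srs rsP] := poly_rootsP p.
  have rsb t : t \in rs -> nc t < rho + 1.
    move=> trs; have : Fs h r k g t.
      rewrite /Fs /= -/p rsP (perm_big _ (perm_to_rem trs)) big_cons /= subrr mul0r mulr0 nc0.
      exact: le_trans r1.
    by move=> /kP; rewrite /disc /= subr0.
  have rho20 : 0 <= rho + 2 by lra.
  have [z1 z1E] := nc_exists rho20.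
  have pz1 : r < nc p.[z1].
    rewrite ltNge; apply/negP => /(kP z1); rewrite /disc /= subr0 z1E; lra.
  have A0 : 0 < 2 * rho + 3 by lra.
  have up : nc p.[z1] <= nc (lead_coef p) * (2 * rho + 3) ^+ size rs.
    rewrite rsP ncM ler_wpM2l ?nc_ge0 //; apply: nc_prod_le => t /rsb tb.
    apply: le_trans (ncB _ _) _; rewrite z1E; lra.
  have low : nc (lead_coef p) * ((2 * rho + 3) * y) ^+ size rs <= nc p.[z].
    rewrite rsP ncM ler_wpM2l ?nc_ge0 //; apply: nc_prod_ge => [|t /rsb tb].
      by rewrite mulr_ge0 ?ltW // (lt_le_trans ltr01).
    by apply: le_trans (nc_sub _ _); rewrite /b in zb; lra.
  have y0 : 0 < y by exact: lt_le_trans ltr01 y1.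
  have yp : y ^+ (d ^ k) <= nc p.[z].
    apply: le_trans low; rewrite [(_ * y) ^+ _]exprMn mulrA.
    apply: (@le_trans _ _ (1 * y ^+ size rs)).
      rewrite mul1r ler_weXn2l // srs -[(size p).-1]/(deg p) deg_itp.
      by rewrite leq_pmulr // deg_gt0.
    rewrite ler_wpM2r ?exprn_ge0 ?(ltW y0) //.
    by apply: le_trans up; apply: le_trans r1 _; exact: ltW.
  have ly : ln y = ln T' + c by rewrite /y lnM ?posrE ?expR_gt0 // expRK.
  have h1 : (d ^ k)%:R * ln y <= ln (nc p.[z]).
    rewrite mulr_natl -lnXn // ler_ln ?posrE ?exprn_gt0 //.
    by apply: lt_le_trans yp; rewrite exprn_gt0.
  have h3 : ln (nc p.[z]) <= (d ^ k)%:R * (ln (Num.max 1 (nc g.[z])) + c).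
    rewrite horner_itp; apply: le_trans (cP k g.[z]).
    have [lt1|ge1] := ltP (nc (iter k (horner h) g.[z])) 1; last by [].
    by rewrite ln1 ln_le0 // ltW.
  have := le_trans h1 h3; rewrite ly ler_pM2l // lerD2r.
  rewrite ler_ln ?posrE ?lt_max ?ltr01 // le_max => /orP[|//].
  by rewrite leNgt T'1.
exists [set p : S | if p is Some z then b < nc z else True].
  split=> //; rewrite openE => -[z|] /= zb; last exact: nbhs_infty.
  apply/nbhs_someP; exact: (open_near (open_gt_cont (@nc_cont R)) zb).
move=> g [z|] Gg /= zb; last by rewrite chordal_refl.
have h1 := chordal_infty T'0 (big g z Gg zb); apply: le_lt_trans h1 _.
rewrite ltr_pdivrMr // /T' mulrDr mulr1.
have -> : e * (4 / e) = 4 by field; rewrite gt_eqF.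
lra.
Qed.

(** The outward ray from a point of the bounded set [Xs u] leaves it through a boundary point whose
    modulus is at least as large. *)
Lemma Xs_in_disc u (b : R) : 0 < b -> G u ->
  (forall z, Es u z -> nc z <= b) -> Xs u `<=` cdisc 0 b.
Proof.
move=> b0 Gu Eb z Xz; rewrite /cdisc /= subr0 leNgt; apply/negP => zb.
have [B BP] := @Xs_bounded R h r u (G1 Gu).
have z0 : 0 < nc z by exact: lt_trans zb.
have [s sE] : exists s, s = (`|B| + 1) / nc z + 1 by exists ((`|B| + 1) / nc z + 1).
have s1 : 1 <= s by rewrite sE lerDr divr_ge0 ?nc_ge0 // addr_ge0.
have nXs : ~ Xs u (s%:C%C * z).
  move=> /BP; rewrite nc_scale_real; last by apply: le_trans s1.
  rewrite sE mulrDl divfK ?gt_eqF // mul1r; have := ler_norm B; lra.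
have [v [[t /= + tE] c1 c2]] := connected_meets_boundary (@seg_connected R z (s%:C%C * z)) (seg_l _ _) Xz (seg_r _ _) nXs.
rewrite in_itv /= => /andP[t0 t1].
have := Eb v (conj c1 c2); rewrite -tE.
have -> : z + t%:C%C * (s%:C%C * z - z) = (1 + t * (s - 1))%:C%C * z.
  by rewrite rmorphD rmorphM /= rmorphB /= !rmorph1; ring.
have ts : 0 <= t * (s - 1) by rewrite mulr_ge0 // subr_ge0.
rewrite nc_scale_real ?addr_ge0 // leNgt => /negP; apply.
by apply: (lt_le_trans zb); rewrite mulrDl mul1r lerDl mulr_ge0 // ltW.
Qed.

Theorem Julia_closure :
  Julia G = closure [set p : S | exists u z, [/\ G u, Es u z & p = Some z]].
Proof.
set L := [set p | _]; apply/seteqP; split; last first.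
  apply: closure_closed_sub; first exact: closed_Julia.
  by move=> _ [u [z [Gu Ez ->]]]; exact: Es_Julia Ez.
move=> p Jp; apply: contrapT => ncl.
apply: Jp.
have oL : open (~` closure L) by exact/closed_openC/closed_closure.
have Loff u z : G u -> Es u z -> ~ (~` closure L) (Some z).
  by move=> Gu Ez; apply; apply: subset_closure; exists u, z.
have fin z : (~` closure L) (Some z) -> equicont G (Some z).
  move=> nz; have := open_nbhs_nbhs (conj oL nz).
  move=> /nbhs_someP[e e0 eL]; apply: (equicont_off e0) => u w Gu Ew Dw.
  exact: (Loff u w Gu Ew (eL w Dw)).
apply: (equicont_Fatou oL) ncl => -[z|] nq; first exact: fin.
(* A neighborhood of infinity off the closure bounds all the sets [Es u] together, hence all the
   sets [Xs u]. *)
have [b b0 [_ bP]] := nbhs_inftyP (open_nbhs_nbhs (conj oL nq)).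
apply: (equicont_infty b0) => u Gu; apply: Xs_in_disc => // z Ez.
by rewrite leNgt; apply/negP => /bP; exact: Loff Ez.
Qed.

End JuliaClosure.

(** * Real affine maps *)

Section AffineDensity.
Variable R : realType.

Lemma first_below (x y q : R) : 1 < q -> 0 < y -> y < x ->
  exists k, y / q < x / q ^+ k.+1 /\ x / q ^+ k.+1 <= y.
Proof.
move=> q1 y0 yx; have q0 : 0 < q by exact: lt_trans ltr01 q1.
have P : exists k, x / q ^+ k.+1 <= y.
  have [k kP] := exprn_unbounded (x / y) q1.
  exists k; rewrite ler_pdivrMr ?exprn_gt0 // mulrC -ler_pdivrMr //.
  by apply: le_trans (ltW kP) _; rewrite exprS ler_peMl ?exprn_ge0 ?(ltW q0) ?(ltW q1).
pose P' k := x / q ^+ k.+1 <= y.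
have exP : exists k, P' k by [].
exists (ex_minn exP); case: ex_minnP => k kP kmin; split => //.
rewrite exprS invfM mulrCA [ltRHS]mulrC ltr_pM2r ?invr_gt0 //.
case: k kP kmin => [|k] kP kmin; first by rewrite expr0 invr1 mulr1.
by rewrite ltNge; apply/negP => /kmin; rewrite ltnn.
Qed.

(* Relative density improves: pulling [D] back by a map with a far fixed point
   and then by powers of the map fixing [c] shrinks relative gaps by a factor. *)
Lemma affine_dense_above (D : set R) (F : set (R * R)) (c q : R) :
  F (c, q) -> (forall a, F a -> 2 <= a.2) ->
  (forall a x, F a -> D x -> D (a.1 + (x - a.1) / a.2)) ->
  (forall M, exists2 x, D x & M < x) ->
  (forall M, exists2 a, F a & M < a.1) ->
  forall y e, c < y -> 0 < e -> exists2 x, D x & `|x - y| < e.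
Proof.
move=> Fc F2 DF Dunb Funb.
have q2 : 2 <= q := F2 _ Fc.
have q1 : 1 < q by lra.
have q0 : 0 < q by lra.
have Dk k x : D x -> D (c + (x - c) / q ^+ k).
  move=> Dx; elim: k => [|k IH]; first by rewrite expr0 divr1 addrC subrK.
  have := DF (c, q) _ Fc IH; rewrite /= addrAC subrr add0r.
  by rewrite exprSr invfM mulrA.
(* [P t] is density above c up to an error t relative to the distance from c. The powers of the map
   fixing c alone give 1 - 1/q. *)
pose P (t : R) := forall y, c < y -> exists2 x, D x & `|x - y| <= t * (y - c).
have base : P (1 - q^-1).
  move=> y cy; have y0 : 0 < y - c by rewrite subr_gt0.
  have [x Dx yx] := Dunb y.
  have yx' : y - c < x - c by rewrite ltrD2r.
  have [k [k1 k2]] := first_below q1 y0 yx'.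
  exists (c + (x - c) / q ^+ k.+1); first exact: Dk.
  set X := (x - c) / _ in k1 k2 *.
  rewrite ler0_norm; last by lra.
  rewrite mulrBl mul1r [_^-1 * _]mulrC; lra.
pose l := 1 - (2 * q)^-1.
have l0 : 0 <= l.
  by rewrite /l subr_ge0 invf_le1 ?mulr_gt0 //; lra.
have l1 : l < 1 by rewrite /l ltrBlDr ltrDl invr_gt0 mulr_gt0.
have step t : 0 <= t -> P t -> P (l * t).
  move=> t0 Pt y cy; have y0 : 0 < y - c by rewrite subr_gt0.
  have [[T p] /= Fa MT] := Funb (c + (y - c)).
  have p2 : 2 <= p := F2 _ Fa.
  have p0 : 0 < p by lra.
  (* The pull-back by (T, p) sends c to c + t0', with t0' > (y - c)/2 because T > y and p >= 2.
     After k + 1 pull-backs by (c, q) it comes to c + tau with (y - c)/(2q) < tau <= (y - c)/2, and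
     c + y' is the point sent to y. The error scales with y - c - tau, which gives the factor l = 1
     - 1/(2q). *)
  pose t0' := (T - c) * (1 - p^-1).
  have pi : p^-1 <= 2^-1 by rewrite lef_pV2 ?posrE.
  have half : (y - c) / 2 < t0' by rewrite /t0'; nra.
  have [k [k1 k2]] := first_below q1 (divr_gt0 y0 (ltr0Sn _ 1)) half.
  set tau := t0' / q ^+ k.+1 in k1 k2.
  have qk : 0 < q ^+ k.+1 by rewrite exprn_gt0.
  pose y' := (y - c - tau) * (q ^+ k.+1 * p).
  have y'0 : 0 < y' by rewrite mulr_gt0 ?mulr_gt0 //; lra.
  have [|x Dx xy] := Pt (c + y'); first by rewrite ltrDl.
  exists (c + (T + (x - T) / p - c) / q ^+ k.+1); first by apply: Dk; exact: (DF (T, p)).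
  have -> : c + (T + (x - T) / p - c) / q ^+ k.+1 - y = (x - (c + y')) / (q ^+ k.+1 * p).
    by rewrite /y' /tau /t0'; field; rewrite !gt_eqF.
  rewrite normrM [X in _ * X]gtr0_norm ?invr_gt0 ?mulr_gt0 //.
  rewrite ler_pdivrMr ?mulr_gt0 //; apply: (le_trans xy).
  rewrite [c + y']addrC addrK /y' mulrA ler_wpM2r //; first by rewrite mulr_ge0 // ltW.
  rewrite -mulrA mulrCA ler_wpM2l // /l mulrBl mul1r lerD2l lerN2.
  by rewrite invfM -mulrA mulrC [q^-1 * _]mulrC; move: k1; rewrite mulrAC => /ltW.
move=> y e cy e0; have y0 : 0 < y - c by rewrite subr_gt0.
have qi : q^-1 <= 2^-1 by rewrite lef_pV2 ?posrE.
have qi0 : 0 < q^-1 by rewrite invr_gt0.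
have Pn n : P (l ^+ n * (1 - q^-1)).
  elim: n => [|n IH]; first by rewrite expr0 mul1r.
  by rewrite exprS -mulrA; apply: step => //; rewrite mulr_ge0 ?exprn_ge0 //; lra.
have [n nP] : exists n, l ^+ n < e / (y - c).
  have [l00|ln0] := eqVneq l 0.
    by exists 1%N; rewrite l00 expr1 divr_gt0.
  by apply: expr_small => //; rewrite ?divr_gt0 // lt_def ln0.
have [x Dx xy] := Pn n y cy; exists x => //; apply: (le_lt_trans xy).
rewrite -ltr_pdivlMr //; apply: le_lt_trans nP.
by rewrite ler_piMr ?exprn_ge0 //; lra.
Qed.

Lemma affine_dense_below (D : set R) (F : set (R * R)) (c q : R) :
  F (c, q) -> (forall a, F a -> 2 <= a.2) ->
  (forall a x, F a -> D x -> D (a.1 + (x - a.1) / a.2)) ->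
  (forall M, exists2 x, D x & x < M) ->
  (forall M, exists2 a, F a & a.1 < M) ->
  forall y e, y < c -> 0 < e -> exists2 x, D x & `|x - y| < e.
Proof.
move=> Fc F2 DF Dunb Funb y e yc e0.
have [|a Fa|a x Fa Dx|M|M|||x Dx xy] :=
  @affine_dense_above [set x | D (- x)] [set a | F (- a.1, a.2)] (- c) q _ _ _ _ _ (- y) e.
- by rewrite /= opprK.
- exact: (F2 (- a.1, a.2)).
- have := DF (- a.1, a.2) (- x) Fa Dx; rewrite /= => h.
  by have -> : - (a.1 + (x - a.1) / a.2) = - a.1 + (- x - - a.1) / a.2 by ring.
- by have [x Dx xM] := Dunb (- M); exists (- x); rewrite /= ?opprK // ltrNr.
- by have [a Fa aM] := Funb (- M); exists (- a.1, a.2); rewrite /= ?opprK -?surjective_pairing // ltrNr.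
- by rewrite ltrN2.
- by [].
- by exists (- x) => //; rewrite -normrN opprD opprK.
Qed.

(** Let s be the supremum of the part of [A] below b. Near s + eps/4 there is no point of [A], which
    would exceed s, and no point of [B], which would be too close to points of [A] near s. *)
Lemma no_dense_gap (A B : set R) (a b eps : R) : A a -> B b -> a < b -> 0 < eps ->
  (forall x y, A x -> B y -> eps <= `|x - y|) ->
  (forall y e, a < y -> y < b -> 0 < e -> exists2 x, A x \/ B x & `|x - y| < e) -> False.
Proof.
move=> Aa Bb ab e0 gap dense.
pose E := [set x | A x /\ x <= b].
have Eub : has_sup E by split; [exists a; split => //; exact: ltW|exists b => x []].
pose s := sup E.
have sE x : E x -> x <= s by move=> Ex; apply: ub_le_sup => //; case: Eub.
have e8 : 0 < eps / 8 by rewrite divr_gt0.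
have [x [Ax xb] sx] := sup_adherent e8 Eub; rewrite -/s in sx.
have as_ : a <= s by apply: sE; split => //; exact: ltW.
have xs : x <= s by exact: sE.
have xb' : x + eps <= b.
  have := gap x b Ax Bb; rewrite ler0_norm; last by lra.
  lra.
have h1 : a < s + eps / 4 by lra.
have h2 : s + eps / 4 < b by lra.
have [y AB] := dense _ _ h1 h2 e8; rewrite ltr_norml => /andP[y1 y2].
case: AB => [Ay|By].
  have : E y by split => //; lra.
  by move/sE; lra.
by have := gap x y Ax By; rewrite ler0_norm; lra.
Qed.

End AffineDensity.

(** * Fixed points of the affine maps and capacities *)

Section PsiFacts.
Variable R : realType.
Local Notation C := (complex R).
Implicit Types (g u k : {poly C}).

Lemma deg_ge2 g : (2 < size g)%N -> 2 <= (deg g)%:R :> R.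
Proof. by move=> g2; rewrite (ler_nat R 2) /deg -ltnS prednK // (leq_trans _ g2). Qed.

Lemma PsiE g (x : R) : (Psi g).[x] = (deg g)%:R * x + lnlead g.
Proof. by rewrite /Psi hornerD hornerZ hornerX hornerC. Qed.

Lemma Psi_deriv g : (Psi g)^`() = ((deg g)%:R : R)%:P.
Proof. by rewrite /Psi derivD derivZ derivX derivC addr0 alg_polyC. Qed.

Lemma Psi_fix g (x : R) : (2 < size g)%N -> (Psi g).[x] = x <-> x = xfix g.
Proof.
move=> g2; have d2 := deg_ge2 g2; have d0 : (deg g)%:R - 1 != 0 :> R by rewrite gt_eqF //; lra.
rewrite PsiE /xfix; split => [h|->]; last by field.
by apply: (mulIf d0); rewrite mulfVK //; lra.
Qed.

Lemma Psi_comp g k : (1 < size g)%N -> (1 < size k)%N -> Psi (g \Po k) = Psi g \Po Psi k.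
Proof.
move=> g1 k1; rewrite /Psi comp_polyD comp_polyZ comp_polyX comp_polyC.
rewrite -[(size (g \Po k)).-1]/(deg (g \Po k)) -[ln _ in LHS]/(lnlead (g \Po k)).
rewrite deg_comp lnlead_comp // natrM scalerDr scalerA -addrA; congr (_ + _).
by rewrite -mul_polyC -polyCM -polyCD addrC.
Qed.

Lemma repelling_PsiS (G : set {poly C}) : (forall g, G g -> (2 < size g)%N) ->
  repelling_fixed_points (PsiS G) = [set xfix g | g in G].
Proof.
move=> G2; apply/seteqP; split => [x [_ [[g Gg <-] fx _]]|_ [g Gg <-]].
  by exists g => //; apply/esym/Psi_fix => //; exact: G2.
exists (Psi g); split; first by exists g.
  by apply/Psi_fix => //; exact: G2.
rewrite Psi_deriv hornerC ger0_norm //; have := deg_ge2 (G2 g Gg); lra.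
Qed.

Variable h : {poly C}.
Hypothesis h2 : (2 < size h)%N.

(** The right-hand side is the inverse of Psi(g), written as a contraction about its fixed point:
    the set of capacities is invariant under these inverses. *)
Lemma xx_comp u g : (2 < size u)%N -> (2 < size g)%N ->
  xx h (u \Po g) = xfix g + (xx h u - xfix g) / (deg g)%:R.
Proof.
move=> u2 g2; rewrite /xx lnlead_comp ?(ltn_trans _ u2) ?(ltn_trans _ g2) // deg_comp natrM.
have := deg_ge2 u2; have := deg_ge2 g2; rewrite /xfix => hg hu.
have g1 : (deg g)%:R - 1 != 0 :> R by rewrite gt_eqF //; lra.
have u0 : (deg u)%:R != 0 :> R by rewrite gt_eqF //; lra.
have g0 : (deg g)%:R != 0 :> R by rewrite gt_eqF //; lra.
have hh := deg_ge2 h2.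
have h1 : (deg h)%:R - 1 != 0 :> R by rewrite gt_eqF //; lra.
by field; rewrite u0 g0 g1 h1.
Qed.

Lemma xx_conv u : (2 < size u)%N -> xx h u = xfix u + (xfix h - xfix u) / (deg u)%:R.
Proof.
move=> u2; rewrite /xx; have hu := deg_ge2 u2.
have g1 : (deg u)%:R - 1 != 0 :> R by rewrite gt_eqF //; lra.
have u0 : (deg u)%:R != 0 :> R by rewrite gt_eqF //; lra.
have -> : lnlead u = - (((deg u)%:R - 1) * xfix u).
  by rewrite /xfix mulrC mulfVK // opprK.
by field.
Qed.

Lemma xfix_itp n u : (2 < size u)%N ->
  xfix (itp h n u) - xx h u = (xx h u - xfix h) / ((deg h ^ n * deg u)%:R - 1).
Proof.
move=> u2; have u1 := ltn_trans (ltnSn 1) u2.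
have hu := deg_ge2 u2; have hh := deg_ge2 h2.
rewrite /xfix -/(xfix h) deg_itp.
have /eqP := lnlead_itp h2 n u1; rewrite subr_eq => /eqP ->.
rewrite /xx natrM; set D := (deg h ^ n)%:R; set m := (deg u)%:R in hu *.
have D1 : 1 <= D :> R by rewrite ler1n expn_gt0 deg_gt0 // (ltn_trans _ h2).
have Dm : D * m - 1 != 0 by rewrite gt_eqF //; nra.
have m0 : m != 0 by rewrite gt_eqF //; lra.
by field; rewrite m0 Dm.
Qed.

Lemma nat_large (M : R) q : (1 < q)%N -> exists n, M < (q ^ n)%:R.
Proof.
move=> q1; have [|n nP] := @exprn_unbounded R q%:R M; first by rewrite ltr1n.
by exists n; rewrite natrX.
Qed.

(** The fixed points of Psi(h^n o u) converge to [xx h u]. With [xfix_by_xx], capacities and fixed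
    points have the same closure. *)
Lemma xx_by_xfix (G : set {poly C}) u (e : R) :
  (forall g k, G g -> G k -> G (g \Po k)) -> G h -> G u -> (2 < size u)%N -> 0 < e ->
  exists2 g, G g & `|xfix g - xx h u| < e.
Proof.
move=> Gc Gh Gu u2 e0; have hu := deg_ge2 u2.
have dh : (1 < deg h)%N by rewrite /deg -ltnS prednK // (leq_trans _ h2).
have [n nM] := nat_large (`|xx h u - xfix h| / e) dh.
exists (itp h n u); first by elim: n {nM} => //= n IH; exact: Gc.
rewrite xfix_itp // natrM; set D := (deg h ^ n)%:R in nM *; set m := (deg u)%:R in hu *.
have D1 : 1 <= D :> R by rewrite ler1n expn_gt0 deg_gt0 // (ltn_trans _ h2).
have Dm : 0 < D * m - 1 by nra.
rewrite normrM [X in _ * X]gtr0_norm ?invr_gt0 // ltr_pdivrMr //.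
move: nM; rewrite ltr_pdivrMr // => /lt_le_trans; apply.
by rewrite [e * _]mulrC ler_wpM2r ?(ltW e0) //; nra.
Qed.

(** Pulling [xx h g] back by the powers of Psi(g) contracts it to the fixed point. *)
Lemma xfix_by_xx (G : set {poly C}) g (e : R) :
  (forall g k, G g -> G k -> G (g \Po k)) -> (forall k, G k -> (2 < size k)%N) ->
  G g -> 0 < e -> exists2 u, G u & `|xx h u - xfix g| < e.
Proof.
move=> Gc G2 Gg e0; have g2 := G2 g Gg; have hg := deg_ge2 g2.
pose gk := fix gk n := if n is n'.+1 then gk n' \Po g else g.
have Ggk n : G (gk n) by elim: n => //= n IH; exact: Gc.
have E n : xx h (gk n) - xfix g = (xx h g - xfix g) / (deg g ^ n)%:R.
  elim: n => [|n IH] /=; first by rewrite divr1.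
  rewrite xx_comp ?G2 // addrC addKr IH expnS natrM.
  by rewrite invfM mulrA mulrAC.
have dg : (1 < deg g)%N by rewrite /deg -ltnS prednK // (leq_trans _ g2).
have [n nM] := nat_large (`|xx h g - xfix g| / e) dg.
exists (gk n); first exact: Ggk.
have D0 : 0 < (deg g ^ n)%:R :> R by rewrite ltr0n expn_gt0 (ltn_trans _ dg).
rewrite E normrM [X in _ * X]gtr0_norm ?invr_gt0 // ltr_pdivrMr //.
by rewrite mulrC -ltr_pdivrMr.
Qed.

End PsiFacts.

(** * Splittings of the Julia set *)

Section QuasiComponents.
Variables (R : realType) (T : ptopologicalType).
Hypothesis hT : hausdorff_space T.
Hypothesis cT : compact [set: T].

Definition splits (J A B : set T) :=
  [/\ closed A, closed B, A `|` B = J & A `&` B = set0].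

Lemma splitsC J A B : splits J A B -> splits J B A.
Proof. by case=> a b c d; split; rewrite 1?setUC 1?setIC. Qed.

Lemma splits_nin J A B x : splits J A B -> A x -> B x -> False.
Proof. by case=> _ _ _ AB Ax Bx; rewrite -[False]/(set0 x) -AB. Qed.

(* In a compact Hausdorff space the intersection of the relatively clopen sets
   around a point is connected, hence lies in its component. *)
Lemma quasi_component J x y : closed J -> J x -> J y -> ~ connected_component J x y ->
  exists A B, [/\ splits J A B, A x & B y].
Proof.
move=> cJ Jx Jy nxy; apply: contrapT => nsplit; apply: nxy.
pose clop (A : set T) := A x /\ exists B, splits J A B.
pose Q := \bigcap_(A in clop) A.
have cJ0 : clop J.
  by split => //; exists set0; split; rewrite ?setU0 ?setI0 //; exact: closed0.
have clopI A A' : clop A -> clop A' -> clop (A `&` A').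
  move=> [Ax [B [cA cB AB dAB]]] [A'x [B' [cA' cB' AB' dAB']]]; split=> //; exists (B `|` B').
  have AJ : A `<=` J by rewrite -AB.
  have BJ : B `<=` J by rewrite -AB.
  have BJ' : B' `<=` J by rewrite -AB'.
  split; [exact: closedI|exact: closedU| |].
    apply/seteqP; split=> [z [[Az A'z]|[Bz|Bz]]|z Jz]; [exact: AJ|exact: BJ|exact: BJ'|].
    have : (A `|` B) z by rewrite AB.
    have : (A' `|` B') z by rewrite AB'.
    by move=> [?|?] [?|?]; [left|right; left|right; right|right; left].
  rewrite -subset0 => z [[Az A'z] [Bz|Bz]]; first by rewrite -dAB.
  by rewrite -dAB'.
have Qx : Q x by move=> A [].
have Qy : Q y.
  move=> A [Ax [B sAB]]; apply: contrapT => nAy; apply: nsplit; exists A, B; split=> //.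
  by case: sAB => _ _ AB _; move: Jy; rewrite -AB => -[].
have cQ : closed Q by apply: closed_bigI => A [_ [B []]].
have QJ : Q `<=` J by move=> z; apply.
exists Q => //; split=> //; apply: connected_sep_closed => // U V cU cV UV0 [u Uu] [v Vv] QUV.
wlog Ux : U V cU cV UV0 u Uu v Vv QUV / U x.
  move=> W; have := Qx; rewrite {1}QUV => -[Ux|Vx]; first exact: (W U V cU cV _ u _ v).
  by apply: (W V U cV cU _ v _ u) => //; rewrite 1?setIC // setUC.
have /(@normal_openP R) nT := compact_normal hT cT.
have [U' [V' [oU oV UU' VV' UV']]] := nT U V cU cV UV0.
(* Otherwise the sets A minus U' and V' form a filter base of closed sets, and a cluster point of it
   lies in [Q] but outside U' and V'. *)
have [A [cA AUV]] : exists A, clop A /\ A `<=` U' `|` V'.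
  apply: contrapT => nA.
  pose F := filter_from clop (fun A => A `\` (U' `|` V')).
  have fF : ProperFilter F.
    apply: filter_from_proper; first apply: filter_from_filter.
    - by exists J.
    - move=> A A' cA cA'; exists (A `&` A'); first exact: clopI.
      by move=> z [[Az A'z] nz]; split; split.
    - move=> A cA; apply: contrapT => A0; apply: nA; exists A; split=> // z Az.
      by apply: contrapT => nz; apply: A0; exists z.
  have [z [_ cz]] := cT fF (@filterT _ F _).
  have zc A : clop A -> closure (A `\` (U' `|` V')) z.
    move=> cA B Bz; apply: (cz _ B) => //; by exists A.
  have cl A : clop A -> closed (A `\` (U' `|` V')).
    move=> [_ [B [cA _ _ _]]]; apply: closedI => //.
    exact/open_closedC/openU.
  have Qz : Q z.
    move=> A cA; suff [] : (A `\` (U' `|` V')) z by [].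
    by have := zc A cA; rewrite -(closure_id _).1 //; exact: cl.
  have [_ []] : (J `\` (U' `|` V')) z by have := zc J cJ0; rewrite -(closure_id _).1 //; exact: cl.
  by move: Qz; rewrite QUV => -[/UU'|/VV']; [left|right].
have [Ax [B [clA clB AB AB0]]] := cA.
(* Inside [A], removing V' is the same as keeping U', so this part is again open and closed in [J];
   it contains x and misses v. *)
have sU : splits J (A `&` ~` V') (B `|` A `&` ~` U').
  split.
  - by apply: closedI => //; exact: open_closedC.
  - by apply: closedU => //; apply: closedI => //; exact: open_closedC.
  - rewrite -AB; apply/seteqP; split=> [z [[]|[|[]]]|z [Az|Bz]]; [by left|by right|by left| |by right; left].
    have [Vz|nVz] := pselect (V' z); last by left.
    right; right; split=> // Uz; by rewrite -[False]/(set0 z) -UV'.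
  - rewrite -subset0 => z [[Az nVz] [Bz|[_ nUz]]]; first by rewrite -AB0.
    by case: (AUV z Az).
have /(_ (A `&` ~` V')) : forall A, clop A -> A v by move: (Vv) => Vv'; have Qv : Q v by rewrite QUV; right.
case.
  split; last by eexists; exact: sU.
  split=> // Vx; suff : set0 x by []. rewrite -UV'; split=> //; exact: UU'.
by move=> _; apply; exact: VV'.
Qed.

End QuasiComponents.

Section SphereTopology.
Variable R : realType.
Local Notation C := (complex R).
Local Notation T := (cplane R).
Local Notation S := (rsphere R).

Lemma chordal_eq0 (p q : S) : chordal p q = 0 -> p = q.
Proof.
case: p q => [z|] [w|] //; rewrite /chordal -?/(qn _) => /eqP; rewrite mulf_eq0 ?mulf_eq0 invr_eq0.
- rewrite pnatr_eq0 /= (gt_eqF (mulr_gt0 (qn_gt0 z) (qn_gt0 w))) orbF => /eqP zw.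
  by have /eqP := zw; rewrite nc_eq0 subr_eq0 => /eqP ->.
- by rewrite pnatr_eq0 (gt_eqF (qn_gt0 z)).
- by rewrite pnatr_eq0 (gt_eqF (qn_gt0 w)).
Qed.

Lemma chordal_ge0 (p q : S) : 0 <= chordal p q.
Proof.
have := chordal_triangle p p q; rewrite chordal_refl (chordalC q p).
by rewrite -mulr2n pmulrn_lge0.
Qed.

Lemma sphere_hausdorff : hausdorff_space S.
Proof.
move=> p q pq; apply: chordal_eq0; apply/eqP; rewrite eq_le chordal_ge0 andbT.
apply/ler_addgt0Pl => e e0; rewrite addr0.
have e2 : 0 < e / 2 by rewrite divr_gt0.
have [s [ps qs]] := pq _ _ (nbhs_chordal p e2) (nbhs_chordal q e2).
have := chordal_triangle p q s; rewrite (chordalC p s).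
by move: ps qs => /= ps qs; lra.
Qed.

Lemma some_cont : continuous (Some : T -> S).
Proof. by move=> z A; rewrite nbhs_simpl => /nbhs_someP[e e0 eA]; apply/nbhs_disc; exists e. Qed.

Lemma open_some (U : set T) : open U -> open [set (Some z : S) | z in U].
Proof.
move=> oU; rewrite openE => _ [z Uz <-]; apply/nbhs_someP.
have /nbhs_disc[e e0 eU] := open_nbhs_nbhs (conj oU Uz).
by exists e => // w wz; exists w => //; exact: eU.
Qed.

Lemma closed_some (K : set T) : compact K -> closed [set (Some z : S) | z in K].
Proof.
move=> cK; apply: compact_closed; first exact: sphere_hausdorff.
by apply: continuous_compact => //; exact/continuous_subspaceT/some_cont.
Qed.

Lemma closed_finite_part (A : set S) : closed A -> closed (finite_part A).
Proof. by move=> cA; apply: (@closed_comp _ _ (Some : T -> S)) => // z _; exact: some_cont. Qed.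

Lemma compact_finite_part (A : set S) : closed A -> ~ A None ->
  exists2 b : R, 0 < b & compact (finite_part A) /\ forall z, A (Some z) -> nc z <= b.
Proof.
move=> cA nA; have nN : nbhs (None : S) (~` A).
  by apply: open_nbhs_nbhs; split => //; exact: closed_openC.
have [b b0 [_ bA]] := nbhs_inftyP nN.
have Ab z : A (Some z) -> nc z <= b.
  by move=> Az; rewrite leNgt; apply/negP => /bA.
exists b => //; split => //; apply: (closed_bounded_compact (b := b)) => //.
exact: closed_finite_part.
Qed.

End SphereTopology.

(** The bound in [bounded_set] is an element of the scalar field [complex R]; comparing moduli with
    it amounts to comparing with its real part. *)
Lemma bounded_set_nc (R : realType) (W : set (cplane R)) : bounded_set W ->
  exists2 b : R, 0 < b & forall z, W z -> nc z <= b.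
Proof.
move=> [M [Mr MP]].
have M1 : M < M + 1 by rewrite ltrDl.
exists (`|complex.Re M| + 1) => [|z Wz]; first by rewrite ltr_wpDl.
have := MP _ M1 z Wz; rewrite /=.
case: M {Mr MP M1} => a b; rewrite [`|z|]normcE'.
move=> H; have : (nc z)%:C%C <= Complex (a + 1) (b + 0) by exact: H.
by rewrite lecE /= => /andP[_ le]; apply: le_trans le _; rewrite lerD2r ler_norm.
Qed.

(** * From components of the Julia set to components of M(Psi(G)) *)

Section JuliaSplitting.
Variable R : realType.
Local Notation C := (complex R).
Local Notation T := (cplane R).
Local Notation S := (rsphere R).
Variable G : set {poly C}.
Hypothesis Gc : forall g k, G g -> G k -> G (g \Po k).
Hypothesis G2 : forall g, G g -> (2 < size g)%N.
Variable R0 : R.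
Hypothesis crit : forall g c, G g -> root g^`() c -> nc g.[c] <= R0.
Variable h : {poly C}.
Hypothesis Gh : G h.
Variable r : R.
Hypothesis hr : escape_radius h r.
Hypothesis rR0 : R0 < r.

Let h2 : (2 < size h)%N. Proof. exact: G2. Qed.
Let G1 g : G g -> (1 < size g)%N. Proof. by move/G2; exact: ltn_trans. Qed.

Local Notation Xs := (Xs h r).
Local Notation Es := (Es h r).
Local Notation xx := (xx h).
Local Notation J := (Julia G).

Definition side (A : set S) u := G u /\ forall z, Es u z -> A (Some z).

Lemma split_side A B u : splits J A B -> G u -> side A u \/ side B u.
Proof.
move=> [cA cB AB AB0] Gu.
have [z0 Ez0] := Es_nonempty Gc G2 crit Gh rR0 Gu.
pose E : set S := [set Some z | z in Es u].
have cE : connected E.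
  apply: (@connected_continuous_connected T S).
    exact: (Es_connected Gc G2 crit Gh hr rR0 Gu).
  exact/continuous_subspaceT/some_cont.
have EAB : E `<=` A `|` B.
  by move=> _ [z Ez <-]; rewrite AB; exact: (Es_Julia Gc Gh hr Gu Ez).
have E0 : E (Some z0) by exists z0.
have [Az|Bz] := EAB _ E0; [left|right]; split => // z Ez.
  apply: (connected_sub_closed cE cA cB EAB _ E0 Az); last by exists z.
  by rewrite -setIA AB0 setI0.
apply: (connected_sub_closed cE cB cA _ _ E0 Bz); last by exists z.
  by rewrite setUC.
by rewrite -setIA (setIC B) AB0 setI0.
Qed.

Lemma Es_near (p : S) V : J p -> nbhs p V -> exists u z, [/\ G u, Es u z & V (Some z)].
Proof.
rewrite (Julia_closure Gc G2 Gh hr) => Jp /Jp[_ [[u [z [Gu Ez ->]]] Vz]].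
by exists u, z.
Qed.

Lemma side_near A B p V : splits J A B -> A p -> nbhs p V ->
  exists u z, [/\ side A u, Es u z & V (Some z)].
Proof.
move=> sJ Ap nV; have [cA cB AB AB0] := sJ.
have nB : nbhs p (~` B).
  apply: open_nbhs_nbhs; split; first exact: closed_openC.
  by move=> Bp; exact: (splits_nin sJ Ap Bp).
have Jp : J p by rewrite -AB; left.
have [u [z [Gu Ez [Vz nBz]]]] := Es_near Jp (filterI nV nB).
exists u, z; split => //; have [//|[_ Bs]] := split_side sJ Gu.
by case: nBz; exact: Bs.
Qed.

Lemma side_disj A B v w : splits J A B -> side A v -> side B w -> Es v `&` Es w = set0.
Proof.
move=> sJ [_ Av] [_ Bw]; rewrite -subset0 => z [/Av Az /Bw Bz].
exact: (splits_nin sJ Az Bz).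
Qed.

Lemma sides_nested A B v w : splits J A B -> side A v -> side B w ->
  Xs v `<=` Xs w \/ Xs w `<=` Xs v.
Proof.
move=> sJ Av Bw; have [Gv Gw] := (Av.1, Bw.1).
have [p0 p0P] := common_point Gc G2 crit Gh rR0.
apply: (nested h2 hr (G1 Gv) (G1 Gw) _ _ (p0P _ Gv) (p0P _ Gw)).
- exact: (Xs_connected Gc G2 crit Gh hr rR0 Gv).
- exact: (Es_connected Gc G2 crit Gh hr rR0 Gw).
- exact: side_disj sJ Av Bw.
Qed.

Lemma xx_le v w : G v -> G w -> Xs v `<=` Xs w -> xx v <= xx w.
Proof.
move=> Gv Gw vw; rewrite -[leLHS]addr0 -(ln1 R).
by apply: (xx_mono h2 hr (G1 Gv) (G1 Gw) ltr01) => z /vw; rewrite mul1r.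
Qed.

(** Either [Xs v] is the inner set, with boundary in the bounded side [A], or [Xs w] is inner and
    lies in [Xs v]. Both ways the inner set is in the disc of radius b, the only size that [xx_gap]
    asks for. Since infinity is on at most one side, [sides_gap] follows by symmetry. *)
Lemma sides_gap_bounded A B : splits J A B -> ~ A None -> exists2 eps : R, 0 < eps &
  forall v w, side A v -> side B w -> eps <= `|xx v - xx w|.
Proof.
move=> sJ nA; have [cA cB AB AB0] := sJ.
have [b b0 [cK Kb]] := compact_finite_part cA nA.
have [|d d0 dP] := compact_closed_gap cK (closed_finite_part cB).
  by rewrite -subset0 => z [Az Bz]; exact: (splits_nin sJ Az Bz).
have eps0 : 0 < ln (1 + d / (2 * b)) by rewrite ln_gt0 // ltrDl divr_gt0 // mulr_gt0.
exists (ln (1 + d / (2 * b))) => // v w Av Bw; have [[Gv Av'] [Gw Bw']] := (Av, Bw).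
have Xvb : Xs v `<=` cdisc 0 b.
  by apply: (Xs_in_disc G2 b0 Gv) => z /Av' /Kb.
have vb z : Xs v z -> nc z <= b by move=> /Xvb; rewrite /cdisc /= subr0.
have [vw|wv] := sides_nested sJ Av Bw.
  have gap a c : Es v a -> Es w c -> d <= nc (a - c) by move=> /Av' Aa /Bw' Bc; exact: dP.
  have H := xx_gap h2 hr (G1 Gv) (G1 Gw) b0 d0 vb vw gap.
  by rewrite distrC; apply: le_trans (ler_norm _); lra.
have wb z : Xs w z -> nc z <= b by move=> /wv; exact: vb.
have gap a c : Es w a -> Es v c -> d <= nc (a - c).
  by move=> /Bw' Ba /Av' Ac; rewrite ncBC; exact: dP.
have H := xx_gap h2 hr (G1 Gw) (G1 Gv) b0 d0 wb wv gap.
by apply: le_trans (ler_norm _); lra.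
Qed.

Lemma sides_gap A B : splits J A B -> exists2 eps : R, 0 < eps &
  forall v w, side A v -> side B w -> eps <= `|xx v - xx w|.
Proof.
move=> sJ; have [An|nA] := pselect (A None); last exact: sides_gap_bounded.
have [||eps eps0 H] := @sides_gap_bounded B A; first exact: splitsC.
  by move=> Bn; exact: (splits_nin sJ An Bn).
by exists eps => // v w Av Bw; rewrite distrC; exact: H.
Qed.

Let q (g : {poly C}) : R := (deg g)%:R.

Lemma xx_le_max u (M : R) : G u -> (forall g, G g -> xfix g <= M) -> xx u <= M.
Proof.
move=> Gu H; rewrite xx_conv ?G2 //; have := deg_ge2 (G2 Gu); rewrite -/(q u) => q2.
have [hu hh] := (H u Gu, H h Gh).
have -> : xfix u + (xfix h - xfix u) / q u = xfix u * (1 - (q u)^-1) + xfix h * (q u)^-1 by ring.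
have i0 : 0 < (q u)^-1 by rewrite invr_gt0; lra.
have i1 : (q u)^-1 <= 1 by rewrite invf_le1; lra.
nra.
Qed.

Lemma xx_ge_min u (M : R) : G u -> (forall g, G g -> M <= xfix g) -> M <= xx u.
Proof.
move=> Gu H; rewrite xx_conv ?G2 //; have := deg_ge2 (G2 Gu); rewrite -/(q u) => q2.
have [hu hh] := (H u Gu, H h Gh).
have -> : xfix u + (xfix h - xfix u) / q u = xfix u * (1 - (q u)^-1) + xfix h * (q u)^-1 by ring.
have i0 : 0 < (q u)^-1 by rewrite invr_gt0; lra.
have i1 : (q u)^-1 <= 1 by rewrite invf_le1; lra.
nra.
Qed.

Lemma xx_between u : G u -> Num.min (xfix u) (xfix h) <= xx u <= Num.max (xfix u) (xfix h).
Proof.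
move=> Gu; rewrite xx_conv ?G2 //; have := deg_ge2 (G2 Gu); rewrite -/(q u) => q2.
have -> : xfix u + (xfix h - xfix u) / q u = xfix u * (1 - (q u)^-1) + xfix h * (q u)^-1 by ring.
have i0 : 0 < (q u)^-1 by rewrite invr_gt0; lra.
have i1 : (q u)^-1 <= 1 by rewrite invf_le1; lra.
by apply/andP; split; rewrite ?ge_min ?le_max; case: (leP (xfix u) (xfix h)) => k; nra.
Qed.

Definition caps : set R := [set xx u | u in G].
Let F : set (R * R) := [set (xfix g, q g) | g in G].

Let F2 a : F a -> 2 <= a.2.
Proof. by case=> g Gg <-; exact/deg_ge2/G2. Qed.

Let FD a x : F a -> caps x -> caps (a.1 + (x - a.1) / a.2).
Proof.
case=> g Gg <- [u Gu <-]; exists (u \Po g); first exact: Gc.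
by rewrite xx_comp ?G2.
Qed.

Lemma xfix_min3 u v w : G u -> G v -> G w ->
  exists g, [/\ G g, xfix g <= xfix u, xfix g <= xfix v & xfix g <= xfix w].
Proof.
move=> Gu Gv Gw; case: (leP (xfix u) (xfix v)) => uv.
  by case: (leP (xfix u) (xfix w)) => uw; [exists u|exists w]; split => //; lra.
by case: (leP (xfix v) (xfix w)) => uw; [exists v|exists w]; split => //; lra.
Qed.

Lemma xfix_max3 u v w : G u -> G v -> G w ->
  exists g, [/\ G g, xfix u <= xfix g, xfix v <= xfix g & xfix w <= xfix g].
Proof.
move=> Gu Gv Gw; case: (leP (xfix u) (xfix v)) => uv.
  by case: (leP (xfix v) (xfix w)) => uw; [exists w|exists v]; split => //; lra.
by case: (leP (xfix u) (xfix w)) => uw; [exists w|exists u]; split => //; lra.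
Qed.

Lemma caps_not_dense A B p1 p2 : splits J A B -> A p1 -> B p2 ->
  exists v w, [/\ G v, G w & ~ forall y e, Num.min (xx v) (xx w) < y ->
    y < Num.max (xx v) (xx w) -> 0 < e -> exists2 x, caps x & `|x - y| < e].
Proof.
move=> sJ Ap Bp; have [v [_ [Av _ _]]] := side_near sJ Ap filterT.
have [w [_ [Bw _ _]]] := side_near (splitsC sJ) Bp filterT.
exists v, w; split; [exact: Av.1|exact: Bw.1|move=> dense].
have [eps eps0 gap] := sides_gap sJ.
have vw := gap v w Av Bw.
pose DA := [set xx u | u in side A]; pose DB := [set xx u | u in side B].
have gAB x y : DA x -> DB y -> eps <= `|x - y|.
  by move=> [a Aa <-] [b Bb <-]; exact: gap.
have DAv : DA (xx v) by exists v.
have DBw : DB (xx w) by exists w.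
have capsAB x : caps x -> DA x \/ DB x.
  by move=> [u /(split_side sJ)[su|su] <-]; [left|right]; exists u.
have [lt|gt|eq] := ltgtP (xx v) (xx w); last by move: vw; rewrite eq subrr normr0; lra.
  apply: (no_dense_gap DAv DBw lt eps0 gAB) => y e y1 y2 e0.
  have [||//|x cx xy] := dense y e; rewrite ?gt_min ?lt_max ?y1 ?y2 ?orbT //.
  by exists x => //; exact: capsAB.
have gBA x y : DB x -> DA y -> eps <= `|x - y| by move=> a b; rewrite distrC; exact: gAB.
apply: (no_dense_gap DBw DAv gt eps0 gBA) => y e y1 y2 e0.
have [||//|x cx xy] := dense y e; rewrite ?gt_min ?lt_max ?y1 ?y2 ?orbT //.
by exists x => //; have [] := capsAB x cx; [right|left].
Qed.

Lemma caps_bounded A B p1 p2 : splits J A B -> A p1 -> B p2 ->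
  exists b : R, forall u, G u -> `|xx u| <= b.
Proof.
move=> sJ Ap Bp; have [v [w [Gv Gw nd]]] := caps_not_dense sJ Ap Bp.
have [/andP[v1 v2] /andP[w1 w2]] := (xx_between Gv, xx_between Gw).
have [b1 b1P] : exists b : R, forall u, G u -> xx u <= b.
  apply: contrapT => /forallNP unb; apply: nd => y e y1 y2 e0.
  (* Density holds above [xfix g], and has to cover the interval between [xx v] and [xx w]. By
     [xx_between] these are bounded below by fixed points of v, w and h, hence the minimum of
     three. *)
  have [g [Gg gv gw gh]] := xfix_min3 Gv Gw Gh.
  apply: (@affine_dense_above R caps F (xfix g) (q g)) => //.
  - by exists g.
  - move=> M; apply: contrapT => nM; apply: (unb M) => u Gu.
    by rewrite leNgt; apply/negP => Mu; apply: nM; exists (xx u) => //; exists u.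
  - move=> M; apply: contrapT => nM; apply: (unb M) => u Gu.
    apply: xx_le_max => // k Gk; rewrite leNgt; apply/negP => Mk; apply: nM.
    by exists (xfix k, q k) => //; exists k.
  - apply: le_lt_trans y1; rewrite le_min.
    rewrite (le_trans _ v1) ?le_min ?gv //= (le_trans _ w1) //.
    by rewrite le_min gw.
have [b2 b2P] : exists b : R, forall u, G u -> b <= xx u.
  apply: contrapT => /forallNP unb; apply: nd => y e y1 y2 e0.
  have [g [Gg gv gw gh]] := xfix_max3 Gv Gw Gh.
  apply: (@affine_dense_below R caps F (xfix g) (q g)) => //.
  - by exists g.
  - move=> M; apply: contrapT => nM; apply: (unb M) => u Gu.
    by rewrite leNgt; apply/negP => Mu; apply: nM; exists (xx u) => //; exists u.
  - move=> M; apply: contrapT => nM; apply: (unb M) => u Gu.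
    apply: xx_ge_min => // k Gk; rewrite leNgt; apply/negP => Mk; apply: nM.
    by exists (xfix k, q k) => //; exists k.
  - apply: lt_le_trans y2 _; rewrite ge_max.
    rewrite (le_trans v2) ?ge_max ?gv //= (le_trans w2) //.
    by rewrite ge_max gw.
exists (Num.max b1 (- b2)) => u Gu; rewrite ler_norml lerNl !le_max lerN2 b2P // b1P //.
by rewrite orbT.
Qed.

Lemma Mset_caps x : Mset (PsiS G) x%:E <->
  forall e : R, 0 < e -> exists2 u, G u & `|xx u - x| < e.
Proof.
rewrite /Mset repelling_PsiS //; split => [Mx e e0|H V nV].
  have e2 : 0 < e / 2 by rewrite divr_gt0.
  have [|_ [[_ [g Gg <-] <-] gx]] := Mx [set y : \bar R | exists2 t : R, y = t%:E & `|t - x| < e / 2].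
    apply/nbhs_EFin; exists (e / 2) => //= t xt; exists t => //.
    by rewrite distrC.
  have {}gx : `|xfix g - x| < e / 2 by case: gx => t [->].
  have [u Gu ug] := xfix_by_xx h2 Gc G2 Gg e2.
  exists u => //; rewrite -(subrK (xfix g) (xx u)) -addrA (le_lt_trans (ler_normD _ _)) //.
  lra.
have /nbhs_EFin[e /= e0 eV] := nV.
have e2 : 0 < e / 2 by rewrite divr_gt0.
have [u Gu ux] := H _ e2.
have [g Gg gu] := xx_by_xfix h2 Gc Gh Gu (G2 Gu) e2.
exists (xfix g)%:E; split; first by exists (xfix g) => //; exists g.
apply: eV => /=; rewrite distrC -(subrK (xx u) (xfix g)) -addrA (le_lt_trans (ler_normD _ _)) //.
lra.
Qed.

Lemma Mset_bounded (b : R) : (forall u, G u -> `|xx u| <= b) ->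
  forall y, Mset (PsiS G) y -> exists2 x, y = x%:E & `|x| <= b.
Proof.
move=> ub; pose I := [set y : \bar R | ((- b)%:E <= y)%E] `&` [set y | (y <= b%:E)%E].
have MI : Mset (PsiS G) `<=` I.
  apply: closure_closed_sub; first by apply: closedI; [exact: closed_ereal_le_ereal|exact: closed_ereal_ge_ereal].
  rewrite repelling_PsiS // => _ [_ [g Gg <-] <-].
  suff : `|xfix g| <= b by rewrite ler_norml /I /= !lee_fin => /andP[].
  apply/ler_addgt0Pr => e e0; have [u Gu ug] := xfix_by_xx h2 Gc G2 Gg e0.
  rewrite -(subrK (xx u) (xfix g)) (le_trans (ler_normD _ _)) //.
  have := ub u Gu; move: ug; rewrite distrC; lra.
move=> y /MI; rewrite /I /=; case: y => [x| |] [] //.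
by rewrite !lee_fin => h1' h2'; exists x => //; rewrite ler_norml h1' h2'.
Qed.

(** (p, m) is in the closure of the pairs made of a point of [Es u] and the number [xx u], for u in
    [G]. *)
Definition caps_at (p : S) (m : R) := forall V (e : R), nbhs p V -> 0 < e ->
  exists u z, [/\ G u, Es u z, V (Some z) & `|xx u - m| < e].

Lemma caps_at_exists (b : R) p : (forall u, G u -> `|xx u| <= b) -> J p ->
  exists m, caps_at p m.
Proof.
move=> ub Jp; pose B (V : set S) := [set x : R | exists u z, [/\ G u, Es u z, V (Some z) & xx u = x]].
have fF : ProperFilter (filter_from (nbhs p) B).
  apply: filter_from_proper; first apply: filter_from_filter.
  - by exists setT; exact: filterT.
  - move=> V V' nV nV'; exists (V `&` V'); first exact: filterI.
    by move=> _ [u [z [Gu Ez [Vz V'z] <-]]]; split; exists u, z.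
  - move=> V nV; have [u [z [Gu Ez Vz]]] := Es_near Jp nV.
    by exists (xx u), u, z.
have [|m [_ cm]] := @segment_compact R (- b) b _ fF.
  exists setT; first exact: filterT.
  by move=> _ [u [z [Gu _ _ <-]]] /=; rewrite in_itv /= -ler_norml ub.
exists m => V e nV e0.
have [||x [[u [z [Gu Ez Vz <-]]] mx]] := cm (B V) (ball m e).
- by exists V.
- exact: nbhsx_ballx.
by exists u, z; split => //; rewrite distrC.
Qed.

Lemma caps_at_Mset p m : caps_at p m -> Mset (PsiS G) m%:E.
Proof.
move=> cm; apply/Mset_caps => e e0.
by have [u [z [Gu _ _ um]]] := cm _ _ filterT e0; exists u.
Qed.

Lemma caps_at_side A B p m V (e : R) : splits J A B -> A p -> caps_at p m -> nbhs p V -> 0 < e ->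
  exists u z, [/\ side A u, Es u z, V (Some z) & `|xx u - m| < e].
Proof.
move=> sJ Ap cm nV e0; have [cA cB AB AB0] := sJ.
have nB : nbhs p (~` B).
  apply: open_nbhs_nbhs; split; first exact: closed_openC.
  by move=> Bp; exact: (splits_nin sJ Ap Bp).
have [u [z [Gu Ez [Vz nBz] um]]] := cm _ _ (filterI nV nB) e0.
exists u, z; split => //; have [//|[_ Bs]] := split_side sJ Gu.
by case: nBz; exact: Bs.
Qed.

Lemma ereal_connected_convex (K : set (\bar R)) (a b c : \bar R) : connected K ->
  K a -> K c -> (a <= b)%E -> (b <= c)%E -> K b.
Proof.
move=> cK Ka Kc ab bc; apply: contrapT => nKb.
have ltab : (a < b)%E by rewrite lt_neqAle ab andbT; apply/eqP => E; apply: nKb; rewrite -E.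
have : K `<=` [set y | (y < b)%E].
  apply: (connected_sub_open cK (@open_ereal_lt_ereal R b) (@open_ereal_gt_ereal R b) _ _ Ka ltab).
    move=> y Ky; have [ylt|ylt|E] := ltgtP y b; [by left|by right|].
    by case: nKb; rewrite -E.
  rewrite -subset0 => y [[_ /= h1'] /= h3]; have := lt_trans h1' h3.
  by rewrite ltxx.
by move=> /(_ c Kc) /=; rewrite ltNge bc.
Qed.

(** A common component would contain the whole interval between m and n; capacities would then be
    dense in it, while those of the two sides stay a fixed distance apart. *)
Lemma caps_at_split A B p q' m n : splits J A B -> A p -> B q' -> caps_at p m -> caps_at q' n ->
  ~ connected_component (Mset (PsiS G)) m%:E n%:E.
Proof.
wlog mn : A B p q' m n / m <= n.
  move=> W sJ Ap Bq cm cn; have [mn|/ltW nm] := leP m n; first exact: (W A B p q' m n mn).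
  by move/connected_component_sym; exact: (W B A q' p n m nm (splitsC sJ) Bq Ap cn cm).
move=> sJ Ap Bq cm cn [K [Km KM cK] Kn].
have KMx x : m <= x -> x <= n -> Mset (PsiS G) x%:E.
  by move=> mx xn; apply: KM; apply: (ereal_connected_convex cK Km Kn); rewrite lee_fin.
have [eps eps0 gap] := sides_gap sJ.
(* The numbers m and n are only limits of capacities, so the gap is carried over to the closures of
   both sides. *)
pose lim (A : set S) := [set x : R | forall e : R, 0 < e -> exists2 u, side A u & `|xx u - x| < e].
have lA : lim A m.
  by move=> e e0; have [u [z [Au _ _ um]]] := caps_at_side sJ Ap cm filterT e0; exists u.
have lB : lim B n.
  by move=> e e0; have [u [z [Au _ _ um]]] := caps_at_side (splitsC sJ) Bq cn filterT e0; exists u.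
have lgap x y : lim A x -> lim B y -> eps <= `|x - y|.
  move=> lx ly; apply/ler_addgt0Pr => e e0; have e2 : 0 < e / 2 by rewrite divr_gt0.
  have [[u Au ux] [w Bw wy]] := (lx _ e2, ly _ e2).
  have := gap u w Au Bw.
  have -> : xx u - xx w = (xx u - x) + (x - y) - (xx w - y) by ring.
  move=> H; have := ler_normB (xx u - x + (x - y)) (xx w - y).
  have := ler_normD (xx u - x) (x - y); lra.
have ltmn : m < n.
  rewrite lt_neqAle mn andbT; apply/eqP => E; have := lgap _ _ lA lB.
  by rewrite E subrr normr0; lra.
apply: (no_dense_gap lA lB ltmn eps0 lgap) => y e my yn e0.
have [u Gu uy] := (Mset_caps y).1 (KMx y (ltW my) (ltW yn)) e e0.
exists (xx u) => //; have [su|su] := split_side sJ Gu; [left|right] => e' e'0;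
  by exists u => //; rewrite subrr normr0.
Qed.

(** [K] lies on the side opposite to [Es v], so it cannot cross that boundary and stays in the
    interior of [Xs v]. *)
Lemma sub_interior A B (K : set S) v z2 : splits J A B -> side A v -> connected K ->
  K `<=` B -> K (Some z2) -> Xs v z2 -> finite_part K `&` closure (~` Xs v) = set0.
Proof.
move=> sJ [Gv Av] cK KB Kz2 Xz2.
pose U := [set (Some z : S) | z in ~` closure (~` Xs v)].
pose V : set S := ~` [set Some z | z in Xs v].
have oU : open U by apply: open_some; apply: closed_openC; exact: closed_closure.
have oV : open V by apply: closed_openC; apply: closed_some; exact: compact_Xs (G1 Gv).
have nE z : K (Some z) -> Xs v z -> ~ closure (~` Xs v) z.
  move=> Kz Xz cz; apply: (@splits_nin _ _ _ _ (Some z : S) sJ); last exact: KB.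
  by apply: Av; split => //; exact: subset_closure.
have KU : K `<=` U.
  apply: (connected_sub_open cK oU oV _ _ Kz2); last by exists z2 => //; exact: nE.
    move=> [z|] Kz; last by right => -[].
    have [Xz|nX] := pselect (Xs v z); first by left; exists z => //; exact: nE.
    by right => -[w Xw [wz]]; apply: nX; rewrite -wz.
  rewrite -subset0 => _ [[_ [z nz <-]]] nV; apply: nV; exists z => //.
  by apply: contrapT => nX; apply: nz; exact: subset_closure.
by rewrite -subset0 => z [/KU[w nw [wz]]]; rewrite wz in nw.
Qed.

(** Suppose m2 < m1. Take v on the side [A] with [Es v] close to z1 and [xx v] close to m1. Sets
    [Xs w] with boundary close to z2 have smaller capacity, so they lie inside [Xs v]; thus z2 is in
    [Xs v], and [K] in its interior. The closure of the complement of [Xs v] is then connected,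
    misses [K] and meets [W] near z1, so this unbounded set lies in the bounded [W]. *)
Lemma caps_order A B (K : set S) W z1 z2 m1 m2 : splits J A B -> A (Some z1) -> closed K ->
  connected K -> K `<=` B -> K (Some z2) -> components (~` finite_part K) W ->
  bounded_set W -> W z1 -> caps_at (Some z1) m1 -> caps_at (Some z2) m2 -> m1 <= m2.
Proof.
move=> sJ Az1 clK cK KB Kz2 [w0 nw0 WE] /bounded_set_nc[b b0 Wb] Wz1 cm1 cm2.
have {}WE : W = connected_component (~` finite_part K) z1.
  by rewrite -WE; apply: same_connected_component; rewrite WE.
rewrite leNgt; apply/negP => m21; pose c := (m1 - m2) / 2.
have c0 : 0 < c by rewrite divr_gt0 // subr_gt0.
have nKz1 : ~ finite_part K z1 by move/KB; exact: (splits_nin sJ Az1).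
have /nbhs_disc[d d0 dK] : nbhs z1 (~` finite_part K).
  by apply: open_nbhs_nbhs; split => //; apply: closed_openC; exact: closed_finite_part.
have nV : nbhs (Some z1 : S) [set (Some z : S) | z in disc z1 d].
  apply: open_nbhs_nbhs; split; first exact/open_some/open_disc.
  by exists z1 => //; exact: disc_center.
have [v [z [Av Ez [z' Dz [z'z]] vm1]]] := caps_at_side sJ Az1 cm1 nV c0.
rewrite z'z {z' z'z} in Dz.
have Gv := Av.1.
have Bz2 := KB _ Kz2.
(* [Xs v] is closed, so it suffices to approach z2 by points of boundaries [Es w] with [Xs w] inside
   [Xs v]. *)
have Xz2 : Xs v z2.
  rewrite (closure_id (Xs v)).1; last exact: closed_Xs.
  move=> V nVz2; have nV2 : nbhs (Some z2 : S) [set (Some z : S) | z in V].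
    by apply/nbhs_someP; have /nbhs_disc[e e0 eV] := nVz2; exists e => // w wz; exists w => //; exact: eV.
  have [w [y [Bw Ey [y' Vy [y'y]] wm2]]] := caps_at_side (splitsC sJ) Bz2 cm2 nV2 c0.
  rewrite y'y {y' y'y} in Vy; exists y; split => //.
  have Gw := Bw.1.
  have [vw|wv] := sides_nested sJ Av Bw.
    by have := xx_le Gv Gw vw; move: vm1 wm2; rewrite !ltr_norml /c => /andP[? _] /andP[_ ?]; lra.
  by apply: wv; case: Ey => + _; rewrite -(closure_id (Xs w)).1 //; exact: closed_Xs.
have dis := sub_interior sJ Av cK KB Kz2 Xz2.
have cY : connected (closure (~` Xs v)).
  by apply: connected_closure; exact: (XsC_connected h2 hr (G1 Gv)).
have [b' b'P] := Xs_bounded h r (G1 Gv).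
pose y : C := (Num.max b `|b'| + 1)%:C%C.
have ny : nc y = Num.max b `|b'| + 1 by rewrite nc_real ger0_norm // addr_ge0 // le_max normr_ge0 orbT.
have Yy : closure (~` Xs v) y.
  apply: subset_closure => /b'P; rewrite ny => le.
  have : `|b'| <= Num.max b `|b'| by rewrite le_max lexx orbT.
  by have := ler_norm b'; lra.
have DW : disc z1 d `<=` W.
  rewrite WE; apply: connected_component_max; [exact: disc_center|exact: dK|].
  exact: disc_connected.
have Wz := DW z Dz.
have YW : closure (~` Xs v) `<=` W.
  have -> : W = connected_component (~` finite_part K) z.
    by rewrite WE; apply: same_connected_component; rewrite -WE.
  apply: connected_component_max; [exact: Ez.2| |exact: cY].
  by move=> t Yt Kt; rewrite -[False]/(set0 t) -dis; split.
have := Wb _ (YW _ Yy); rewrite ny.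
have : b <= Num.max b `|b'| by rewrite le_max lexx.
lra.
Qed.

Lemma components_ltr (M : set (\bar R)) (a b : \bar R) : M a -> M b -> (a < b)%E ->
  ~ connected_component M a b ->
  ltr_sets (connected_component M a) (connected_component M b).
Proof.
move=> Ma Mb ab nab.
have Ca := connected_component_refl Ma; have Cb := connected_component_refl Mb.
have cC c : connected (connected_component M c) := @component_connected _ M c.
split; last by move=> E; apply: nab; rewrite E.
right => x y Cx Cy; rewrite ltNge; apply/negP => yx.
have [bx|xb] := leP b x.
  by apply: nab; exact: (ereal_connected_convex (cC a) Ca Cx (ltW ab) bx).
have Cbx := ereal_connected_convex (cC b) Cy Cb yx (ltW xb).
by apply: nab; exact: (connected_component_trans Cx (connected_component_sym Cbx)).
Qed.

Lemma disconnected_split : ~ connected J -> exists A B p1 p2, [/\ splits J A B, A p1 & B p2].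
Proof.
move=> nJ; apply: contrapT => H; apply: nJ.
have cJ : closed J by exact: closed_Julia.
apply: (@connected_sep_closed S J cJ) => U V cU cV UV0 [p Up] [q' Vq] E.
apply: H; exists U, V, p, q'; split; [split|exact: Up|exact: Vq].
- exact: cU.
- exact: cV.
- exact: esym E.
- exact: UV0.
Qed.

Lemma component_split p q' : J p -> J q' -> ~ connected_component J p q' ->
  exists A B, [/\ splits J A B, A p & B q'].
Proof.
apply: (quasi_component R); [exact: sphere_hausdorff|exact: one_point_compactification_compact|exact: closed_Julia].
Qed.

Definition order_embedding (tPsi : set S -> set (\bar R)) :=
  [/\ set_fun (Julia_components_hat G) (M_components (PsiS G)) tPsi,
      set_inj (Julia_components_hat G) tPsi
    & forall J1 J2 : set S,
        Julia_components G J1 -> Julia_components G J2 ->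
        surround_lt (finite_part J1) (finite_part J2) ->
        ltr_sets (tPsi J1) (tPsi J2)].

(** There is a single component, so a constant map is injective and no two components are strictly
    ordered. *)
Lemma order_embedding_connected : connected J -> exists tPsi, order_embedding tPsi.
Proof.
move=> cJ; have JE K : Julia_components_hat G K -> K = J.
  by move=> [p Jp <-]; exact: connected_component_id.
have Mh : Mset (PsiS G) (xfix h)%:E.
  rewrite /Mset repelling_PsiS //; apply: subset_closure; exists (xfix h) => //.
  by exists h.
exists (fun=> connected_component (Mset (PsiS G)) (xfix h)%:E); split.
- by move=> K _; exists (xfix h)%:E.
- by move=> K K' /set_mem/JE-> /set_mem/JE->.
- by move=> K K' [/JE-> _] [/JE-> _] [_].
Qed.

Lemma order_embedding_disconnected : ~ connected J -> exists tPsi, order_embedding tPsi.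
Proof.
move=> nJ; have [A0 [B0 [p1 [p2 [sJ0 Ap1 Bp2]]]]] := disconnected_split nJ.
have [b ub] := caps_bounded sJ0 Ap1 Bp2.
(* One limit is picked at every point of [J]; 0 is the default where there is none. *)
pose m p := xget 0 [set m : R | caps_at p m].
have mP p : J p -> caps_at p (m p).
  by move=> Jp; have [m0 m0P] := caps_at_exists ub Jp; exact: (xgetPex 0 (ex_intro _ _ m0P)).
pose pt (K : set S) := get K.
have ptP K : Julia_components_hat G K -> K (pt K).
  by move=> [p Jp <-]; apply: getPex; exists p; exact: connected_component_refl.
have KJ K : Julia_components_hat G K -> K `<=` J.
  by move=> [p Jp <-]; exact: connected_component_sub.
have KE K p : Julia_components_hat G K -> K p -> K = connected_component J p.
  by move=> [q' Jq <-]; exact: same_connected_component.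
have sep K K' : Julia_components_hat G K -> Julia_components_hat G K' -> K <> K' ->
    exists A B, [/\ splits J A B, K `<=` A & K' `<=` B].
  move=> hK hK' KK'; have [||c|A [B [sJ Ap Bp]]] := @component_split (pt K) (pt K').
  - exact: (KJ _ hK _ (ptP _ hK)).
  - exact: (KJ _ hK' _ (ptP _ hK')).
  - apply: KK'.
    by rewrite (KE _ _ hK (ptP _ hK)) (KE _ _ hK' (ptP _ hK')); exact: same_connected_component.
  have [cA cB AB AB0] := sJ; exists A, B; split => //.
    have cK : connected K by case: hK => p _ <-; exact: component_connected.
    apply: (connected_sub_closed cK cA cB _ _ (ptP _ hK) Ap); first by rewrite AB; exact: KJ.
    by rewrite -setIA AB0 setI0.
  have cK : connected K' by case: hK' => p _ <-; exact: component_connected.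
  apply: (connected_sub_closed cK cB cA _ _ (ptP _ hK') Bp); first by rewrite setUC AB; exact: KJ.
  by rewrite -setIA (setIC B) AB0 setI0.
have mPt K : Julia_components_hat G K -> caps_at (pt K) (m (pt K)).
  by move=> hK; apply: mP; exact: (KJ _ hK _ (ptP _ hK)).
have MP K : Julia_components_hat G K -> Mset (PsiS G) (m (pt K))%:E.
  by move=> hK; apply: (caps_at_Mset (p := pt K)); exact: mPt.
have nsep K K' : Julia_components_hat G K -> Julia_components_hat G K' -> K <> K' ->
    ~ connected_component (Mset (PsiS G)) (m (pt K))%:E (m (pt K'))%:E.
  move=> hK hK' KK'; have [A [B [sJ KA KB]]] := sep _ _ hK hK' KK'.
  apply: (caps_at_split sJ (KA _ (ptP _ hK)) (KB _ (ptP _ hK'))); exact: mPt.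
exists (fun K => connected_component (Mset (PsiS G)) (m (pt K))%:E); split.
- by move=> K hK; exists (m (pt K))%:E => //; exact: MP.
- move=> K K' /set_mem hK /set_mem hK' E; apply: contrapT => KK'.
  by apply: (nsep K K') => //; rewrite E; apply: connected_component_refl; exact: MP.
move=> K K' [hK nK] [hK' nK'] [[//|[W [cW bW KW]]] neq].
have KK' : K <> K' by move=> E; apply: neq; rewrite E.
have ns := nsep _ _ hK hK' KK'; have [A [B [sJ KA KB]]] := sep _ _ hK hK' KK'.
apply: components_ltr => //; try exact: MP.
rewrite lte_fin lt_neqAle; apply/andP; split.
  by apply/eqP => E; apply: ns; rewrite E; apply: connected_component_refl; exact: MP.
have clK : closed K' by case: hK' => p _ <-; apply: component_closed; exact: closed_Julia.
have cK : connected K' by case: hK' => p _ <-; exact: component_connected.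
case E : (pt K) (ptP _ hK) (mPt _ hK) => [z1|] Kz1 cm1; last by case: (nK Kz1).
case E' : (pt K') (ptP _ hK') (mPt _ hK') => [z2|] Kz2 cm2; last by case: (nK' Kz2).
exact: (caps_order sJ (KA _ Kz1) clK cK KB Kz2 cW bW (KW _ Kz1) cm1 cm2).
Qed.

Lemma order_embedding_exists : exists tPsi, order_embedding tPsi.
Proof.
have [|] := pselect (connected J); first exact: order_embedding_connected.
exact: order_embedding_disconnected.
Qed.

Lemma caps_bounded_disconnected : ~ connected J ->
  exists b : R, forall u, G u -> `|xx u| <= b.
Proof. by move=> /disconnected_split[A [B [p1 [p2 []]]]]; exact: caps_bounded. Qed.
End JuliaSplitting.

(** * The Julia set of the affine semigroup *)

Section EtaPsi.
Variable R : realType.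
Local Notation C := (complex R).
Local Notation T := (cplane R).
Local Notation S := (rsphere R).
Variable G : set {poly C}.
Hypothesis Gc : forall g k, G g -> G k -> G (g \Po k).
Hypothesis G2 : forall g, G g -> (2 < size g)%N.

Local Notation F := (etaS (PsiS G)).
Local Notation iota := (fun x : R => Some (real_complex R x) : S).

Implicit Types (g k : {poly C}) (w z : C).

Lemma eta_PsiE g z : (Defs.eta (Psi g)).[z] = (deg g)%:R * z + (lnlead g)%:C%C.
Proof.
rewrite /Defs.eta /Psi rmorphD /= map_polyZ map_polyX map_polyC /= hornerD hornerZ hornerX hornerC.
by rewrite rmorph_nat.
Qed.

Lemma eta_Psi_fix g w : (2 < size g)%N ->
  (Defs.eta (Psi g)).[(xfix g)%:C%C + w] = (xfix g)%:C%C + (deg g)%:R * w.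
Proof.
move=> g2; have := (Psi_fix (xfix g) g2).2 erefl; rewrite PsiE.
move/(congr1 (real_complex R)); rewrite rmorphD [X in X + _]rmorphM rmorph_nat => E.
by rewrite eta_PsiE -[in RHS]E mulrDr addrAC.
Qed.

Lemma eta_Psi_comp g k : (1 < size g)%N -> (1 < size k)%N ->
  Defs.eta (Psi (g \Po k)) = Defs.eta (Psi g) \Po Defs.eta (Psi k).
Proof. by move=> g1 k1; rewrite Psi_comp // /Defs.eta map_comp_poly. Qed.

(** The iterates of [eta (Psi g)] fix this point and expand about it, so they are bounded there and
    escape nearby. *)
Lemma xfix_Julia g : G g -> Julia F (iota (xfix g)).
Proof.
move=> Gg; have g2 := G2 Gg; have g1 := ltn_trans (ltnSn 1) g2.
pose gk := fix gk n := if n is n'.+1 then gk n' \Po g else g.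
have Ggk n : G (gk n) by elim: n => //= n IH; exact: Gc.
have gkE n w : (Defs.eta (Psi (gk n))).[(xfix g)%:C%C + w] = (xfix g)%:C%C + (deg g ^ n.+1)%:R * w.
  elim: n w => [|n IH] w; first by rewrite eta_Psi_fix // expn1.
  rewrite [gk _]/= eta_Psi_comp ?(ltn_trans (ltnSn 1) (G2 (Ggk n))) //.
  by rewrite horner_comp eta_Psi_fix // IH (expnS _ n.+1) mulnC natrM mulrA.
apply: (@not_normal_Julia R F (fun n => Defs.eta (Psi (gk n))) (xfix g)%:C%C `|xfix g|).
- by move=> n; exists (Psi (gk n)) => //; exists (gk n).
- exact: normr_ge0.
- by move=> n; rewrite -[X in _.[X]]addr0 gkE mulr0 addr0 nc_real.
move=> e e0; have e2 : 0 < e / 2 by rewrite divr_gt0.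
exists ((xfix g)%:C%C + (e / 2)%:C%C) => [|M].
  by rewrite addrC addKr nc_real gtr0_norm //; lra.
have dg : 1 < (deg g)%:R :> R by have := deg_ge2 g2; lra.
have [N NP] := exprn_unbounded ((M + `|xfix g|) / (e / 2)) dg.
exists N => n Nn; rewrite gkE.
have key (a b : C) : nc b <= nc (a + b) + nc a.
  by have := ncB (a + b) a; rewrite addrAC subrr add0r.
have := key (xfix g)%:C%C ((deg g ^ n.+1)%:R * (e / 2)%:C%C).
rewrite [nc (xfix g)%:C%C]nc_real.
rewrite ncM nc_nat nc_real (gtr0_norm e2).
have : (M + `|xfix g|) / (e / 2) < (deg g ^ n.+1)%:R.
  apply: lt_le_trans NP _; rewrite natrX ler_weXn2l ?(ltW dg) //.
  exact: leq_trans Nn (leqnSn n).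
by rewrite ltr_pdivrMr // => a b; lra.
Qed.

Variable b : R.
Hypothesis b0 : 0 < b.
Hypothesis xb : forall g, G g -> `|xfix g| <= b.

Lemma sphere_map_eta g z : (2 < size g)%N ->
  sphere_map (Defs.eta (Psi g)) (Some z) =
  Some ((xfix g)%:C%C + (deg g)%:R * (z - (xfix g)%:C%C) : T).
Proof. by move=> g2; rewrite -eta_Psi_fix // addrCA subrr addr0. Qed.

Lemma eta_far g z (t r : R) : G g -> 0 < r -> t <= nc (z - (xfix g)%:C%C) ->
  r + b <= (deg g)%:R * t ->
  chordal (sphere_map (Defs.eta (Psi g)) (Some z)) (None : S) <= 2 / r.
Proof.
move=> Gg r0 tz rb; rewrite sphere_map_eta ?G2 //; apply: chordal_infty r0 _.
set w := z - _ in tz *.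
have := ncB ((xfix g)%:C%C + (deg g)%:R * w) (xfix g)%:C%C.
rewrite addrAC subrr add0r ncM nc_nat nc_real; have := xb Gg.
have : (deg g)%:R * t <= (deg g)%:R * nc w by rewrite ler_wpM2l.
lra.
Qed.

Lemma eta_equicont_infty : equicont F None.
Proof.
move=> e e0; pose s := (4 / e + b) / 2 + b.
exists [set p : S | if p is Some z then s < nc z else True].
  split=> //; rewrite openE => -[z|] /= zb; last exact: nbhs_infty.
  apply/nbhs_someP; exact: (open_near (open_gt_cont (@nc_cont R)) zb).
move=> _ [z|] [_ [g Gg <-] <-] zs; last by rewrite chordal_refl.
have {}zs : s < nc z by [].
have r0 : 0 < 4 / e by rewrite divr_gt0.
have := @eta_far g z (s - b) (4 / e) Gg r0.
have -> : 2 / (4 / e) = e / 2 by field; rewrite gt_eqF.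
move=> H; apply: (@le_lt_trans _ _ (e / 2)); last by lra.
have d2 : 2 <= (deg g)%:R :> R := deg_ge2 (G2 Gg).
apply: H; last first.
  have : 0 <= (4 / e + b) * ((deg g)%:R - 2) by rewrite mulr_ge0 ?subr_ge0 // addr_ge0 ?ltW.
  by rewrite /s addrK; lra.
have := ncB (z - (xfix g)%:C%C) (- (xfix g)%:C%C); rewrite opprK subrK ncN nc_real.
have := xb Gg; lra.
Qed.

(** A map of large degree sends the points near z, which are at least d/2 from its fixed point,
    close to infinity, since the fixed points are bounded by b. The remaining maps have degree below
    [L] and are uniformly Lipschitz. *)
Lemma eta_equicont z (d : R) : 0 < d -> (forall g, G g -> d <= nc (z - (xfix g)%:C%C)) ->
  equicont F (Some z).
Proof.
move=> d0 zd e e0; pose B := 8 / e + b; pose L := 2 * B / d.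
have r0 : 0 < 8 / e by rewrite divr_gt0.
have B0 : 0 < B by rewrite addr_gt0.
have L0 : 0 < L by rewrite divr_gt0 // mulr_gt0.
pose rho := Num.min (d / 2) (e / (2 * L)).
have rho0 : 0 < rho by rewrite lt_min !divr_gt0 // mulr_gt0.
exists [set (Some w : S) | w in disc z rho].
  split; first exact/open_some/open_disc.
  by exists z => //; exact: disc_center.
move=> _ _ [_ [g Gg <-] <-] [w zw <-].
have wz : nc (w - z) < rho by [].
have [wz1 wz2] : nc (w - z) < d / 2 /\ nc (w - z) < e / (2 * L).
  by apply/andP; rewrite -lt_min.
have [le|gt] := leP B ((deg g)%:R * (d / 2)).
  have wT : d / 2 <= nc (w - (xfix g)%:C%C).
    have := ncB (w - (xfix g)%:C%C) (w - z); have := zd _ Gg.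
    have -> : w - (xfix g)%:C%C - (w - z) = z - (xfix g)%:C%C by ring.
    lra.
  have zT : d / 2 <= nc (z - (xfix g)%:C%C) by have := zd _ Gg; lra.
  have h1 := eta_far Gg r0 wT le; have h2 := eta_far Gg r0 zT le.
  apply: le_lt_trans (chordal_triangle _ _ None) _; rewrite (chordalC None).
  have h3 : 2 / (8 / e) = e / 4 by field; rewrite gt_eqF.
  by rewrite h3 in h1 h2; lra.
rewrite !sphere_map_eta ?G2 //; apply: le_lt_trans (chordal_le _ _) _.
have -> : (xfix g)%:C%C + (deg g)%:R * (w - (xfix g)%:C%C) -
   ((xfix g)%:C%C + (deg g)%:R * (z - (xfix g)%:C%C)) = (deg g)%:R * (w - z) by ring.
rewrite ncM nc_nat.
have dL : (deg g)%:R < L by rewrite /L ltr_pdivlMr //; lra.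
have n0 := nc_ge0 (w - z : C).
set n := nc _ in n0 *; have : n < e / (2 * L) := wz2.
rewrite ltr_pdivlMr; last exact: (mulr_gt0 (ltr0Sn R 1) L0).
move=> lt.
have : (deg g)%:R * n <= L * n by rewrite ler_wpM2r // ltW.
lra.
Qed.

Lemma Julia_eta_sub p : Julia F p -> exists2 x, Mset (PsiS G) x%:E & p = iota x.
Proof.
pose X : set T := [set (xfix g)%:C%C | g in G].
have Xb z : X z -> nc z <= b by move=> [g Gg <-]; rewrite nc_real; exact: xb.
have cb z : closure X z -> nc z <= b.
  have cl : closed [set z : T | nc z <= b] by exact: (closed_le_cont (@nc_cont R)).
  exact: (closure_closed_sub cl Xb).
have cK : compact (closure X) by apply: (closed_bounded_compact (b := b)) cb; exact: closed_closure.
pose U : set S := ~` [set Some z | z in closure X].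
have oU : open U by apply: closed_openC; exact: closed_some.
have Uq q : U q -> equicont F q.
  case: q => [z|_] Uz; last exact: eta_equicont_infty.
  have nz : nbhs z (~` closure X).
    apply: open_nbhs_nbhs; split; first by apply: closed_openC; exact: closed_closure.
    by move=> cz; apply: Uz; exists z.
  have /nbhs_disc[d d0 dP] := nz; apply: (eta_equicont d0) => g Gg.
  rewrite leNgt ncBC; apply/negP => lt; apply: (dP (xfix g)%:C%C lt).
  by apply: subset_closure; exists g.
have FU := equicont_Fatou oU Uq.
move=> Jp; have : [set (Some z : S) | z in closure X] p.
  by apply: contrapT => nU; apply: Jp; exact: FU.
move=> [z cz <-].
have near e : 0 < e -> exists2 g, G g & nc (z - (xfix g)%:C%C) < e.
  move=> e0; have [_ [[g Gg <-] lt]] := cz _ (nbhs_disc_center z e0).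
  by exists g => //; rewrite ncBC.
have imz : complex.Im z = 0.
  apply/eqP; rewrite -normr_le0; apply/ler_addgt0Pr => e e0; rewrite add0r.
  have [g Gg lt] := near e e0.
  have := Im_le_nc (z - (xfix g)%:C%C); rewrite raddfB /= subr0; lra.
exists (complex.Re z); last by rewrite /= [z in LHS]complexE imz mulr0 addr0.
rewrite /Mset repelling_PsiS // => V /nbhs_EFin[e /= e0 eV].
have [g Gg lt] := near e e0; exists (xfix g)%:E; split; first by exists (xfix g) => //; exists g.
apply: eV => /=; apply: le_lt_trans lt.
by have := Re_le_nc (z - (xfix g)%:C%C); rewrite raddfB.
Qed.

Lemma Mset_Julia x : Mset (PsiS G) x%:E -> Julia F (iota x).
Proof.
rewrite /Mset repelling_PsiS // => Mx.
rewrite (closure_id (Julia F)).1; last exact: closed_Julia.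
move=> V /nbhs_someP[e e0 eV].
have [|_ [[_ [g Gg <-] <-] gx]] := Mx [set y : \bar R | exists2 t : R, y = t%:E & `|t - x| < e].
  by apply/nbhs_EFin; exists e => //= t xt; exists t => //; rewrite distrC.
have {}gx : `|xfix g - x| < e by case: gx => t [->].
exists (iota (xfix g)); split; first exact: xfix_Julia.
by apply: eV; rewrite -rmorphB nc_real.
Qed.
End EtaPsi.

Lemma set_inj_card_le (T U : Type) (A : set T) (B : set U) (f : T -> U) :
  set_fun A B f -> set_inj A f -> (A #<= B)%card.
Proof.
move=> fAB fI; rewrite -(card_le_eql (inj_card_eq fI)).
by apply: subset_card_le => _ [x Ax <-]; exact: fAB.
Qed.

(** * Cardinalities and assembly *)

Section CalG.
Variable R : realType.
Local Notation C := (complex R).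
Local Notation T := (cplane R).
Local Notation S := (rsphere R).
Local Notation iota := (fun x : R => Some (real_complex R x) : S).

(** The Julia set of the affine semigroup lies on the real axis over M(Psi(G)); projecting to the
    real part sends a connected subset of it to a connected subset of M(Psi(G)), so points of
    different components of M(Psi(G)) stay in different components. *)
Lemma eta_components_card (G : set {poly C}) (b : R) :
  (forall g k, G g -> G k -> G (g \Po k)) -> (forall g, G g -> (2 < size g)%N) ->
  0 < b -> (forall g, G g -> `|xfix g| <= b) -> Mset (PsiS G) `<=` range (@EFin R) ->
  (M_components (PsiS G) #<= Julia_components_hat (etaS (PsiS G)))%card.
Proof.
move=> Gc G2 b0 xb Mr; pose pt (K : set (\bar R)) := fine (get K).
have ptP K : M_components (PsiS G) K -> K (pt K)%:E /\ Mset (PsiS G) (pt K)%:E.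
  move=> [y My <-]; set K' := connected_component _ y.
  have Kg : K' (get K') by apply: getPex; exists y; exact: connected_component_refl.
  have Mg : Mset (PsiS G) (get K') by exact: (connected_component_sub Kg).
  by have [x _ xE] := Mr _ Mg; rewrite /pt -xE /= xE.
have KE K : M_components (PsiS G) K -> K = connected_component (Mset (PsiS G)) (pt K)%:E.
  by move=> hK; have [+ _] := ptP _ hK; case: hK => y _ <-; exact: same_connected_component.
apply: (@set_inj_card_le _ _ _ _ (fun K => connected_component (Julia (etaS (PsiS G))) (iota (pt K)))).
  by move=> K hK; exists (iota (pt K)) => //; apply: (Mset_Julia Gc G2); exact: (ptP _ hK).2.
move=> K K' /set_mem hK /set_mem hK' E.
rewrite (KE _ hK) (KE _ hK'); apply: same_connected_component.
have : connected_component (Julia (etaS (PsiS G))) (iota (pt K)) (iota (pt K')).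
  by rewrite E; apply: connected_component_refl; apply: (Mset_Julia Gc G2); exact: (ptP _ hK').2.
move=> [L [Lx LJ cL] Lx'].
(* The value at infinity is a default: [L] consists of real points. *)
pose rho (p : S) : \bar R := if p is Some z then (complex.Re z)%:E else 0%E.
exists (rho @` L); last by exists (iota (pt K')).
split; first by exists (iota (pt K)).
  by move=> _ [p /LJ/(Julia_eta_sub G2 b0 xb)[x Mx ->] <-].
apply: connected_continuous_connected cL _; apply: continuous_in_subspaceT => p /set_mem/LJ.
move=> /(Julia_eta_sub G2 b0 xb)[x _ ->] V /nbhs_EFin[e /= e0 eV].
apply/nbhs_someP; exists e => // w wx; apply: eV => /=; apply: le_lt_trans wx.
by rewrite ncBC; have := Re_le_nc (x%:C%C - w); rewrite raddfB.
Qed.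

Lemma calG_setup (G : set {poly C}) : calG G -> exists h r R0,
  [/\ (forall g k, G g -> G k -> G (g \Po k)), (forall g c, G g -> root g^`() c -> nc g.[c] <= R0),
      G h, escape_radius h r & R0 < r].
Proof.
move=> [[A [[h Ah] A1 GE]] G2 /bounded_set_nc[b b0 bP]].
have Gh : G h by rewrite GE; exact: generated_by.
have [r br hr] := escape_radius_exists (G2 h Gh) b.
exists h, r, b; split => //.
  by move=> g k; rewrite GE; exact: generated_comp.
move=> g c Gg gc; apply: bP; apply: subset_closure; exists g => //.
by exists (Some c).
Qed.

End CalG.

Theorem theorem2p12 (R : realType) :
  (forall G : set {poly complex R}, calG G ->
    (Julia_components_hat G #<= M_components (PsiS G))%card /\
    exists tPsi : set (rsphere R) -> set (\bar R),
      [/\ set_fun (Julia_components_hat G) (M_components (PsiS G)) tPsi,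
          set_inj (Julia_components_hat G) tPsi
        & forall J1 J2 : set (rsphere R),
            Julia_components G J1 -> Julia_components G J2 ->
            surround_lt (finite_part J1) (finite_part J2) ->
            ltr_sets (tPsi J1) (tPsi J2)]) /\
  (forall G : set {poly complex R}, calG_dis G ->
    Mset (PsiS G) `<=` range (@EFin R) /\
    (fun x : R => Some (real_complex R x) : rsphere R)
      @` [set x : R | Mset (PsiS G) x%:E] = Julia (etaS (PsiS G))) /\
  (forall G : set {poly complex R}, calG G ->
    (Julia_components_hat G #<= Julia_components_hat (etaS (PsiS G)))%card).
Proof.
have part1 (G : set {poly complex R}) : calG G -> exists tPsi, order_embedding G tPsi.
  move=> cG; have [h [r [R0 [Gc crit Gh hr rR0]]]] := calG_setup cG; have [_ G2 _] := cG.
  exact: (order_embedding_exists Gc G2 crit Gh hr rR0).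
have part2 (G : set {poly complex R}) : calG G -> ~ connected (Julia G) -> Mset (PsiS G) `<=` range (@EFin R) /\
    exists2 b : R, 0 < b & forall g, G g -> `|xfix g| <= b.
  move=> cG nJ; have [h [r [R0 [Gc crit Gh hr rR0]]]] := calG_setup cG; have [_ G2 _] := cG.
  have [b ub] := caps_bounded_disconnected Gc G2 crit Gh hr rR0 nJ.
  have MP := Mset_bounded Gc G2 Gh ub.
  split; first by move=> y /MP[x -> _]; exists x.
  exists (`|b| + 1); first by rewrite ltr_wpDl.
  move=> g Gg; have [|x [<-] xb] := MP (xfix g)%:E.
    by rewrite /Mset repelling_PsiS //; apply: subset_closure; exists (xfix g) => //; exists g.
  by have := ler_norm b; lra.
have part3 (G : set {poly complex R}) : calG G -> (Julia_components_hat G #<= M_components (PsiS G))%card.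
  by move=> /part1[f [f1 f2 _]]; exact: set_inj_card_le f1 f2.
split; [|split] => G cG.
- by split; [exact: part3|exact: part1].
- case: cG => cG nJ; have [Mr [b b0 xb]] := part2 G cG nJ; split => //.
  have [h [r [R0 [Gc crit Gh hr rR0]]]] := calG_setup cG; have [_ G2 _] := cG.
  apply/seteqP; split => [_ [x Mx <-]|p]; first exact: Mset_Julia.
  by move=> /(Julia_eta_sub G2 b0 xb)[x Mx ->]; exists x.
- have [h [r [R0 [Gc crit Gh hr rR0]]]] := calG_setup cG; have [_ G2 _] := cG.
  have [cJ|nJ] := pselect (connected (Julia G)).
    have JE K : Julia_components_hat G K -> K = Julia G.
      by move=> [p Jp <-]; exact: connected_component_id.
    apply: (@set_inj_card_le _ _ _ _ (fun=> connected_component (Julia (etaS (PsiS G)))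
      (Some (real_complex R (xfix h)) : rsphere R))).
      by move=> K _; exists (Some (real_complex R (xfix h)) : rsphere R) => //; exact: xfix_Julia.
    by move=> K K' /set_mem/JE-> /set_mem/JE->.
  have [Mr [b b0 xb]] := part2 G cG nJ.
  apply: (card_le_trans (part3 G cG)).
  exact: (eta_components_card Gc G2 b0 xb Mr).
Qed.
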